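(* Fix parameters $0<w\le 1$ and $0<\delta\le 1$. Let $v\colon \mathbb{R}^2\to[0,1]$ be a function depending only on the horizontal variable, i.e. $v(a,b)=v(a)$. Let $\mathcal{R}_\delta$ be the collection of all rectangles $R$ of width $w$ such that $|V_R|\ge \delta |R|$. Then for every $f\in L^2(\mathbb{R}^2)$, $$\|M_{\mathcal{R}_\delta} f\|_{2}\le C\left(\log \tfrac{1}{\delta}\right)^{3/2}\|f\|_{2},$$ where $C$ is a universal constant (independent of $w$, $\delta$, $v$ and $f$).
   Context: For a collection of rectangles $\mathcal{R}$ in $\mathbb{R}^2$, the maximal operator is $M_{\mathcal{R}} f(x)=\sup_{x\in R\in\mathcal{R}} \frac{1}{|R|}\int_R f$. For a rectangle $R$, $L(R)$ denotes its length (long side), $w(R)$ its width (short side), and $\theta(R)$ is the interval of width $w(R)/L(R)$ centered at the slope of the long side of $R$. Given the slope field $v$, $V_R=\{p\in R: v(p)\in\theta(R)\}$. $|\cdot|$ denotes Lebesgue measure.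
   Formalization: The factor (log 1/δ)^{3/2} is replaced by (1+log 1/δ)^{3/2}, since at δ=1 (take v=0, horizontal rectangles) the literal right side is 0 while Mf≠0; for δ≤1/2 the two agree up to a universal constant. The field v is assumed Borel measurable, so that |V_R| is defined. *)

(* Defs.v *)
From HB Require Import structures.
From mathcomp Require Import all_boot all_order all_algebra.
From mathcomp Require Import all_classical all_reals all_analysis.
Set Implicit Arguments. Unset Strict Implicit. Unset Printing Implicit Defensive.
Import Order.TTheory GRing.Theory Num.Theory.
Local Open Scope classical_set_scope.
Local Open Scope ring_scope.

Definition leb2 (R : realType) :=
  ((@lebesgue_measure R) \x (@lebesgue_measure R))%E.

(* An (open) rectangle in the plane.  Its long side has slope [rslope], i.e.
   direction (1, rslope)/sqrt(1+rslope^2); its length (long side) is [rlen],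
   its width (short side) is [rwid], with 0 < rwid <= rlen; [rc] is its center.
   (Rectangles with vertical long side have no finite slope; they can never
   belong to the collections considered below.) *)
Record rect (R : realType) := Rect {
  rc : R * R ; rslope : R ; rlen : R ; rwid : R }.

Definition rect_wf (R : realType) (Q : rect R) :=
  0 < rwid Q /\ rwid Q <= rlen Q.

Definition rect_set (R : realType) (Q : rect R) : set (R * R) :=
  [set p | let n := Num.sqrt (1 + rslope Q ^+ 2) in
           let d1 := p.1 - (rc Q).1 in let d2 := p.2 - (rc Q).2 in
           `|d1 + rslope Q * d2| / n < rlen Q / 2 /\
           `|- rslope Q * d1 + d2| / n < rwid Q / 2].

Definition theta (R : realType) (Q : rect R) : set R :=
  `[rslope Q - rwid Q / rlen Q / 2, rslope Q + rwid Q / rlen Q / 2]%classic.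

Definition VR (R : realType) (v : R * R -> R) (Q : rect R) : set (R * R) :=
  rect_set Q `&` [set p | theta Q (v p)].

Definition Rdelta (R : realType) (w delta : R) (v : R * R -> R) : set (rect R) :=
  [set Q | rect_wf Q /\ rwid Q = w /\
           (@leb2 R (VR v Q) >= delta%:E * @leb2 R (rect_set Q))%E].

(* Maximal operator M_C f(x) = sup_{x in Q in C} (1/|Q|) int_Q |f|
   (value 0 when no rectangle of C contains x). *)
Definition maxop (R : realType) (C : set (rect R)) (f : R * R -> R)
  (x : R * R) : \bar R :=
  ereal_sup ([set 0%E] `|`
    [set ((@leb2 R (rect_set Q))^-1 *
          \int[@leb2 R]_(p in rect_set Q) (`|f p|)%:E)%E
      | Q in [set Q | C Q /\ rect_set Q x]]).

(* Main.v *)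
(* The theorem is discretized on a grid of cells of side w, where rectangles become
   tubes over dyadic tiles (interval of columns) x (interval of slopes), the one-third
   trick providing the dyadic intervals.  A tile is good when the slope field lies in
   its slope interval on a proportion delta of its columns; slope intervals of tiles
   over one interval of columns being disjoint, good tiles satisfy a Carleson
   condition with constant 1 / delta.

   For a finite family of good tubes a Vitali selection extracts a subfamily S whose
   union W is comparable to the original one, and each point of W is charged to one
   tube of S.  Let Phi be the sum over S of the averages of the charges: its integral
   is |W|, and if the averages of F over the tubes exceed t then t |W| <= int F Phi.
   The Carleson condition gives int Phi^3 <= C delta^-2 |W|.  For the second moment,
   off an exceptional set at most delta^-2 slopes are relevant; shearing reduces the
   interaction of the tubes to strong maximal averages of a set, and the L log L
   inequality of the strong dyadic maximal function yields
   int Phi^2 <= C log(1/delta)^2 |W|.  Interpolating these bounds over the levels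
   t = 4^k, each point contributing to O(log(1/delta)) of them, gives the cube of the
   logarithm for the square of the norm. *)

Require Import Defs.
From HB Require Import structures.
From mathcomp Require Import all_boot all_order all_algebra.
From mathcomp Require Import all_classical all_reals all_analysis.
From mathcomp Require Import measurable_realfun simple_functions zify ring lra.
Set Implicit Arguments. Unset Strict Implicit. Unset Printing Implicit Defensive.
Import Order.TTheory GRing.Theory Num.Theory.
Local Open Scope ring_scope.

(** * Dyadic maximal functions *)

(** The obstacle is that a good tile allows a whole interval of slopes and that there is no bound on
    the number of scales. With slopes chosen freely, the tubes over one column could use a new slope
    at each scale, and nothing would bound the number of tubes through a point. With inherited
    slopes, the tubes of level at most k over a column use no more slopes than there are good tiles
    with minimal slope interval, and the selection leaves at most one tube per slope through a
    point. All moment bounds rest on this count. In the second moment there is one error term for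
    each direction of shearing. Each carries a free parameter e that costs only log(1/e)^2, so e =
    delta^2 pays for the delta^-2 slopes relevant to one tube; this is how a polynomial number of
    slopes turns into a logarithm. The third moment may lose a power of delta because it is used
    only where F exceeds the level by a factor of order delta^-2, and there the sum over the levels
    is geometric. *)

Definition dsum (V : nmodType) (k i : nat) (f : nat -> V) : V :=
  \sum_(n <- iota (i * 2 ^ k) (2 ^ k)) f n.

Lemma mem_dyadic k i n : (n \in iota (i * 2 ^ k) (2 ^ k)) = (n %/ 2 ^ k == i)%N.
Proof.
have h : (0 < 2 ^ k)%N by rewrite expn_gt0.
rewrite mem_iota; apply/idP/eqP => [/andP[h1 h2]|<-].
  apply/eqP; rewrite eqn_leq leq_divRL // h1 andbT -ltnS ltn_divLR //.
  by rewrite mulSn addnC.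
by rewrite leq_divM /= addnC -mulSn ltn_ceil.
Qed.

Lemma dsum0 (V : nmodType) i (f : nat -> V) : dsum 0 i f = f i.
Proof. by rewrite /dsum expn0 muln1 /= big_cons big_nil addr0. Qed.

Lemma dsumS (V : nmodType) k i (f : nat -> V) :
  dsum k.+1 i f = dsum k (2 * i)%N f + dsum k (2 * i).+1 f.
Proof.
rewrite /dsum expnS -[(2 * 2 ^ k)%N]/(2 ^ k + (2 ^ k + 0))%N addn0 iotaD big_cat.
by congr (_ + _); congr (\sum_(n <- iota _ _) _); lia.
Qed.

Lemma eq_dsum (V : nmodType) k i (f g : nat -> V) :
  (forall n, (n %/ 2 ^ k = i)%N -> f n = g n) -> dsum k i f = dsum k i g.
Proof. by move=> h; apply: eq_big_seq => n; rewrite mem_dyadic => /eqP; apply: h. Qed.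

Lemma ltn_expP n k : (n < 2 ^ k)%N = (n %/ 2 ^ k == 0)%N.
Proof. by rewrite -mem_dyadic mul0n mem_iota. Qed.

Section Dyadic.
Variable R : realType.
Implicit Types f g h : nat -> R.

Lemma le_dsum k i f g :
  (forall n, (n %/ 2 ^ k = i)%N -> f n <= g n) -> dsum k i f <= dsum k i g.
Proof.
move=> h; rewrite /dsum [leLHS]big_seq [leRHS]big_seq.
by apply: ler_sum => n; rewrite mem_dyadic => /eqP; apply: h.
Qed.

Lemma dsum_ge0 k i f : (forall n, 0 <= f n) -> 0 <= dsum k i f.
Proof. by move=> h; apply: sumr_ge0. Qed.

Lemma dsum_const k i (c : R) : dsum k i (fun=> c) = (2 ^ k)%N%:R * c.
Proof.
by rewrite /dsum big_const_seq count_predT size_iota iter_addr_0 mulr_natl.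
Qed.

Lemma dsumD k i f g : dsum k i (fun n => f n + g n) = dsum k i f + dsum k i g.
Proof. by rewrite /dsum big_split. Qed.

Lemma dsumZ k i c f : dsum k i (fun n => c * f n) = c * dsum k i f.
Proof. by rewrite /dsum mulr_sumr. Qed.

Lemma dsum_sum (I : Type) (s : seq I) (P : pred I) k i (F : I -> nat -> R) :
  dsum k i (fun n => \sum_(x <- s | P x) F x n) = \sum_(x <- s | P x) dsum k i (F x).
Proof. by rewrite /dsum exchange_big. Qed.

Lemma ler_dsum_term k i f n : (forall n, 0 <= f n) -> (n %/ 2 ^ k = i)%N ->
  f n <= dsum k i f.
Proof.
move=> f0 hn; have : n \in iota (i * 2 ^ k) (2 ^ k) by rewrite mem_dyadic hn.
move=> nin; rewrite /dsum (bigD1_seq n) ?iota_uniq //= lerDl.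
by apply: sumr_ge0.
Qed.

(* If an inequality holds on every dyadic interval of length [2 ^ k], it holds on the longer ones. *)
Lemma le_dsum_coarse k k0 i0 f g : (k <= k0)%N ->
  (forall i, dsum k i f <= dsum k i g) -> dsum k0 i0 f <= dsum k0 i0 g.
Proof.
move=> /subnK <-; elim: (k0 - k)%N i0 => [|d IH] i0 h; first exact: h.
by rewrite addSn !dsumS lerD // IH.
Qed.

Definition avg k i f : R := dsum k i f / (2 ^ k)%N%:R.

Fixpoint dmax k f n : R :=
  if k is k'.+1 then Num.max (avg k (n %/ 2 ^ k) f) (dmax k' f n) else f n.

Lemma avg_le_dmax l k f n : (l <= k)%N -> avg l (n %/ 2 ^ l) f <= dmax k f n.
Proof.
elim: k => [|k IH]; first by rewrite leqn0 => /eqP ->; rewrite /avg dsum0 /= divn1 divr1.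
rewrite leq_eqVlt => /orP[/eqP ->|/IH h] /=; rewrite le_max ?lexx // h orbT //.
Qed.

Lemma natr_exp2_gt0 k : 0 < (2 ^ k)%N%:R :> R.
Proof. by rewrite ltr0n expn_gt0. Qed.

Lemma dmax_range k f n : (forall n, 0 <= f n <= 1) -> 0 <= dmax k f n <= 1.
Proof.
move=> h; elim: k => [|k /andP[IH0 IH1]] //=; rewrite le_max IH0 orbT /= ge_max IH1 andbT.
rewrite /avg ler_pdivrMr ?natr_exp2_gt0 // mul1r -[leRHS]mulr1 -(dsum_const k.+1 (n %/ 2 ^ k.+1)).
by apply: le_dsum => m _; case/andP: (h m).
Qed.

Lemma le_dmax k f g n : (forall n, f n <= g n) -> dmax k f n <= dmax k g n.
Proof.
move=> h; elim: k => [|k IH] /=; first exact: h.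
rewrite ge_max !le_max IH orbT andbT; apply/orP; left.
by rewrite ler_wpM2r ?invr_ge0 ?ler0n // le_dsum.
Qed.

Lemma dmaxD_const k f c n : dmax k (fun n => c + f n) n = c + dmax k f n.
Proof.
elim: k => [|k IH] //=; rewrite IH addr_maxr; congr (Num.max _ _).
by rewrite /avg dsumD dsum_const mulrDl mulrAC divff ?mul1r // pnatr_eq0 -lt0n expn_gt0.
Qed.

Definition pos (x : R) : R := Num.max 0 x.

Lemma pos_ge0 x : 0 <= pos x. Proof. by rewrite /pos le_max lexx. Qed.
Lemma le_pos x : x <= pos x. Proof. by rewrite /pos le_max lexx orbT. Qed.
Lemma pos_le x y : x <= y -> pos x <= pos y.
Proof. by move=> h; rewrite /pos ge_max !le_max lexx /= h orbT. Qed.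
Lemma pos_le_ge0 x y : 0 <= y -> x <= y -> pos x <= y.
Proof. by move=> h0 h; rewrite /pos ge_max h0. Qed.

(** This is [ln x <= x - 1] at [x = m / a], multiplied by [a]: raising the level from [m] to the
    average [a] is paid for by the decrease of the logarithm. *)
Lemma ln_inv_step (a m : R) : 0 < m -> m < a -> (a - m) + ln a^-1 * a <= ln m^-1 * a.
Proof.
move=> m0 ma; have a0 : 0 < a by apply: lt_trans ma.
have h : ln (1 + (m / a - 1)) <= m / a - 1.
  by apply: le_ln1Dx; rewrite ltrBrDr addNr divr_gt0.
have e : ln (1 + (m / a - 1)) = ln a^-1 - ln m^-1.
  by rewrite addrCA subrr addr0 lnM ?posrE ?invr_gt0 // !lnV ?posrE //; ring.
rewrite e in h; have {}h : (ln a^-1 - ln m^-1) * a <= m - a.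
  by apply: le_trans (ler_wpM2r (ltW a0) h) _; rewrite mulrBl divfK ?gt_eqF ?mul1r.
lra.
Qed.

(* Dyadic L log L inequality: the level [m] is raised to the average whenever the latter exceeds it. *)
Lemma dmax_llogl k i f m : (forall n, 0 <= f n <= 1) -> 0 < m <= 1 ->
  dsum k i (fun n => pos (dmax k f n - m)) <= ln m^-1 * dsum k i f.
Proof.
move=> f01; have f0 n : 0 <= f n by case/andP: (f01 n).
have hln (x : R) : 0 < x <= 1 -> 0 <= ln x^-1.
  by case/andP=> x0 x1; rewrite ln_ge0 ?invf_ge1.
elim: k i m => [|k IH] i m /andP[m0 m1].
  rewrite !dsum0 /=; have /andP[fi0 fi1] := f01 i.
  apply: pos_le_ge0; first by rewrite mulr_ge0 ?hln // m0.
  case: (ltP m (f i)) => [mf|fm]; last first.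
    by rewrite (@le_trans _ _ 0) ?subr_le0 ?mulr_ge0 ?hln ?m0.
  apply: le_trans (ln_inv_step m0 mf); rewrite lerDl mulr_ge0 ?hln ?fi1 ?andbT //.
  by apply: lt_trans mf.
set a := avg k.+1 i f.
have hN := @natr_exp2_gt0 k.+1.
have ea : dsum k.+1 i f = a * (2 ^ k.+1)%N%:R by rewrite /a /avg divfK ?gt_eqF.
have a1 : a <= 1.
  rewrite /a /avg ler_pdivrMr // mul1r -[leRHS]mulr1 -(dsum_const k.+1 i).
  by apply: le_dsum => n _; case/andP: (f01 n).
have split2 (c : R) : dsum k.+1 i (fun n => pos (dmax k f n - c)) <= ln c^-1 * dsum k.+1 i f
    \/ ~~ (0 < c <= 1).
  case: (boolP (0 < c <= 1)) => [hc|]; last by right.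
  by left; rewrite !dsumS mulrDr lerD ?IH.
case: (ltP m a) => [ma|am].
  have a0 : 0 < a by apply: lt_trans ma.
  have {split2} h : dsum k.+1 i (fun n => pos (dmax k f n - a)) <= ln a^-1 * dsum k.+1 i f.
    by case: (split2 a); rewrite ?a0 ?a1.
  apply: (@le_trans _ _ (dsum k.+1 i (fun n => (a - m) + pos (dmax k f n - a)))).
    apply: le_dsum => n hn /=; rewrite hn -/a.
    apply: pos_le_ge0; first by rewrite addr_ge0 ?pos_ge0 // subr_ge0 ltW.
    rewrite lerBlDr ge_max; apply/andP; split.
      by have := pos_ge0 (dmax k f n - a); lra.
    by have := le_pos (dmax k f n - a); lra.
  rewrite dsumD dsum_const; apply: le_trans (lerD (lexx _) h) _.
  have h2 := ler_wpM2r (ltW hN) (ln_inv_step m0 ma).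
  rewrite ea; clearbody a; lra.
case: (split2 m); last by rewrite m0 m1.
apply: le_trans; apply: le_dsum => n hn /=; rewrite hn -/a.
apply: pos_le_ge0; first exact: pos_ge0.
rewrite lerBlDr ge_max; apply/andP; split.
  by have := pos_ge0 (dmax k f n - m); lra.
by have := le_pos (dmax k f n - m); lra.
Qed.

(** An iterated maximal function: it dominates the strong dyadic maximal function and can be treated
    one variable at a time. *)
Definition dmax2 K H (f : nat -> nat -> R) (n u : nat) : R :=
  dmax K (fun n' => dmax H (f n') u) n.

(** The inner maximal function is at most [e] plus its excess over [e], and this excess again takes
    values in [0, 1]. A second use of the inequality in one variable, at level [e], explains the
    threshold [2 * e] and the square of the logarithm. *)
Lemma dmax2_llogl K H (f : nat -> nat -> R) e : (forall n u, 0 <= f n u <= 1) -> 0 < e <= 1 ->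
  dsum K 0 (fun n => dsum H 0 (fun u => pos (dmax2 K H f n u - 2 * e))) <=
  ln e^-1 ^+ 2 * dsum K 0 (fun n => dsum H 0 (f n)).
Proof.
move=> f01 he; have le0 : 0 <= ln e^-1.
  by case/andP: he => e0 e1; rewrite ln_ge0 ?invf_ge1.
have e0 : 0 <= e by case/andP: he => /ltW.
rewrite expr2 -mulrA.
apply: (@le_trans _ _ (ln e^-1 *
    dsum K 0 (fun n => dsum H 0 (fun u => pos (dmax H (f n) u - e))))); last first.
  rewrite ler_wpM2l // -dsumZ; apply: le_dsum => n _; exact: dmax_llogl.
rewrite /dsum exchange_big /= [X in _ <= _ * X]exchange_big /= mulr_sumr.
apply: ler_sum => u _; rewrite -!/(dsum _ _ _).
set h' := fun n => pos (dmax H (f n) u - e).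
have h'01 n : 0 <= h' n <= 1.
  have /andP[d0 d1] := @dmax_range H (f n) u (f01 n).
  by rewrite /h' pos_ge0 /= pos_le_ge0 //; lra.
apply: le_trans (dmax_llogl _ _ h'01 he); apply: le_dsum => n _; apply: pos_le.
have h : dmax2 K H f n u <= dmax K (fun n => e + h' n) n.
  apply: le_dmax => n'; have := le_pos (dmax H (f n') u - e).
  rewrite /h'; lra.
rewrite dmaxD_const in h; lra.
Qed.

Lemma avg_le_dmax2 K H k r (f : nat -> nat -> R) n u : (k <= K)%N -> (r <= H)%N ->
  dsum k (n %/ 2 ^ k) (fun n' => dsum r (u %/ 2 ^ r) (f n')) <=
  (2 ^ k)%N%:R * (2 ^ r)%N%:R * dmax2 K H f n u.
Proof.
move=> kK rH; rewrite -mulrA -ler_pdivrMl ?natr_exp2_gt0 //.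
apply: (@le_trans _ _ ((2 ^ r)%N%:R * avg k (n %/ 2 ^ k) (fun n' => dmax H (f n') u))); last first.
  by rewrite ler_wpM2l ?ler0n //; exact: avg_le_dmax.
rewrite /avg mulrA [leRHS]mulrC ler_wpM2l ?invr_ge0 ?ler0n // -dsumZ.
apply: le_dsum => n' _; rewrite -ler_pdivrMl ?natr_exp2_gt0 // mulrC.
exact: avg_le_dmax.
Qed.

End Dyadic.

(** * Good tiles and their slopes *)

Lemma sum_nat_atmost1 (R : realDomainType) (b : nat -> bool) N :
  (forall k k', (k < k' < N)%N -> b k -> b k' -> False) ->
  \sum_(k < N) (b k)%:R <= 1 :> R.
Proof.
elim: N => [|N IH] h; first by rewrite big_ord0.
rewrite big_ord_recr /=; case bN: (b N); last first.
  by rewrite addr0 IH // => k k' /andP[h1 h2]; apply: h; rewrite h1 ltnS ltnW.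
rewrite big1 ?add0r // => k _; case bk: (b k) => //.
by case: (h k N) => //; rewrite ltn_ord /=.
Qed.

Lemma sqr_sum_le (R : realDomainType) (c : nat -> R) N : (forall k, 0 <= c k) ->
  (\sum_(k < N) c k) ^+ 2 <= 2 * \sum_(k < N) (c k * \sum_(k' < k.+1) c k').
Proof.
move=> c0; elim: N => [|N IH]; first by rewrite !big_ord0 expr0n mulr0.
rewrite !big_ord_recr /=; set s := \sum_(i < N) _ in IH *.
set t := \sum_(i < N) _ in IH *.
have : 0 <= c N ^+ 2 by rewrite sqr_ge0.
nra.
Qed.

Lemma divn_expK (a e d : nat) : ((a %/ 2 ^ e) %/ 2 ^ d = a %/ 2 ^ (d + e))%N.
Proof. by rewrite -divnMA -expnD addnC. Qed.

Section Tiles.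
Variables (R : realType) (K : nat) (m : nat -> nat -> R) (delta : R).
Hypothesis m0 : forall n a, 0 <= m n a.
Hypothesis m1 : forall n, \sum_(a < 2 ^ K.+1) m n a <= 1.
Hypothesis delta0 : 0 < delta.

(* [m n a] is the proportion of column [n] where the slope field lies in
   [a / 2 ^ K, (a + 1) / 2 ^ K).  The tile (k, i, j) consists of the columns in
   [i 2 ^ k, (i + 1) 2 ^ k) and the slopes in [j / 2 ^ k, (j + 1) / 2 ^ k). *)
Definition tmass k n j : R := \sum_(a < 2 ^ K.+1 | (a %/ 2 ^ (K - k))%N == j) m n a.

Definition good k i j : bool :=
  (k <= K)%N && (delta * (2 ^ k)%N%:R <= dsum k i (fun n => tmass k n j)).

(** The tiles over column [n] that are minimal, for inclusion of slope intervals, among the good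
    ones of level at most [k1]. In [rcount] a second level [k0] bounds the tiles counted, because
    [carleson2] sums the short ones among those minimal up to a larger level. *)
Definition rmin k1 k n j : bool :=
  [&& good k (n %/ 2 ^ k) j, (k <= k1)%N &
  `[< forall k' j', (k < k' <= k1)%N -> (j' %/ 2 ^ (k' - k) = j)%N ->
      ~~ good k' (n %/ 2 ^ k') j' >]].

Definition rcount n k0 k1 : R :=
  \sum_(k < k0.+1) \sum_(j < 2 ^ K.+1) (rmin k1 k n j)%:R.

(** The range [2 ^ K.+1], that is slopes in [0, 2), leaves room for the value 1 of the slope field,
    of index [2 ^ K], and for the coarse slope intervals containing it. *)
Lemma good_lt k i j : good k i j -> (j < 2 ^ K.+1)%N.
Proof.
case/andP=> kK h; rewrite ltnNge; apply/negP => jb; move: h; apply/negP.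
rewrite -ltNge /dsum big1 => [|n _]; first by rewrite mulr_gt0 ?natr_exp2_gt0.
rewrite /tmass big1 // => a /eqP ha; exfalso.
have := ltn_ord a; have := leq_div (nat_of_ord a) (2 ^ (K - k)); lia.
Qed.

Lemma rmin_eq k1 k n n' j : (n %/ 2 ^ k = n' %/ 2 ^ k)%N -> rmin k1 k n j = rmin k1 k n' j.
Proof.
move=> e; rewrite /rmin e; congr [&& _, _ & _].
have e' k' : (k <= k')%N -> (n %/ 2 ^ k' = n' %/ 2 ^ k')%N.
  by move=> /subnK <-; rewrite -!divn_expK e.
by apply: asbool_equiv_eq; split=> h k' j' hk' hj'; have := h k' j' hk' hj';
  rewrite e' //; case/andP: hk' => /ltnW.
Qed.

Lemma rmin_disj k1 k k' n a : (k < k')%N ->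
  rmin k1 k n (a %/ 2 ^ (K - k))%N -> rmin k1 k' n (a %/ 2 ^ (K - k'))%N -> False.
Proof.
move=> kk' /and3P[_ _ /asboolP h] /and3P[g hk1 _].
have kK : (k' <= K)%N by case/andP: g.
suff : ~~ good k' (n %/ 2 ^ k')%N (a %/ 2 ^ (K - k'))%N by rewrite g.
apply: h; first by rewrite kk'.
by rewrite divn_expK; congr (_ %/ 2 ^ _)%N; lia.
Qed.

(** Minimality makes the slope intervals of different levels disjoint over a column. Goodness bounds
    the mass from below only on average, so it is used on intervals of length [2 ^ k], where [rmin]
    at level [k] is constant, and then summed. *)
Lemma carleson k0 k1 i0 : (k0 <= K)%N ->
  dsum k0 i0 (fun n => rcount n k0 k1) * delta <= (2 ^ k0)%N%:R.
Proof.
move=> k0K; rewrite mulrC -dsumZ.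
apply: (@le_trans _ _ (dsum k0 i0 (fun n =>
   \sum_(k < k0.+1) \sum_(j < 2 ^ K.+1) ((rmin k1 k n j)%:R * tmass k n j)))).
  have -> : dsum k0 i0 (fun n => delta * rcount n k0 k1) =
     \sum_(k < k0.+1) \sum_(j < 2 ^ K.+1) dsum k0 i0 (fun n => delta * (rmin k1 k n j)%:R).
    under [RHS]eq_bigr do rewrite -dsum_sum.
    rewrite -dsum_sum; apply: eq_dsum => n _; rewrite /rcount mulr_sumr.
    by apply: eq_bigr => k _; rewrite mulr_sumr.
  rewrite dsum_sum; apply: ler_sum => k _; rewrite dsum_sum; apply: ler_sum => j _.
  apply: (@le_dsum_coarse _ k); first by rewrite -ltnS.
  move=> i; have e n : (n %/ 2 ^ k = i)%N -> rmin k1 k n j = rmin k1 k (i * 2 ^ k) j.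
    by move=> h; apply: rmin_eq; rewrite h mulnK ?expn_gt0.
  rewrite [leLHS](eq_dsum (g := fun n => delta * (rmin k1 k (i * 2 ^ k) j)%:R)); last first.
    by move=> n hn /=; rewrite (e n hn).
  rewrite [leRHS](eq_dsum (g := fun n => (rmin k1 k (i * 2 ^ k) j)%:R * tmass k n j)); last first.
    by move=> n hn /=; rewrite (e n hn).
  rewrite !dsumZ dsum_const; case hr: (rmin _ _ _ _); last by rewrite !mulr0 mul0r.
  rewrite mulr1 mul1r; case/and3P: hr => /andP[_ ].
  by rewrite mulnK ?expn_gt0.
rewrite -[leRHS]mulr1 -(dsum_const k0 i0); apply: le_dsum => n _.
apply: le_trans (m1 n).
have -> : \sum_(k < k0.+1) \sum_(j < 2 ^ K.+1) (rmin k1 k n j)%:R * tmass k n j =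
   \sum_(a < 2 ^ K.+1) m n a * \sum_(k < k0.+1) \sum_(j < 2 ^ K.+1 | (a %/ 2 ^ (K - k))%N == j)
      (rmin k1 k n j)%:R.
  rewrite exchange_big /= [RHS](eq_bigr (fun a : 'I_ _ => \sum_(k < k0.+1)
     \sum_(j < 2 ^ K.+1 | (a %/ 2 ^ (K - k))%N == j) m n a * (rmin k1 k n j)%:R)); last first.
    by move=> a _; rewrite mulr_sumr; apply: eq_bigr => k _; rewrite mulr_sumr.
  rewrite exchange_big [RHS]exchange_big /=; apply: eq_bigr => k _.
  rewrite (exchange_big_dep xpredT) //=; apply: eq_bigr => j _.
  by rewrite /tmass mulr_sumr; apply: eq_bigr => a _; rewrite mulrC.
apply: ler_sum => a _; rewrite -[leRHS]mulr1 ler_wpM2l //.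
apply: (@le_trans _ _ (\sum_(k < k0.+1) (rmin k1 k n (a %/ 2 ^ (K - k))%N)%:R)).
  apply: ler_sum => k _.
  have ha : (a %/ 2 ^ (K - k) < 2 ^ K.+1)%N by apply: leq_ltn_trans (leq_div _ _) (ltn_ord a).
  rewrite (eq_bigl (fun j => j == Ordinal ha)) ?big_pred1_eq //.
  by move=> j; rewrite eq_sym -val_eqE.
apply: (@sum_nat_atmost1 _ (fun k => rmin k1 k n (a %/ 2 ^ (K - k))%N)) => k k' /andP[h _].
exact: rmin_disj.
Qed.

Lemma rcount_ge0 n k0 k1 : 0 <= rcount n k0 k1.
Proof. by apply: sumr_ge0 => k _; apply: sumr_ge0 => j _; rewrite ler0n. Qed.

(** The John-Nirenberg argument for exponent 2. In the square the larger level is singled out; its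
    count is constant on its own intervals, where the linear estimate applies, and the linear
    estimate is then used once more. *)
Lemma carleson2 k1 i : (k1 <= K)%N ->
  dsum k1 i (fun n => rcount n k1 k1 ^+ 2) * delta ^+ 2 <= 2 * (2 ^ k1)%N%:R.
Proof.
move=> k1K.
pose c k n : R := \sum_(j < 2 ^ K.+1) (rmin k1 k n j)%:R.
have c0 k n : 0 <= c k n by apply: sumr_ge0 => j _; rewrite ler0n.
apply: (@le_trans _ _ (2 * delta * (delta * dsum k1 i (fun n =>
   \sum_(k < k1.+1) c k n * rcount n k k1)))).
  set D := dsum _ _ _; have -> (x : R) : 2 * delta * (delta * x) = 2 * x * delta ^+ 2 by ring.
  rewrite ler_wpM2r ?sqr_ge0 // /D.
  rewrite -dsumZ; apply: le_dsum => n _.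
  exact: (@sqr_sum_le _ (fun k => c k n)).
apply: (@le_trans _ _ (2 * delta * dsum k1 i (fun n => rcount n k1 k1))); last first.
  by rewrite -mulrA ler_wpM2l // mulrC carleson.
rewrite ler_wpM2l ?mulr_ge0 ?(ltW delta0) // dsum_sum mulr_sumr /rcount dsum_sum.
apply: ler_sum => k _; rewrite -dsumZ; apply: (@le_dsum_coarse _ k); first by rewrite -ltnS.
move=> i'; set cc := c k (i' * 2 ^ k)%N.
have e n : (n %/ 2 ^ k = i')%N -> c k n = cc.
  move=> h; apply: eq_bigr => j _; congr (_ %:R); congr nat_of_bool.
  by apply: rmin_eq; rewrite h mulnK ?expn_gt0.
rewrite (eq_dsum (g := fun n => cc * (rcount n k k1 * delta))); last first.
  by move=> n hn /=; rewrite (e n hn) mulrC mulrA.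
rewrite [leRHS](eq_dsum (g := fun n => cc)); last by move=> n hn; exact: e.
rewrite dsumZ dsum_const mulrC; apply: ler_wpM2r; first exact: c0.
have := @carleson k k1 i' _.
have kK : (k <= K)%N by apply: leq_trans k1K; rewrite -ltnS.
rewrite [_ * delta]mulrC -dsumZ => /(_ kK); apply: le_trans.
by apply: le_dsum => n _; rewrite mulrC.
Qed.

Definition next_spec (t : nat * nat * nat) (o : option (nat * nat)) : Prop :=
  let: (k, i, j) := t in
  match o with
  | None => forall d j', (0 < d)%N -> (j' %/ 2 ^ d = j)%N -> ~~ good (k + d) (i %/ 2 ^ d) j'
  | Some (d, j') => [/\ (0 < d)%N, (j' %/ 2 ^ d = j)%N, good (k + d) (i %/ 2 ^ d) j' &
      forall d' j'', (0 < d' < d)%N -> (j'' %/ 2 ^ d' = j)%N -> ~~ good (k + d') (i %/ 2 ^ d') j'']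
  end.

Lemma next_ex t : exists o, next_spec t o.
Proof.
case: t => [[k i] j].
pose P d := (0 < d)%N && `[< exists2 j', (j' %/ 2 ^ d = j)%N & good (k + d) (i %/ 2 ^ d) j' >].
case: (pselect (exists d, P d)) => [h|h].
  case: (ex_minnP h) => d /andP[d0 /asboolP[j' e g]] dmin.
  exists (Some (d, j')); split=> // d' j'' /andP[h1 h2] e'; apply/negP => g'.
  have := dmin d'; rewrite /P h1 /=; move: h2; rewrite ltnNge => /negP h2 h3; apply: h2; apply: h3.
  by apply/asboolP; exists j''.
exists None => d j' d0 e; apply/negP => g; apply: h; exists d; rewrite /P d0.
by apply/asboolP; exists j'.
Qed.

(** The choice among the candidates depends on the tile alone, so two chains that meet coincide from
    then on. *)
Definition next t := projT1 (cid (next_ex t)).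
Lemma nextP t : next_spec t (next t). Proof. exact: (projT2 (cid (next_ex t))). Qed.

(* A tile inherits its slope from the nearest good tile above it with finer
   slopes.  Chains of such tiles merge, so that the number of slopes used over a
   column is at most [rcount], which satisfies a Carleson condition. *)
Fixpoint slope_rec f k i j : nat :=
  if f is f'.+1 then
    if next (k, i, j) is Some (d, j') then slope_rec f' (k + d)%N (i %/ 2 ^ d)%N j'
    else (j * 2 ^ (K - k))%N
  else (j * 2 ^ (K - k))%N.

Definition slope k i j := slope_rec (K - k) k i j.

(** Each [next] raises the level, and good tiles have level at most [K], so [K - k] steps exhaust
    every chain. *)
Lemma slope_rec_fuel f k i j : (k <= K)%N -> (K - k <= f)%N -> slope_rec f k i j = slope k i j.
Proof.
rewrite /slope; move: {2}(K - k)%N (leqnn (K - k)%N) => N; elim: N f k i j => [|N IH] f k i j hN kK hf.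
  have e : (K - k = 0)%N by lia.
  rewrite e; case: f hf => //= f _; have := nextP (k, i, j).
  by case: (next _) => [[d j']|] //= [d0 _ g _]; case/andP: g; lia.
case: f hf => [|f] hf.
  have e : (K - k = 0)%N by lia.
  by rewrite e.
rewrite /=; have := nextP (k, i, j); case E: (next _) => [[d j']|] /=; last first.
  by move=> _; case E2: (K - k)%N => [|N'] /=; rewrite ?E ?E2.
case=> d0 _ /andP[kdK _] _; have -> : (K - k = (K - k).-1.+1)%N by lia.
by rewrite /= E !IH //; lia.
Qed.

Lemma slopeE k i j : (k <= K)%N -> slope k i j =
  if next (k, i, j) is Some (d, j') then slope (k + d) (i %/ 2 ^ d) j'
  else (j * 2 ^ (K - k))%N.
Proof.
move=> kK; rewrite -(@slope_rec_fuel (K - k).+1) ?leqnSn //=.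
have := nextP (k, i, j); case: (next _) => [[d j']|//] [d0 _ /andP[kdK _] _].
by rewrite slope_rec_fuel //; lia.
Qed.

Lemma slope_mem k i j : (k <= K)%N -> (slope k i j %/ 2 ^ (K - k) = j)%N.
Proof.
move: {2}(K - k)%N (leqnn (K - k)%N) => N; elim: N k i j => [|N IH] k i j hN kK;
  rewrite slopeE //; have := nextP (k, i, j);
  case: (next _) => [[d j']|] /=; try by rewrite mulnK ?expn_gt0.
  by case=> d0 _ /andP[]; lia.
case=> d0 e /andP[kdK _] _.
have <- : (d + (K - (k + d)) = K - k)%N by lia.
by rewrite -divn_expK IH //; lia.
Qed.

Lemma slope_lt k i j : good k i j -> (slope k i j < 2 ^ K.+1)%N.
Proof.
move=> g; have kK : (k <= K)%N by case/andP: g.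
move: {2}(K - k)%N (leqnn (K - k)%N) => N; elim: N k i j g kK => [|N IH] k i j g kK hN.
  have e : (K - k = 0)%N by lia.
  by have := slope_mem i j kK; rewrite e expn0 divn1 => ->; apply: good_lt g.
rewrite slopeE //; have := nextP (k, i, j); case: (next _) => [[d j']|] /=.
  by case=> d0 e g' _; apply: IH => //; [case/andP: g'|lia].
move=> _; have := g; rewrite /good => /andP[_ h]; rewrite ltnNge; apply/negP => jb.
move: h; apply/negP; rewrite -ltNge /dsum big1 => [|n _].
  by rewrite mulr_gt0 ?natr_exp2_gt0.
rewrite /tmass big1 // => a /eqP ha; exfalso.
have := leq_divM (nat_of_ord a) (2 ^ (K - k)); rewrite ha.
have := ltn_ord a; lia.
Qed.

(** Follow the chain until its next step would leave the levels up to [k1]. The tile reached has no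
    finer good tile up to [k1], hence is minimal, and the slope is constant along the chain. *)
Lemma slope_rmin k n j k1 : good k (n %/ 2 ^ k) j -> (k <= k1 <= K)%N ->
  exists k' j', [/\ (k <= k' <= k1)%N, rmin k1 k' n j' &
    slope k (n %/ 2 ^ k) j = slope k' (n %/ 2 ^ k') j'].
Proof.
move: {2}(K - k)%N (leqnn (K - k)%N) => N; elim: N k j => [|N IH] k j hN g /andP[kk1 k1K].
  exists k, j; split=> //; first by rewrite leqnn.
  rewrite /rmin g kk1; apply/asboolP => k' j' hk'; lia.
case: (boolP (rmin k1 k n j)) => [h|]; first by exists k, j; rewrite leqnn kk1.
rewrite /rmin g kk1 /= => /asboolPn h.
have := nextP (k, (n %/ 2 ^ k)%N, j); rewrite slopeE; last by lia.
case: (next _) => [[d j']|] /=; last first.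
  move=> h'; exfalso; apply: h => k' j' /andP[h1 h2] e.
  have := h' (k' - k)%N j'; rewrite divn_expK subnK; last by lia.
  by rewrite subnKC; [apply=> //; lia|lia].
case=> d0 e g' dmin.
have kd : (k + d <= k1)%N.
  rewrite leqNgt; apply/negP => hlt; apply: h => k' j'' /andP[h1 h2] e'.
  have := dmin (k' - k)%N j''; rewrite divn_expK subnK; last by lia.
  by rewrite subnKC; [apply=> //; lia|lia].
rewrite divn_expK addnC in g'.
have [] := IH (d + k)%N j' _ g' _; try lia.
move=> k' [j'' [h1 h2 h3]]; exists k', j''; split=> //; first by lia.
by rewrite divn_expK addnC h3.
Qed.

End Tiles.

(** * Tubes *)

Lemma dsum_restrict (R : realType) k K i i0 (f : nat -> R) :
  (k <= K)%N -> (i %/ 2 ^ (K - k) = i0)%N ->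
  dsum K i0 (fun n => (n %/ 2 ^ k == i)%N%:R * f n) = dsum k i f.
Proof.
move=> kK ii0; rewrite /dsum.
rewrite (eq_bigr (fun n => if (n %/ 2 ^ k == i)%N then f n else 0)); last first.
  by move=> n _; case: eqP; rewrite ?mul1r ?mul0r.
rewrite -big_mkcond -big_filter; apply: perm_big; apply: uniq_perm.
- by rewrite filter_uniq ?iota_uniq.
- by rewrite iota_uniq.
move=> n; rewrite mem_filter !mem_dyadic; case: eqP => //= e.
by apply/eqP; rewrite -ii0 -e divn_expK subnK.
Qed.

Lemma dsum_point (R : realType) H y0 (f : nat -> R) : (y0 < 2 ^ H)%N ->
  dsum H 0 (fun y => (y == y0)%:R * f y) = f y0.
Proof.
move=> h; rewrite -(dsum0 y0 f) -(@dsum_restrict _ 0 H y0 0) //; last first.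
  by apply/eqP; rewrite subn0 -ltn_expP.
by apply: eq_dsum => n _; rewrite expn0 divn1.
Qed.

Lemma divn_eq_lt q x y : (0 < q)%N -> (x %/ q = y %/ q)%N -> (x < y + q)%N.
Proof.
move=> q0 e; apply: leq_trans (ltn_ceil x q0) _.
by rewrite e mulSn addnC leq_add2r leq_divM.
Qed.

Lemma cross_lt a b n n0 q q' : (a < b + q)%N -> (b < a + q)%N ->
  (n < n0 + q')%N -> (n0 < n + q')%N -> (a * n + b * n0 < b * n + a * n0 + q * q')%N.
Proof.
move=> h1 h2 h3 h4.
have q0 : (0 < q * q')%N by rewrite muln_gt0; lia.
case: (leqP a b) => hab; case: (leqP n n0) => hnn.
- move: (subnKC hab) (subnKC hnn); move: (b - a)%N (n0 - n)%N => d d' e1 e2; subst b n0.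
  have : (d * d' < q * q')%N by apply: ltn_mul; lia.
  nia.
- move: (subnKC hab) (subnKC (ltnW hnn)); move: (b - a)%N (n - n0)%N => d d' e1 e2; subst b n.
  nia.
- move: (subnKC (ltnW hab)) (subnKC hnn); move: (a - b)%N (n0 - n)%N => d d' e1 e2; subst a n0.
  nia.
- move: (subnKC (ltnW hab)) (subnKC (ltnW hnn)).
  move: (a - b)%N (n - n0)%N => d d' e1 e2; subst a n.
  have : (d * d' < q * q')%N by apply: ltn_mul; lia.
  nia.
Qed.

(** In units of [X], the hypothesis costs 1 and the two floors on the right cost less than 1 each,
    so the difference is below 3. *)
Lemma floor_cross X s1 s2 s3 s4 p1 p2 p3 p4 :
  (p1 * X <= s1 < p1.+1 * X)%N -> (p2 * X <= s2 < p2.+1 * X)%N ->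
  (p3 * X <= s3 < p3.+1 * X)%N -> (p4 * X <= s4 < p4.+1 * X)%N ->
  (s1 + s4 < s2 + s3 + X)%N -> (p1 + p4 <= p2 + p3 + 2)%N.
Proof.
move=> h1 h2 h3 h4 hp; rewrite leqNgt; apply/negP => hlt.
have : ((p2 + p3 + 3) * X <= (p1 + p4) * X)%N by rewrite leq_mul2r; lia.
rewrite !mulnDl; lia.
Qed.

(* Level, interval of columns, interval of slopes, height at column 0. *)
Definition tube := (nat * nat * nat * nat)%type.
Definition tk (Q : tube) := Q.1.1.1.
Definition ti (Q : tube) := Q.1.1.2.
Definition tj (Q : tube) := Q.1.2.
Definition tt (Q : tube) := Q.2.

Section Tubes.
Variables (R : realType) (K H : nat) (m : nat -> nat -> R) (delta : R).
Hypothesis m0 : forall n a, 0 <= m n a.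
Hypothesis m1 : forall n, \sum_(a < 2 ^ K.+1) m n a <= 1.
Hypothesis delta0 : 0 < delta.

Local Notation good := (good K m delta).
Local Notation slope := (slope K m delta).
Local Notation rmin := (rmin K m delta).
Local Notation rcount := (rcount K m delta).

Definition rise (a n : nat) : nat := (a * n %/ 2 ^ K)%N.
Definition tslope (Q : tube) := slope (tk Q) (ti Q) (tj Q).
Definition tpos (Q : tube) n := (tt Q + rise (tslope Q) n)%N.
Definition onT (Q : tube) n y := (n %/ 2 ^ tk Q == ti Q)%N && (y == tpos Q n).

(** Slopes being below 2, a tube rises by less than [2 ^ K.+1] over the grid; this margin keeps it
    below [2 ^ H]. *)
Definition wf_tube (Q : tube) : bool :=
  [&& good (tk Q) (ti Q) (tj Q), (ti Q < 2 ^ (K - tk Q))%N & (tt Q + 2 ^ K.+1 <= 2 ^ H)%N].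

Definition tot (f : nat -> nat -> R) : R := dsum K 0 (fun n => dsum H 0 (f n)).

Lemma rise_bounds a n : (rise a n * 2 ^ K <= a * n < (rise a n).+1 * 2 ^ K)%N.
Proof. by rewrite /rise leq_divM /= ltn_ceil ?expn_gt0. Qed.

Lemma tk_le Q : wf_tube Q -> (tk Q <= K)%N.
Proof. by case/and3P => /andP[]. Qed.

Lemma in_tube_lt Q n : wf_tube Q -> (n %/ 2 ^ tk Q = ti Q)%N -> (n < 2 ^ K)%N.
Proof.
move=> hQ e; have h := tk_le hQ; case/and3P: hQ => _ h1 _.
by rewrite -(subnKC h) expnD mulnC -ltn_divLR ?expn_gt0 // e.
Qed.

Lemma rise_lt Q n : wf_tube Q -> (n < 2 ^ K)%N -> (rise (tslope Q) n < 2 ^ K.+1)%N.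
Proof.
case/and3P=> g _ _ hn; have hs := slope_lt delta0 g.
rewrite /rise ltn_divLR ?expn_gt0 //; apply: ltn_mul => //.
Qed.

Lemma tpos_lt Q n : wf_tube Q -> (n %/ 2 ^ tk Q = ti Q)%N -> (tpos Q n < 2 ^ H)%N.
Proof.
move=> hQ e; have := rise_lt hQ (in_tube_lt hQ e); rewrite /tpos.
case/and3P: hQ => _ _; lia.
Qed.

Lemma tot_tube Q (F : nat -> nat -> R) : wf_tube Q ->
  tot (fun n y => (onT Q n y)%:R * F n y) = dsum (tk Q) (ti Q) (fun n => F n (tpos Q n)).
Proof.
move=> hQ; have hi : (ti Q %/ 2 ^ (K - tk Q) = 0)%N.
  by apply/eqP; rewrite -ltn_expP; case/and3P: hQ.
rewrite /tot -(dsum_restrict _ (tk_le hQ) hi).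
apply: eq_dsum => n _; case: eqP => [e|ne].
  rewrite mul1r -(@dsum_point _ H _ (F n)); last exact: tpos_lt.
  by apply: eq_dsum => y _; rewrite /onT e eqxx.
rewrite mul0r /dsum big1 // => y _; rewrite /onT; case: eqP ne => // _ _.
by rewrite mul0r.
Qed.

Lemma tot_sum (I : Type) (s : seq I) (P : pred I) (F : I -> nat -> nat -> R) :
  tot (fun n y => \sum_(x <- s | P x) F x n y) = \sum_(x <- s | P x) tot (F x).
Proof.
rewrite /tot -dsum_sum; apply: eq_dsum => n _; exact: dsum_sum.
Qed.

Lemma totZ c (F : nat -> nat -> R) : tot (fun n y => c * F n y) = c * tot F.
Proof. by rewrite /tot -dsumZ; apply: eq_dsum => n _; rewrite dsumZ. Qed.

Lemma totD (F G : nat -> nat -> R) : tot (fun n y => F n y + G n y) = tot F + tot G.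
Proof. by rewrite /tot -dsumD; apply: eq_dsum => n _; rewrite dsumD. Qed.

Lemma le_tot (F G : nat -> nat -> R) : (forall n y, F n y <= G n y) -> tot F <= tot G.
Proof. by move=> h; apply: le_dsum => n _; apply: le_dsum. Qed.

Lemma tot_ge0 (F : nat -> nat -> R) : (forall n y, 0 <= F n y) -> 0 <= tot F.
Proof. by move=> h; apply: dsum_ge0 => n; apply: dsum_ge0. Qed.

Lemma eq_tot (F G : nat -> nat -> R) : (forall n y, F n y = G n y) -> tot F = tot G.
Proof. by move=> h; apply: eq_dsum => n _; apply: eq_dsum. Qed.

(** A substitute for inclusion: the shorter tube lies in the vertical 2-neighbourhood of the longer
    one. *)
Definition close (Q2 Q1 : tube) : bool :=
  [&& (tk Q2 <= tk Q1)%N, (ti Q2 %/ 2 ^ (tk Q1 - tk Q2) == ti Q1)%N &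
  `[< forall n, (n %/ 2 ^ tk Q2 = ti Q2)%N ->
      (tpos Q2 n <= tpos Q1 n + 2)%N /\ (tpos Q1 n <= tpos Q2 n + 2)%N >]].

Lemma close_refl Q : close Q Q.
Proof.
rewrite /close leqnn subnn expn0 divn1 eqxx /=; apply/asboolP => n _.
by rewrite leq_addr.
Qed.

Lemma close_sym Q1 Q2 : tk Q1 = tk Q2 -> close Q1 Q2 -> close Q2 Q1.
Proof.
rewrite /close => e; rewrite e leqnn subnn expn0 !divn1 /= => /andP[/eqP e2 /asboolP h].
rewrite e2 eqxx /=; apply/asboolP => n hn; rewrite e2 in h.
by have [] := h _ hn.
Qed.

Lemma slope_div_eq a b e n n0 : (e <= K)%N -> (a %/ 2 ^ (K - e) = b %/ 2 ^ (K - e))%N ->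
  (n %/ 2 ^ e = n0 %/ 2 ^ e)%N ->
  (rise a n + rise b n0 <= rise b n + rise a n0 + 2)%N.
Proof.
move=> eK ab nn0.
have eX : (2 ^ K = 2 ^ (K - e) * 2 ^ e)%N by rewrite -expnD subnK.
have q1 : (0 < 2 ^ (K - e))%N by rewrite expn_gt0.
have q2 : (0 < 2 ^ e)%N by rewrite expn_gt0.
have hp := cross_lt (divn_eq_lt q1 ab) (divn_eq_lt q1 (esym ab))
  (divn_eq_lt q2 nn0) (divn_eq_lt q2 (esym nn0)).
rewrite -eX in hp.
exact: floor_cross (rise_bounds a n) (rise_bounds b n) (rise_bounds a n0) (rise_bounds b n0) hp.
Qed.

(** Both slopes lie in the slope interval of the shorter tube. Over its [2 ^ tk Q2] columns two such
    lines separate by less than 1, and by at most 2 after rounding. *)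
Lemma close_of_meet Q1 Q2 n y : wf_tube Q1 -> wf_tube Q2 -> onT Q1 n y -> onT Q2 n y ->
  (tk Q2 <= tk Q1)%N -> (tslope Q1 %/ 2 ^ (K - tk Q2) = tj Q2)%N -> close Q2 Q1.
Proof.
move=> w1 w2 /andP[/eqP i1 /eqP y1] /andP[/eqP i2 /eqP y2] k21 hs.
have k2K := tk_le w2.
rewrite /close k21 -i2 divn_expK subnK // i1 eqxx /=; apply/asboolP => n' hn'.
have hs2 : (tslope Q2 %/ 2 ^ (K - tk Q2) = tj Q2)%N by apply: slope_mem.
rewrite -hs2 in hs.
have c1 := slope_div_eq k2K hs hn'; have c2 := slope_div_eq k2K (esym hs) hn'.
move: y1 y2 c1 c2; rewrite /tpos.
move: (rise _ _) (rise _ _) (rise _ _) (rise _ _) => p1 p2 p3 p4; clear; lia.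
Qed.

Lemma vitali (S0 : seq tube) : exists S : seq tube, [/\ {subset S <= S0}, uniq S,
  (forall Q1 Q2, Q1 \in S -> Q2 \in S -> Q1 != Q2 -> (tk Q2 <= tk Q1)%N -> ~~ close Q2 Q1) &
  (forall Q, Q \in S0 -> exists2 Q', Q' \in S & close Q Q')].
Proof.
pose le Q1 Q2 := (tk Q1 <= tk Q2)%N.
have tot : total le by move=> x y; rewrite /le leq_total.
have tr : transitive le by move=> x y z; apply: leq_trans.
suff: forall s, sorted le s -> exists S : seq tube, [/\ {subset S <= s}, uniq S,
  (forall Q1 Q2, Q1 \in S -> Q2 \in S -> Q1 != Q2 -> (tk Q2 <= tk Q1)%N -> ~~ close Q2 Q1) &
  (forall Q, Q \in s -> exists2 Q', Q' \in S & close Q Q')].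
  case/(_ (sort le S0) (sort_sorted tot S0)) => S [h1 h2 h3 h4]; exists S; split=> //.
    by move=> x /h1; rewrite mem_sort.
  by move=> Q hQ; apply: h4; rewrite mem_sort.
(* The list is sorted by increasing level and its head is treated last, so the longest tubes are
   selected first. *)
elim=> [|Q s IH] hs; first by exists [::]; split=> // Q.
have [S [h1 h2 h3 h4]] := IH (path_sorted hs).
have /allP hmin := order_path_min tr hs.
case: (boolP (has (close Q) S)) => [/hasP[Q' Q'S hc]|/hasPn hc].
  exists S; split=> //; first by move=> x /h1; rewrite inE => ->; rewrite orbT.
  move=> x; rewrite inE => /orP[/eqP ->|/h4 //]; by exists Q'.
have QS : Q \notin S by apply/negP => /hc; rewrite close_refl.
exists (Q :: S); split.
- by move=> x; rewrite !inE => /orP[->//|/h1 ->]; rewrite orbT.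
- by rewrite /= QS.
- move=> Q1 Q2; rewrite !inE => /orP[/eqP ->|q1] /orP[/eqP ->|q2]; rewrite ?eqxx //.
  (* A selected tube of level at most that of the head has the same level, and there closeness is
     symmetric. *)
  + move=> _ hk; apply/negP => hcl; have /negP := hc _ q2; apply; apply: close_sym hcl.
    by apply/eqP; rewrite eqn_leq hk; apply: hmin; apply: h1.
  + by move=> _ _; apply: hc.
  + exact: h3.
move=> x; rewrite inE => /orP[/eqP ->|/h4 [Q' q' c']].
  by exists Q; rewrite ?inE ?eqxx ?close_refl.
by exists Q'; rewrite // inE q' orbT.
Qed.

(** By [slope_rmin] each slope is carried by a minimal tile, and distinct slopes need distinct
    tiles. *)
Lemma size_slopes n k1 (A : seq nat) : (k1 <= K)%N -> uniq A ->
  (forall a, a \in A -> exists k j, [/\ (k <= k1)%N, good k (n %/ 2 ^ k) j &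
     slope k (n %/ 2 ^ k) j = a]) ->
  (size A)%:R <= rcount n k1 k1.
Proof.
move=> k1K uA hA.
apply: (@le_trans _ _ (\sum_(a <- A) \sum_(k < k1.+1) \sum_(j < 2 ^ K.+1)
   (rmin k1 k n j)%:R * (a == slope k (n %/ 2 ^ k) j)%:R)).
  rewrite -sum1_size natr_sum big_seq [leRHS]big_seq; apply: ler_sum => a aA.
  have [k [j [kk1 g ha]]] := hA _ aA.
  have [|k' [j' [/andP[_ hk'] hr hs]]] := @slope_rmin R K m delta delta0 k n j k1 g.
    by rewrite kk1.
  have hj' : (j' < 2 ^ K.+1)%N by case/and3P: hr => g' _ _; exact: good_lt g'.
  have hk : (k' < k1.+1)%N by rewrite ltnS.
  rewrite (bigD1 (Ordinal hk)) //= (bigD1 (Ordinal hj')) //= hr -hs ha eqxx mulr1 -addrA lerDl.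
  rewrite addr_ge0 // ?sumr_ge0 // => i _; rewrite ?sumr_ge0 // => *; rewrite mulr_ge0 ?ler0n //.
rewrite exchange_big; apply: ler_sum => k _; rewrite exchange_big; apply: ler_sum => j _ /=.
rewrite -mulr_sumr -[leRHS]mulr1 ler_wpM2l ?ler0n // -natr_sum lern1.
have -> : (\sum_(i <- A) (i == slope k (n %/ 2 ^ k) j) = count_mem (slope k (n %/ 2 ^ k) j) A)%N.
  by rewrite -sum1_count [RHS]big_mkcond; apply: eq_bigr => i _ /=; case: eqP.
by rewrite count_uniq_mem // leq_b1.
Qed.

Section Family.
Variable S : seq tube.
Hypothesis S_wf : forall Q, Q \in S -> wf_tube Q.
Hypothesis S_uniq : uniq S.
Hypothesis S_far : forall Q1 Q2, Q1 \in S -> Q2 \in S -> Q1 != Q2 ->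
  (tk Q2 <= tk Q1)%N -> ~~ close Q2 Q1.

(** A common slope would lie in the slope interval of the shorter tube, which would then be close to
    the longer one, against the selection. *)
Lemma slope_neq Q1 Q2 n y : Q1 \in S -> Q2 \in S -> onT Q1 n y -> onT Q2 n y ->
  tslope Q1 = tslope Q2 -> Q1 = Q2.
Proof.
move=> s1 s2 o1 o2 e; apply/eqP; apply: contraT => ne.
wlog hk : Q1 Q2 s1 s2 o1 o2 e ne / (tk Q2 <= tk Q1)%N.
  move=> h; case: (leqP (tk Q2) (tk Q1)) => [|/ltnW] hk; first exact: (h Q1 Q2).
  by apply: (h Q2 Q1); rewrite // eq_sym.
have /negP := S_far s1 s2 ne hk; case; apply: (close_of_meet _ _ o1 o2) => //; try exact: S_wf.
by rewrite e; apply: slope_mem => //; apply: tk_le; apply: S_wf.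
Qed.

Lemma count_short n y k1 : (k1 <= K)%N ->
  \sum_(Q <- S | (tk Q <= k1)%N) (onT Q n y)%:R <= rcount n k1 k1.
Proof.
move=> k1K; pose T := [seq Q <- S | (tk Q <= k1)%N && onT Q n y].
have -> : \sum_(Q <- S | (tk Q <= k1)%N) (onT Q n y)%:R = (size (map tslope T))%:R :> R.
  rewrite size_map size_filter -sum1_count natr_sum big_mkcondr /=.
  by apply: eq_bigr => Q _; case: (onT Q n y).
apply: size_slopes => //.
  rewrite map_inj_in_uniq ?filter_uniq // => Q1 Q2; rewrite !mem_filter.
  by move=> /andP[/andP[_ o1] s1] /andP[/andP[_ o2] s2]; apply: slope_neq o1 o2.
move=> a /mapP[Q]; rewrite mem_filter => /andP[/andP[hk /andP[/eqP o _]] hs] ->.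
by exists (tk Q), (tj Q); rewrite /tslope o; split=> //; case/and3P: (S_wf hs).
Qed.

Definition inW n y := has (fun Q => onT Q n y) S.
(* Each point of the union of [S] is charged to one tube through it. *)
Definition rho n y : tube := nth (0, 0, 0, 0)%N S (find (fun Q => onT Q n y) S).

Lemma rhoP n y : inW n y -> rho n y \in S /\ onT (rho n y) n y.
Proof. by move=> h; split; [rewrite mem_nth -?has_find|apply: (nth_find _ h)]. Qed.

Definition emass Q : R := tot (fun n y => (inW n y && (rho n y == Q))%:R).
Definition gw Q : R := emass Q / (2 ^ tk Q)%N%:R.
(** The linearized maximal operator averages over the tube [rho] of a point; this is its adjoint
    applied to the indicator of the union. *)
Definition Phi n y : R := \sum_(Q <- S) gw Q * (onT Q n y)%:R.
Definition Wmass : R := tot (fun n y => (inW n y)%:R).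

Lemma emass_ge0 Q : 0 <= emass Q. Proof. by apply: tot_ge0 => n y; rewrite ler0n. Qed.
Lemma gw_ge0 Q : 0 <= gw Q. Proof. by rewrite divr_ge0 ?emass_ge0 ?ler0n. Qed.
Lemma gwE Q : gw Q * (2 ^ tk Q)%N%:R = emass Q.
Proof. by rewrite divfK // gt_eqF ?natr_exp2_gt0. Qed.

Lemma tube_mass Q : wf_tube Q -> tot (fun n y => (onT Q n y)%:R) = (2 ^ tk Q)%N%:R.
Proof.
move=> hQ; rewrite -[RHS]mulr1 -(dsum_const _ (ti Q)) -(@tot_tube Q (fun _ _ => 1)) //.
by apply: eq_tot => n y; rewrite mulr1.
Qed.

Lemma gw_le1 Q : Q \in S -> gw Q <= 1.
Proof.
move=> hQ; rewrite ler_pdivrMr ?natr_exp2_gt0 // mul1r -tube_mass; last exact: S_wf.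
apply: le_tot => n y; rewrite ler_nat; case: (boolP (inW n y)) => //= h.
by case: eqP => //= <-; have [_ ->] := rhoP h.
Qed.

Lemma sum_emass (c : tube -> nat -> nat -> R) :
  \sum_(Q <- S) tot (fun n y => (inW n y && (rho n y == Q))%:R * c Q n y) =
  tot (fun n y => (inW n y)%:R * c (rho n y) n y).
Proof.
rewrite -tot_sum; apply: eq_tot => n y; case: (boolP (inW n y)) => h /=; last first.
  by rewrite big1 ?mul0r // => Q _; rewrite mul0r.
rewrite mul1r (bigD1_seq (rho n y)) //=; last by have [] := rhoP h.
rewrite eqxx mul1r big1 ?addr0 // => Q hQ; rewrite eq_sym (negbTE hQ) mul0r //.
Qed.

Lemma sum_gw : \sum_(Q <- S) gw Q * (2 ^ tk Q)%N%:R = Wmass.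
Proof.
have -> : Wmass = tot (fun n y => (inW n y)%:R * 1) by apply: eq_tot => n y; rewrite mulr1.
rewrite -(sum_emass (fun _ _ _ => 1)); apply: eq_bigr => Q _.
by rewrite gwE; apply: eq_tot => n y; rewrite mulr1.
Qed.

Lemma tot_Phi_mul (F : nat -> nat -> R) : tot (fun n y => F n y * Phi n y) =
  \sum_(Q <- S) gw Q * dsum (tk Q) (ti Q) (fun n => F n (tpos Q n)).
Proof.
rewrite (eq_tot (fun n y => mulr_sumr _ _ _ _)) tot_sum big_seq [RHS]big_seq; apply: eq_bigr => Q hQ.
rewrite -(tot_tube _ (S_wf hQ)) -totZ; apply: eq_tot => n y; rewrite mulrCA mulrC; ring.
Qed.

Lemma tot_Phi : tot Phi = Wmass.
Proof.
rewrite -sum_gw -(eq_tot (F := fun n y => 1 * Phi n y)); last by move=> n y; rewrite mul1r.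
by rewrite tot_Phi_mul; apply: eq_bigr => Q _; rewrite dsum_const mulr1.
Qed.

Lemma weak_le (F : nat -> nat -> R) t :
  (forall Q, Q \in S -> t * (2 ^ tk Q)%N%:R <= dsum (tk Q) (ti Q) (fun n => F n (tpos Q n))) ->
  t * Wmass <= tot (fun n y => F n y * Phi n y).
Proof.
move=> h; rewrite tot_Phi_mul -sum_gw mulr_sumr big_seq [leRHS]big_seq.
by apply: ler_sum => Q hQ; rewrite mulrCA ler_wpM2l ?gw_ge0 ?h.
Qed.

Lemma Phi_ge0 n y : 0 <= Phi n y.
Proof. by apply: sumr_ge0 => Q _; rewrite mulr_ge0 ?gw_ge0 ?ler0n. Qed.

End Family.
End Tubes.

(** * Shifted dyadic grids *)

Section SortedPowers.
Variables (R : realDomainType) (T : eqType) (key : T -> nat) (c : T -> R) (p : nat).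
Hypothesis c0 : forall x, 0 <= c x.
Hypothesis step : forall a b : R, 0 <= a -> 0 <= b ->
  (b + a) ^+ p.+1 <= a ^+ p.+1 + p.+1%:R * (b * (b + a) ^+ p).

(** The terms enter in increasing order of [key]; [step] bounds the growth of the power when the
    last term [b] joins the sum [a] of the earlier ones. *)
Lemma sum_pow_sorted (s : seq T) :
  (\sum_(x <- s) c x) ^+ p.+1 <=
  p.+1%:R * \sum_(x <- s) (c x * (\sum_(y <- s | (key y <= key x)%N) c y) ^+ p).
Proof.
pose le x y := (key y <= key x)%N.
have tot : total le by move=> x y; rewrite /le leq_total.
have tr : transitive le by move=> x y z h1 h2; apply: leq_trans h2 h1.
have pe : perm_eq (sort le s) s by [rewrite perm_sort]; have so := sort_sorted tot s.
have e1 : \sum_(x <- s) c x = \sum_(x <- sort le s) c x by rewrite (perm_big _ pe).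
have e2 : \sum_(x <- s) (c x * (\sum_(y <- s | (key y <= key x)%N) c y) ^+ p) =
   \sum_(x <- sort le s) (c x * (\sum_(y <- sort le s | (key y <= key x)%N) c y) ^+ p).
  rewrite -(perm_big _ pe) /=; apply: eq_bigr => x _; congr (_ * _ ^+ _).
  by rewrite (perm_big _ pe).
rewrite e1 e2; move: (sort le s) so => {pe e1 e2}t.
elim: t => [|x t IH] ht; first by rewrite !big_nil expr0n mulr0.
have /allP hmin := order_path_min tr ht.
rewrite !big_cons leqnn.
have -> : \sum_(y <- t | (key y <= key x)%N) c y = \sum_(y <- t) c y.
  by rewrite big_seq_cond [RHS]big_seq; apply: eq_bigl => y; case: (boolP (y \in t)) => //= yt; exact: (hmin _ yt).
apply: le_trans (step _ (c0 x)) _; first exact: sumr_ge0.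
rewrite mulrDr addrC lerD2l; apply: le_trans (IH (path_sorted ht)) _.
rewrite ler_wpM2l ?ler0n //; apply: ler_sum => z _; rewrite ler_wpM2l //.
rewrite lerXn2r ?nnegrE ?sumr_ge0 // big_cons; case: ifP => // _; by rewrite lerDr.
Qed.
End SortedPowers.

Lemma sum_sq_sorted (R : realDomainType) (T : eqType) (key : T -> nat) (c : T -> R) (s : seq T) :
  (forall x, 0 <= c x) ->
  (\sum_(x <- s) c x) ^+ 2 <= 2 * \sum_(x <- s) (c x * (\sum_(y <- s | (key y <= key x)%N) c y)).
Proof.
move=> c0; apply: (@sum_pow_sorted _ _ key c 1) => // a b a0 b0.
by have := sqr_ge0 b; rewrite -subr_ge0 => h; rewrite expr1; nra.
Qed.

Lemma sum_cube_sorted (R : realDomainType) (T : eqType) (key : T -> nat) (c : T -> R) (s : seq T) :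
  (forall x, 0 <= c x) ->
  (\sum_(x <- s) c x) ^+ 3 <= 3 * \sum_(x <- s) (c x * (\sum_(y <- s | (key y <= key x)%N) c y) ^+ 2).
Proof.
move=> c0; apply: (@sum_pow_sorted _ _ key c 2) => // a b a0 b0.
rewrite -subr_ge0; have -> : a ^+ 3 + 3%:R * (b * (b + a) ^+ 2) - (b + a) ^+ 3 =
  3 * (a * b ^+ 2) + 2 * b ^+ 3 by ring.
by rewrite addr_ge0 // mulr_ge0 // ?mulr_ge0 // ?exprn_ge0.
Qed.

Definition third q := ((4 ^ q - 1) %/ 3)%N.

Lemma thirdE q : (3 * third q + 1 = 2 ^ (2 * q))%N.
Proof.
rewrite /third expnM -[(2 ^ 2)%N]/4%N.
have : (4 ^ q %% 3 = 1)%N by rewrite -modnXm exp1n.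
have : (0 < 4 ^ q)%N by rewrite expn_gt0.
move: (4 ^ q)%N => x; lia.
Qed.

(* The one-third trick: two dyadic grids, one shifted by [third q], never both cut a short interval. *)
Lemma third_shift q r x y : (r <= 2 * q)%N -> (x <= y)%N -> (3 * (y - x) + 3 <= 2 ^ r)%N ->
  (x %/ 2 ^ r = y %/ 2 ^ r)%N \/ ((x + third q) %/ 2 ^ r = (y + third q) %/ 2 ^ r)%N.
Proof.
move=> rq xy h; case: (eqVneq (x %/ 2 ^ r) (y %/ 2 ^ r))%N => [->|n1]; first by left.
case: (eqVneq ((x + third q) %/ 2 ^ r) ((y + third q) %/ 2 ^ r))%N => [->|n2]; first by right.
exfalso.
have e3 := thirdE q; have e4 : (2 ^ (2 * q) = 2 ^ (2 * q - r) * 2 ^ r)%N.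
  by rewrite -expnD subnK.
have r0 : (0 < 2 ^ r)%N by rewrite expn_gt0.
(* Three times the offset is [s * Z - 1] with [Z = 2 ^ r] and [s = 2 ^ (2 * q - r)]. Cut points
   closer than [Z / 3] would force 3 to divide [s]. *)
have m3 : (2 ^ (2 * q - r) %% 3 != 0)%N.
  rewrite -/(dvdn 3 _) Euclid_dvdX //.
have l1 : (x %/ 2 ^ r < y %/ 2 ^ r)%N by rewrite ltn_neqAle n1 leq_div2r.
have l2 : ((x + third q) %/ 2 ^ r < (y + third q) %/ 2 ^ r)%N.
  by rewrite ltn_neqAle n2 leq_div2r // leq_add2r.
have b1 := ltn_ceil x r0; have b2 := leq_divM y (2 ^ r).
have b3 := ltn_ceil (x + third q) r0; have b4 := leq_divM (y + third q) (2 ^ r).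
move: e3 e4 m3 l1 l2 b1 b2 b3 b4 h xy r0.
move: (2 ^ r)%N (2 ^ (2 * q - r))%N (2 ^ (2 * q))%N (third q) => Z s w al.
move: (x %/ Z)%N (y %/ Z)%N ((x + al) %/ Z)%N ((y + al) %/ Z)%N; clear => p1 p2 p3 p4 e3 e4 m3 l1 l2 b1 b2 b3 b4 h xy Z0.
subst w.
have c1 : (p1.+1 * Z <= p2 * Z)%N by rewrite leq_mul2r l1 orbT.
have c2 : (p3.+1 * Z <= p4 * Z)%N by rewrite leq_mul2r l2 orbT.
(* [p2 Z] and [p4 Z - al] both lie in (x, y] *)
have d1 : (p2 * Z + al < p4 * Z + (y - x))%N by lia.
have d2 : (p3.+1 * Z < p1.+1 * Z + al + (y - x))%N by lia.
have f1 : (s * Z + 3 * (p1.+1 * Z) < 3 * (p3.+1 * Z) + Z)%N by lia.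
have f2 : (3 * (p3.+1 * Z) < s * Z + 3 * (p1.+1 * Z) + Z)%N by lia.
have f1' : ((s + 3 * p1.+1) * Z < (3 * p3.+1 + 1) * Z)%N by lia.
have f2' : ((3 * p3.+1) * Z < (s + 3 * p1.+1 + 1) * Z)%N by lia.
rewrite ltn_mul2r Z0 /= in f1'; rewrite ltn_mul2r Z0 /= in f2'.
lia.
Qed.

Lemma seq_argmin (u : nat -> nat) (s : seq nat) : s != [::] ->
  exists2 x, x \in s & forall y, y \in s -> (u x <= u y)%N.
Proof.
elim: s => // x s IH _; case: (eqVneq s [::]) => [->|/IH[z zs hz]].
  by exists x; rewrite ?inE // => y; rewrite inE => /eqP ->.
case: (leqP (u x) (u z)) => h.
  exists x; rewrite ?inE ?eqxx // => y; rewrite inE => /orP[/eqP->//|/hz]; exact: leq_trans.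
exists z; rewrite ?inE ?zs ?orbT // => y; rewrite inE => /orP[/eqP->|/hz//]; exact: ltnW.
Qed.

Lemma seq_argmax (u : nat -> nat) (s : seq nat) : s != [::] ->
  exists2 x, x \in s & forall y, y \in s -> (u y <= u x)%N.
Proof.
elim: s => // x s IH _; case: (eqVneq s [::]) => [->|/IH[z zs hz]].
  by exists x; rewrite ?inE // => y; rewrite inE => /eqP ->.
case: (leqP (u z) (u x)) => h.
  exists x; rewrite ?inE ?eqxx // => y; rewrite inE => /orP[/eqP->//|/hz] h2.
  exact: leq_trans h.
exists z; rewrite ?inE ?zs ?orbT // => y; rewrite inE => /orP[/eqP->|/hz//]; exact: ltnW.
Qed.

(** Here [(a - b) + (b - a)] is the distance of natural numbers, and the product of differences is
    expanded into cross terms to avoid truncated subtraction. *)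
Lemma cross_le a b n n' : (b * n + a * n' <= b * n' + a * n +
  ((a - b) + (b - a)) * ((n - n') + (n' - n)))%N.
Proof.
case: (leqP a b) => hab; case: (leqP n n') => hnn.
- by move: (subnKC hab) (subnKC hnn); rewrite (eqP (hab : a - b == 0)%N) (eqP (hnn : n - n' == 0)%N);
    move: (b - a)%N (n' - n)%N => d e <- <-; nia.
- move: (subnKC hab) (subnKC (ltnW hnn)).
  rewrite (eqP (hab : a - b == 0)%N) (eqP (ltnW hnn : n' - n == 0)%N).
  by move: (b - a)%N (n - n')%N => d e <- <-; nia.
- move: (subnKC (ltnW hab)) (subnKC hnn).
  rewrite (eqP (ltnW hab : b - a == 0)%N) (eqP (hnn : n - n' == 0)%N).
  by move: (a - b)%N (n' - n)%N => d e <- <-; nia.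
- move: (subnKC (ltnW hab)) (subnKC (ltnW hnn)).
  rewrite (eqP (ltnW hab : b - a == 0)%N) (eqP (ltnW hnn : n' - n == 0)%N).
  by move: (a - b)%N (n - n')%N => d e <- <-; nia.
Qed.

Lemma cross_ge a b n n' B : (b * n + a * n' < b * n' + a * n + B)%N ->
  (b * n' + a * n < b * n + a * n' + B)%N ->
  (((a - b) + (b - a)) * ((n - n') + (n' - n)) < B)%N.
Proof.
case: (leqP a b) => hab; case: (leqP n n') => hnn.
- by move: (subnKC hab) (subnKC hnn); rewrite (eqP (hab : a - b == 0)%N) (eqP (hnn : n - n' == 0)%N);
    move: (b - a)%N (n' - n)%N => d e <- <-; nia.
- move: (subnKC hab) (subnKC (ltnW hnn)).
  rewrite (eqP (hab : a - b == 0)%N) (eqP (ltnW hnn : n' - n == 0)%N).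
  by move: (b - a)%N (n - n')%N => d e <- <-; nia.
- move: (subnKC (ltnW hab)) (subnKC hnn).
  rewrite (eqP (ltnW hab : b - a == 0)%N) (eqP (hnn : n - n' == 0)%N).
  by move: (a - b)%N (n' - n)%N => d e <- <-; nia.
- move: (subnKC (ltnW hab)) (subnKC (ltnW hnn)).
  rewrite (eqP (ltnW hab : b - a == 0)%N) (eqP (ltnW hnn : n' - n == 0)%N).
  by move: (a - b)%N (n - n')%N => d e <- <-; nia.
Qed.

(** For positive [c], [c * d = d * (c - 1) + d] is below [4 * X], so [c * D <= 6 * P] once the
    rounding term [2 * X] is included. With [c <= P] this gives 36 + 6 = 42. *)
Lemma overlap_arith X P c D d : (0 < X)%N -> (c <= P)%N -> (d < 2 * X)%N ->
  (d * (c - 1) < 2 * X)%N -> (X * D < d * P + 2 * X)%N ->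
  (c * (6 * D + 6) <= 42 * P)%N.
Proof.
move=> X0 cP d2 h1 h2; rewrite -(leq_pmul2l X0).
case: c cP h1 => [|c] cP h1; first by rewrite mul0n muln0.
rewrite subn1 /= in h1.
have h3 : (c.+1 * (X * D) <= c.+1 * (d * P + 2 * X))%N by rewrite leq_mul2l (ltnW h2) orbT.
have h4 : (d * c * P <= 2 * X * P)%N by rewrite leq_mul2r (ltnW h1) orbT.
have h5 : (d * P <= 2 * X * P)%N by rewrite leq_mul2r (ltnW d2) orbT.
have h6 : (X * c.+1 <= X * P)%N by rewrite leq_mul2l cP orbT.
nia.
Qed.

Lemma osc_arith X A t ra rb ra' rb' x1 x2 x3 x4 u1 u2 E :
  (ra * X <= x4 < ra.+1 * X)%N -> (rb * X <= x1 < rb.+1 * X)%N ->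
  (ra' * X <= x2 < ra'.+1 * X)%N -> (rb' * X <= x3 < rb'.+1 * X)%N ->
  (u1 + ra = t + rb + A)%N -> (u2 + ra' = t + rb' + A)%N ->
  (x1 + x2 <= x3 + x4 + E)%N -> (X * u1 < X * u2 + E + 2 * X)%N.
Proof.
move=> b1 b2 b3 b4 e1 e2 h.
have : ((u1 + ra + rb') * X = (u2 + ra' + rb) * X)%N by congr (_ * _)%N; lia.
move: b1 b2 b3 b4; rewrite [(X * u1)%N]mulnC [(X * u2)%N]mulnC !mulnDl !mulSn; lia.
Qed.

Lemma level_arith X A t ra rb ra' rb' x1 x2 x3 x4 u1 :
  (ra * X <= x4 < ra.+1 * X)%N -> (rb * X <= x1 < rb.+1 * X)%N ->
  (ra' * X <= x2 < ra'.+1 * X)%N -> (rb' * X <= x3 < rb'.+1 * X)%N ->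
  (u1 + ra = t + rb + A)%N -> (u1 + ra' = t + rb' + A)%N ->
  (x1 + x2 < x3 + x4 + 2 * X)%N /\ (x3 + x4 < x1 + x2 + 2 * X)%N.
Proof.
move=> b1 b2 b3 b4 e1 e2.
have : ((ra' + rb) * X = (ra + rb') * X)%N by congr (_ * _)%N; lia.
move: b1 b2 b3 b4; rewrite !mulnDl !mulSn; lia.
Qed.

(** * Dyadic boxes around sheared tubes *)

Section Box.
Variables (K k i t a b : nat).
Let X := (2 ^ K)%N.
Let dd := ((a - b) + (b - a))%N.
Let u n := (t + rise K b n + (2 ^ K.+1 - rise K a n))%N.

Hypothesis kK : (k <= K)%N.
Hypothesis iK : (i < 2 ^ (K - k))%N.
Hypotheses (aX : (a < 2 ^ K.+1)%N) (bX : (b < 2 ^ K.+1)%N).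

Let inI n : (n %/ 2 ^ k = i)%N -> (n < 2 ^ K)%N.
Proof. by move=> e; rewrite -(subnKC kK) expnD mulnC -ltn_divLR ?expn_gt0 // e. Qed.

Let riseX n : (n < 2 ^ K)%N -> (rise K a n < 2 ^ K.+1)%N.
Proof. by move=> h; rewrite /rise ltn_divLR ?expn_gt0 //; apply: ltn_mul. Qed.

Let uE n : (n %/ 2 ^ k = i)%N -> (u n + rise K a n = t + rise K b n + 2 ^ K.+1)%N.
Proof.
move=> e; have := riseX (inI e); rewrite /u.
move: (rise K a n) (rise K b n) (2 ^ K.+1)%N; clear => *; lia.
Qed.

Let near_I n n' : (n %/ 2 ^ k = i)%N -> (n' %/ 2 ^ k = i)%N -> ((n - n') + (n' - n) < 2 ^ k)%N.
Proof.
move=> e e'; have p : (0 < 2 ^ k)%N by rewrite expn_gt0.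
have h1 := divn_eq_lt p (etrans e (esym e')); have h2 := divn_eq_lt p (etrans e' (esym e)).
move: h1 h2 p; move: (2 ^ k)%N; clear=> *; lia.
Qed.

Lemma sheared_osc n n' : (n %/ 2 ^ k = i)%N -> (n' %/ 2 ^ k = i)%N ->
  (X * u n < X * u n' + dd * 2 ^ k + 2 * X)%N.
Proof.
move=> e e'; have h := near_I e e'.
have h2 : (dd * ((n - n') + (n' - n)) <= dd * 2 ^ k)%N by rewrite leq_mul2l (ltnW h) orbT.
apply: (osc_arith (rise_bounds K a n) (rise_bounds K b n) (rise_bounds K a n')
  (rise_bounds K b n') (uE e) (uE e')).
by apply: leq_trans (cross_le a b n n') _; rewrite leq_add2l.
Qed.

Lemma sheared_level n n' : (n %/ 2 ^ k = i)%N -> (n' %/ 2 ^ k = i)%N -> u n = u n' ->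
  (dd * ((n - n') + (n' - n)) < 2 * X)%N.
Proof.
move=> e e' eu; have e2 := uE e'; rewrite -eu in e2.
have [h1 h2] := level_arith (rise_bounds K a n) (rise_bounds K b n) (rise_bounds K a n')
  (rise_bounds K b n') (uE e) e2.
exact: cross_ge.
Qed.

(** Up to rounding, the sheared height [u] is linear in [n]. A steep line has a tall box but visits
    each height in few columns; a flat line may stay at one height but its box is short. Either way
    the sheared tube is at most 42 times as dense as the uniform distribution on its box. *)
Lemma box_ex : exists (r : nat) (sg : bool) (J : nat), [/\ (r <= K + 5)%N,
  (forall n, (n %/ 2 ^ k = i)%N -> ((u n + sg * third (K + 5)) %/ 2 ^ r = J)%N) &
  (forall u0, (count (fun n => u n == u0) (iota (i * 2 ^ k) (2 ^ k)) * 2 ^ r <= 42 * 2 ^ k)%N)].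
Proof.
set s := iota (i * 2 ^ k) (2 ^ k).
have ms n : (n \in s) = (n %/ 2 ^ k == i)%N := mem_dyadic k i n.
have s0 : s != [::] by rewrite -size_eq0 size_iota -lt0n expn_gt0.
have [nl nls hl] := seq_argmin u s0; have [nh nhs hh] := seq_argmax u s0.
have X0 : (0 < X)%N by rewrite expn_gt0.
(* The exponent [r] is the least one that the one-third trick allows for an interval of length
   [D]. *)
set D := (u nh - u nl)%N; pose r := up_log 2 (3 * D + 3).
have /andP[r1 r2] : (2 ^ r.-1 < 3 * D + 3 <= 2 ^ r)%N by apply: up_log_bounds; lia.
have r3 : (2 ^ r < 6 * D + 6)%N.
  have : (0 < r)%N by rewrite up_log_gt0; lia.
  move=> r0; move: r1; rewrite -{2}(prednK r0) expnS; move: (2 ^ r.-1)%N; clear; lia.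
have hD : (X * D < dd * 2 ^ k + 2 * X)%N.
  have eh : (nh %/ 2 ^ k = i)%N by apply/eqP; rewrite -ms.
  have el : (nl %/ 2 ^ k = i)%N by apply/eqP; rewrite -ms.
  have := sheared_osc eh el.
  have := hl _ nhs; rewrite /D mulnBr; clear; lia.
have hd : (dd < 2 * X)%N.
  move: aX bX; rewrite expnS -/X /dd; clear; lia.
have hPX : (2 ^ k <= X)%N by rewrite leq_exp2l.
(* Since [dd < 2 * X] and [2 ^ k <= X], the bound [6 * D + 6] stays below [32 * X], whence the 5. *)
have rK : (r <= K + 5)%N.
  apply: ltnW; rewrite -(@ltn_exp2l 2) // expnD -/X; apply: leq_trans r3 _.
  have : (X * D < X * (2 * X + 2))%N.
    apply: leq_trans hD _; rewrite mulnDr [(X * 2)%N]mulnC leq_add2r mulnCA mulnA leq_mul // ltnW //.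
  rewrite ltn_pmul2l // -[(2 ^ 5)%N]/32%N; move: X0; clear; lia.
have [sg hsg] : exists sg : bool, ((u nl + sg * third (K + 5)) %/ 2 ^ r =
    (u nh + sg * third (K + 5)) %/ 2 ^ r)%N.
  have rq : (r <= 2 * (K + 5))%N by move: rK; clear; lia.
  have := third_shift rq (hl _ nhs) r2; case=> h; [exists false|exists true];
  by rewrite ?mul0n ?mul1n ?addn0.
exists r, sg, ((u nl + sg * third (K + 5)) %/ 2 ^ r)%N; split=> //.
  move=> n /eqP; rewrite -ms => ns; apply/eqP; rewrite eqn_leq; apply/andP; split.
    by rewrite hsg leq_div2r // leq_add2r hh.
  by rewrite leq_div2r // leq_add2r hl.
move=> u0; set c := count _ _.
apply: (@leq_trans (c * (6 * D + 6))); first by rewrite leq_mul2l (ltnW r3) orbT.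
have cs : (c <= 2 ^ k)%N by rewrite -[leqRHS](size_iota (i * 2 ^ k)) count_size.
apply: (overlap_arith X0 cs hd _ hD).
rewrite /c -size_filter; set f := [seq _ <- _ | _].
case: (eqVneq f [::]) => [->|f0]; first by rewrite muln0 muln_gt0.
have [n1 n1f h1] := seq_argmin id f0; have [n2 n2f h2] := seq_argmax id f0.
move: (n1f) (n2f); rewrite !mem_filter -/s !ms => /andP[/eqP e1 /eqP i1] /andP[/eqP e2 /eqP i2].
have h3 := sheared_level i2 i1 (etrans e2 (esym e1)).
apply: leq_ltn_trans h3; rewrite leq_mul2l; apply/orP; right.
have : (size f <= size (iota n1 (n2 - n1).+1))%N.
  apply: uniq_leq_size; first by rewrite filter_uniq ?iota_uniq.
  move=> x xf; have := h1 _ xf; have := h2 _ xf; rewrite mem_iota /=; clear; lia.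
rewrite size_iota; clear; lia.
Qed.
End Box.

(** * Moments of the tube counting function *)

Lemma dsum_shift_split (R : realType) H1 H2 c (G : nat -> R) : (c + 2 ^ H1 <= 2 ^ H2)%N ->
  dsum H2 0 G = \sum_(v <- iota 0 c) G v + dsum H1 0 (fun u => G (u + c)%N) +
    \sum_(v <- iota (c + 2 ^ H1) (2 ^ H2 - (c + 2 ^ H1))) G v.
Proof.
move=> h; rewrite /dsum !mul0n -{1}(subnKC h) iotaD big_cat iotaD big_cat /= add0n.
by congr (_ + _ + _); rewrite -{1}[c]addn0 iotaDl big_map; apply: eq_bigr => u _; rewrite addnC.
Qed.

Lemma le_dsum_shift (R : realType) H1 H2 c (G : nat -> R) : (c + 2 ^ H1 <= 2 ^ H2)%N ->
  (forall v, 0 <= G v) -> dsum H1 0 (fun u => G (u + c)%N) <= dsum H2 0 G.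
Proof.
move=> h G0; rewrite (dsum_shift_split _ h).
have : 0 <= \sum_(v <- iota 0 c) G v by apply: sumr_ge0.
have : 0 <= \sum_(v <- iota (c + 2 ^ H1) (2 ^ H2 - (c + 2 ^ H1))) G v by apply: sumr_ge0.
lra.
Qed.

Lemma dsum_shift_eq (R : realType) H1 H2 c (G : nat -> R) : (c + 2 ^ H1 <= 2 ^ H2)%N ->
  (forall v, ~~ (c <= v < c + 2 ^ H1)%N -> G v = 0) ->
  dsum H2 0 G = dsum H1 0 (fun u => G (u + c)%N).
Proof.
move=> h G0; rewrite (dsum_shift_split _ h) !big1_seq ?add0r ?addr0 // => v /andP[_];
  rewrite mem_iota => hv; apply: G0; move: hv; lia.
Qed.

Section Moments.
Variables (R : realType) (K H H1 H2 : nat) (m : nat -> nat -> R) (delta : R).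
Hypothesis m0 : forall n a, 0 <= m n a.
Hypothesis m1 : forall n, \sum_(a < 2 ^ K.+1) m n a <= 1.
Hypothesis delta0 : 0 < delta.

Local Notation good := (good K m delta).
Local Notation slope := (slope K m delta).
Local Notation rmin := (rmin K m delta).
Local Notation rcount := (rcount K m delta).
Local Notation tslope := (tslope K m delta).
Local Notation tpos := (tpos K m delta).
Local Notation onT := (onT K m delta).
Local Notation wf_tube := (wf_tube K H m delta).
Local Notation tot := (@tot R K H).
Local Notation close := (close K m delta).

Lemma count_window (y' : nat) :
  dsum H 0 (fun y => ((y' <= y + 2) && (y <= y' + 2))%N%:R) <= 5 :> R.
Proof.
apply: (@le_trans _ _ (dsum H 0 (fun y => \sum_(e < 5) (y + 2 == y' + e)%N%:R))).
  apply: le_dsum => y _; case: (boolP ((y' <= y + 2) && (y <= y' + 2))%N) => h; last exact: sumr_ge0.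
  have he : (y + 2 - y' < 5)%N by lia.
  rewrite (bigD1 (Ordinal he)) //= (_ : (y + 2 == y' + (y + 2 - y'))%N = true); last lia.
  by rewrite lerDl sumr_ge0.
rewrite dsum_sum; apply: (@le_trans _ _ (\sum_(e < 5) 1)); last first.
  by rewrite big_const_ord iter_addr_0.
apply: ler_sum => e _; rewrite /dsum -natr_sum lern1.
apply: (@leq_trans (count_mem (y' + e - 2)%N (iota (0 * 2 ^ H) (2 ^ H)))).
  rewrite -sum1_count [leqRHS]big_mkcond; apply: leq_sum => y _ /=.
  by case: eqP => // he; rewrite (_ : (y == _)%N = true); lia.
by rewrite count_uniq_mem ?iota_uniq // leq_b1.
Qed.

Section Family.
Variable S : seq tube.
Hypothesis S_wf : forall Q, Q \in S -> wf_tube Q.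
Hypothesis S_uniq : uniq S.
Hypothesis S_far : forall Q1 Q2, Q1 \in S -> Q2 \in S -> Q1 != Q2 ->
  (tk Q2 <= tk Q1)%N -> ~~ close Q2 Q1.
Local Notation inW := (inW K m delta S).
Local Notation rho := (rho K m delta S).
Local Notation emass := (emass K H m delta S).
Local Notation gw := (gw K H m delta S).
Local Notation Phi := (Phi K H m delta S).
Local Notation Wmass := (Wmass K H m delta S).

(** Closeness puts each point of a discarded tube at vertical distance at most 2 from the union of
    [S], and there are 5 such offsets. *)
Lemma union_le (S0 : seq tube) : (forall Q, Q \in S0 -> exists2 Q', Q' \in S & close Q Q') ->
  tot (fun n y => (has (fun Q => onT Q n y) S0)%:R) <= 5 * Wmass.
Proof.
move=> h; rewrite /Wmass -totZ; apply: le_dsum => n _.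
apply: (@le_trans _ _ (dsum H 0 (fun y => dsum H 0 (fun y' =>
   (inW n y')%:R * ((y' <= y + 2) && (y <= y' + 2))%N%:R)))).
  apply: le_dsum => y _; case: (boolP (has _ _)) => [/hasP[Q QS0 /andP[/eqP i1 /eqP y1]]|_]; last first.
    by apply: dsum_ge0 => y'; rewrite mulr_ge0.
  have [Q' Q'S /and3P[k1 /eqP i2 /asboolP hc]] := h _ QS0.
  have e' : (n %/ 2 ^ tk Q' = ti Q')%N by rewrite -i2 -i1 divn_expK subnK.
  have lt' := tpos_lt delta0 (S_wf Q'S) e'.
  have [c1 c2] := hc _ i1.
  have inw : inW n (tpos Q' n) by apply/hasP; exists Q' => //; rewrite /onT e' !eqxx.
  apply: le_trans (ler_dsum_term (f := fun y' => (inW n y')%:R *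
     ((y' <= y + 2) && (y <= y' + 2))%N%:R) _ (n := tpos Q' n) _).
  - by rewrite inw y1 c1 c2 mulr1.
  - by move=> y'; rewrite mulr_ge0.
  - by apply/eqP; rewrite -ltn_expP.
rewrite /dsum exchange_big /=; apply: ler_sum => y' _.
by rewrite -mulr_sumr mulrC ler_wpM2r // count_window.
Qed.

(** Once the longest of three tubes is singled out, the others through the point number at most
    [rcount], which depends on the column only. Summing its square along the tube is [carleson2];
    the constant is 3 times 2. *)
Lemma third_moment : tot (fun n y => Phi n y ^+ 3) * delta ^+ 2 <= 6 * Wmass.
Proof.
apply: (@le_trans _ _ (tot (fun n y => 3 * \sum_(Q <- S) gw Q * ((onT Q n y)%:R *
   rcount n (tk Q) (tk Q) ^+ 2)) * delta ^+ 2)).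
  rewrite ler_wpM2r ?sqr_ge0 //; apply: le_tot => n y.
  apply: le_trans (sum_cube_sorted tk _ _) _.
    by move=> Q; rewrite mulr_ge0 ?gw_ge0.
  rewrite ler_wpM2l // big_seq [leRHS]big_seq; apply: ler_sum => Q QS.
  rewrite -mulrA ler_wpM2l ?gw_ge0 // ler_wpM2l // lerXn2r ?nnegrE ?rcount_ge0 //.
    by apply: sumr_ge0 => Q' _; rewrite mulr_ge0 ?gw_ge0.
  apply: le_trans (count_short delta0 S_wf S_uniq S_far n y (tk_le (S_wf QS))).
  rewrite big_seq_cond [leRHS]big_seq_cond; apply: ler_sum => Q' /andP[Q'S _].
  by rewrite -[leRHS]mul1r ler_wpM2r // gw_le1.
rewrite totZ tot_sum (_ : 6 * Wmass = 3 * (2 * Wmass)); last by ring.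
rewrite -mulrA ler_wpM2l // -(sum_gw K H m delta S_uniq) mulr_suml mulr_sumr big_seq [leRHS]big_seq.
apply: ler_sum => Q QS; rewrite totZ -mulrA [leRHS]mulrCA ler_wpM2l ?gw_ge0 //.
rewrite (tot_tube delta0 (fun n _ => rcount n (tk Q) (tk Q) ^+ 2) (S_wf QS)).
exact: (carleson2 m0 m1 delta0 _ (tk_le (S_wf QS))).
Qed.

End Family.
End Moments.

Section Moments.
Variables (R : realType) (K H H1 H2 : nat) (m : nat -> nat -> R) (delta : R).
Hypothesis m0 : forall n a, 0 <= m n a.
Hypothesis m1 : forall n, \sum_(a < 2 ^ K.+1) m n a <= 1.
Hypothesis delta0 : 0 < delta.

Local Notation good := (good K m delta).
Local Notation slope := (slope K m delta).
Local Notation rmin := (rmin K m delta).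
Local Notation rcount := (rcount K m delta).
Local Notation tslope := (tslope K m delta).
Local Notation tpos := (tpos K m delta).
Local Notation onT := (onT K m delta).
Local Notation wf_tube := (wf_tube K H m delta).
Local Notation tot := (@tot R K H).
Local Notation close := (close K m delta).

(* Tubes of slope [a] become horizontal; the term [2 ^ K.+1] avoids truncation. *)
Definition shear a Q n : nat := (tpos Q n + (2 ^ K.+1 - rise K a n))%N.

Definition box_spec a Q (b : nat * bool * nat) : Prop :=
  let: (r, sg, J) := b in
  [/\ (r <= K + 5)%N,
  (forall n, (n %/ 2 ^ tk Q = ti Q)%N -> ((shear a Q n + sg * third (K + 5)) %/ 2 ^ r = J)%N) &
  (forall u0, (count (fun n => shear a Q n == u0) (iota (ti Q * 2 ^ tk Q) (2 ^ tk Q)) * 2 ^ r <=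
     42 * 2 ^ tk Q)%N)].

Lemma box_choice : exists bx : nat * tube -> nat * bool * nat,
  forall a Q, wf_tube Q -> (a < 2 ^ K.+1)%N -> box_spec a Q (bx (a, Q)).
Proof.
suff /choice[f hf] : forall aQ : nat * tube, exists b, wf_tube aQ.2 -> (aQ.1 < 2 ^ K.+1)%N ->
    box_spec aQ.1 aQ.2 b.
  by exists f => a Q; apply: (hf (a, Q)).
case=> a Q /=; case: (boolP (wf_tube Q)) => [w|]; last by exists (0%N, false, 0%N).
case: (ltnP a (2 ^ K.+1)) => [ha|]; last by exists (0%N, false, 0%N).
have hi : (ti Q < 2 ^ (K - tk Q))%N by case/and3P: w.
have hb : (tslope Q < 2 ^ K.+1)%N by case/and3P: (w) => g _ _; apply: slope_lt delta0 _ _ _ g.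
have [r [sg [J [h1 h2 h3]]]] := box_ex (tt Q) (tk_le w) hi ha hb.
by exists (r, sg, J).
Qed.
Section Family.
Variable S : seq tube.
Hypothesis S_wf : forall Q, Q \in S -> wf_tube Q.
Hypothesis S_uniq : uniq S.
Hypothesis S_far : forall Q1 Q2, Q1 \in S -> Q2 \in S -> Q1 != Q2 ->
  (tk Q2 <= tk Q1)%N -> ~~ close Q2 Q1.
Local Notation inW := (inW K m delta S).
Local Notation rho := (rho K m delta S).
Local Notation emass := (emass K H m delta S).
Local Notation gw := (gw K H m delta S).
Local Notation Phi := (Phi K H m delta S).
Local Notation Wmass := (Wmass K H m delta S).

Hypothesis H1P : (2 ^ H + 2 ^ K.+1 <= 2 ^ H1)%N.
Hypothesis H2P : (third (K + 5) + 2 ^ H1 <= 2 ^ H2)%N.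
Hypothesis H2K : (K + 5 <= H2)%N.
Variable bx : nat * tube -> nat * bool * nat.
Hypothesis bxP : forall a Q, wf_tube Q -> (a < 2 ^ K.+1)%N -> box_spec a Q (bx (a, Q)).

Section Slope.
Variables (rel : pred tube) (a : nat).
Hypothesis aX : (a < 2 ^ K.+1)%N.

Definition in_box Q n u : bool :=
  let: (r, sg, J) := bx (a, Q) in
  (n %/ 2 ^ tk Q == ti Q)%N && ((u + sg * third (K + 5)) %/ 2 ^ r == J)%N.

(** The tubes seen in the coordinates sheared by the slope [a], each spread evenly over the height
    [2 ^ r] of its box. *)
Definition Psi n u : R := \sum_(Q <- S | rel Q)
  gw Q / (2 ^ (bx (a, Q)).1.1)%N%:R * (in_box Q n u)%:R.

Definition totU (f : nat -> nat -> R) : R := dsum K 0 (fun n => dsum H1 0 (f n)).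

Variables (ind : nat -> nat -> R).
Hypothesis ind01 : forall n u, 0 <= ind n u <= 1.

(** Translating the function instead of the grid turns the boxes of the shifted grid into dyadic
    ones. *)
Definition shifted (sg : bool) n v : R :=
  let c := (sg * third (K + 5))%N in
  if (c <= v < c + 2 ^ H1)%N then ind n (v - c)%N else 0.

Lemma shifted01 sg n v : 0 <= shifted sg n v <= 1.
Proof. by rewrite /shifted; case: ifP => _; rewrite ?ind01 ?lexx ?ler01. Qed.

Lemma shift_fit (sg : bool) : (sg * third (K + 5) + 2 ^ H1 <= 2 ^ H2)%N.
Proof. by case: sg; rewrite ?mul1n // mul0n; apply: leq_trans H2P; rewrite leq_addl. Qed.

Lemma dsum_shifted sg n : dsum H2 0 (shifted sg n) = dsum H1 0 (ind n).
Proof.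
rewrite (dsum_shift_eq (shift_fit sg)); last by move=> v /negbTE h; rewrite /shifted h.
apply: eq_dsum => u /eqP; rewrite -ltn_expP => hu; rewrite /shifted addnK leq_addl /=.
by rewrite addnC ltn_add2l hu.
Qed.

Definition dmx sg n v := dmax2 K H2 (shifted sg) n v.

(** The left side is [emass Q] times the average of [ind] over the box of [Q]. Every point charged
    to [Q] is sheared into this box, so the average is at most the strong maximal function there. *)
Lemma pair_box Q : Q \in S ->
  gw Q / (2 ^ (bx (a, Q)).1.1)%N%:R * totU (fun n u => (in_box Q n u)%:R * ind n u) <=
  tot (fun n y => (inW n y && (rho n y == Q))%:R *
    dmx (bx (a, Q)).1.2 n (y + (2 ^ K.+1 - rise K a n) + (bx (a, Q)).1.2 * third (K + 5))%N).
Proof.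
move=> QS; have w := S_wf QS; have := bxP w aX.
have -> : (fun n u => (in_box Q n u)%:R * ind n u) = (fun n u =>
  (n %/ 2 ^ tk Q == ti Q)%N%:R * ((((u + (bx (a, Q)).1.2 * third (K + 5)) %/ 2 ^ (bx (a, Q)).1.1 ==
     (bx (a, Q)).2)%N)%:R * ind n u)).
  apply/funext => n; apply/funext => u; rewrite /in_box; case: (bx _) => [[r sg] J] /=.
  by rewrite -mulnb natrM mulrA.
case: (bx (a, Q)) => [[r sg] J] /= [rK hJ _].
have e1 : totU (fun n u => (n %/ 2 ^ tk Q == ti Q)%N%:R *
    (((u + sg * third (K + 5)) %/ 2 ^ r == J)%N%:R * ind n u)) =
  dsum (tk Q) (ti Q) (fun n => dsum H1 0 (fun u =>
     ((u + sg * third (K + 5)) %/ 2 ^ r == J)%N%:R * ind n u)).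
  rewrite /totU -(@dsum_restrict _ _ K _ 0 _ (tk_le w)); last first.
    by apply/eqP; rewrite -ltn_expP; case/and3P: w.
  by apply: eq_dsum => n _; rewrite -dsumZ.
rewrite e1.
have n0 : ((ti Q * 2 ^ tk Q) %/ 2 ^ tk Q = ti Q)%N by rewrite mulnK ?expn_gt0.
have hJ2 : (J %/ 2 ^ (H2 - r) = 0)%N.
  apply/eqP; rewrite -(hJ _ n0) divn_expK subnK; last by apply: leq_trans rK H2K.
  rewrite -ltn_expP; apply: leq_trans (shift_fit sg).
  rewrite addnC ltn_add2l /shear; apply: leq_trans H1P; rewrite -addSn leq_add ?leq_subr //.
  exact: (tpos_lt delta0 w n0).
have e2 : dsum (tk Q) (ti Q) (fun n => dsum H1 0 (fun u =>
     ((u + sg * third (K + 5)) %/ 2 ^ r == J)%N%:R * ind n u)) <=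
   dsum (tk Q) (ti Q) (fun n => dsum r J (shifted sg n)).
  apply: le_dsum => n _.
  rewrite -(@dsum_restrict _ r H2 J 0 _ _ hJ2); last by apply: leq_trans rK H2K.
  rewrite (dsum_shift_eq (shift_fit sg)); last first.
    by move=> v /negbTE h; rewrite /shifted h mulr0.
  apply: le_dsum => u /eqP; rewrite -ltn_expP => hu; rewrite /shifted addnK leq_addl /=.
  by rewrite [X in (X < _)%N]addnC ltn_add2l hu.
apply: (@le_trans _ _ (emass Q * (dsum (tk Q) (ti Q) (fun n => dsum r J (shifted sg n)) /
    ((2 ^ tk Q)%N%:R * (2 ^ r)%N%:R)))).
  rewrite /gw invfM !mulrA mulrAC ler_wpM2r ?invr_ge0 ?ler0n //.
  rewrite -!mulrA ler_wpM2l ?emass_ge0 // mulrC ler_wpM2r ?invr_ge0 ?ler0n //.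
rewrite /emass mulrC -totZ; apply: le_tot => n y; rewrite mulrC.
case: (boolP (inW n y && _)) => [/andP[hw /eqP hQ]|_]; last by rewrite !mul0r.
rewrite !mul1r; have [_ ] := rhoP hw; rewrite hQ => /andP[/eqP hn /eqP hy].
have hv := hJ _ hn; rewrite /shear -hy in hv.
rewrite ler_pdivrMr ?mulr_gt0 ?natr_exp2_gt0 // mulrC -hv -hn.
by apply: avg_le_dmax2; rewrite ?tk_le // ?(tk_le w) // (leq_trans rK).
Qed.

(** The charges being disjoint, the maximal functions at the charged points add up to at most one
    sum over the grid for each of the two shifts. Values up to [2 * e] are paid for by the charges,
    the excess by the L log L inequality. *)
Lemma sum_boxes e : 0 < e <= 1 ->
  totU (fun n u => Psi n u * ind n u) <=
  4 * e * (\sum_(Q <- S | rel Q) emass Q) + 2 * ln e^-1 ^+ 2 * totU ind.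
Proof.
move=> he; have e0 : 0 <= e by case/andP: he => /ltW.
pose D sg n y := dmx sg n (y + (2 ^ K.+1 - rise K a n) + sg * third (K + 5))%N.
pose P sg n y := pos (D sg n y - 2 * e).
have hP sg : tot (P sg) <= ln e^-1 ^+ 2 * totU ind.
  apply: (@le_trans _ _ (dsum K 0 (fun n => dsum H2 0 (fun v => pos (dmx sg n v - 2 * e))))).
    apply: le_dsum => n _; rewrite /P /D.
    have := @le_dsum_shift R H H2 ((2 ^ K.+1 - rise K a n) + sg * third (K + 5)) (fun v =>
      pos (dmx sg n v - 2 * e)) _ (fun _ => pos_ge0 _).
    rewrite addnAC; under eq_dsum do rewrite addnA; apply.
    apply: leq_trans (shift_fit sg); rewrite addnC leq_add2l.
    by apply: leq_trans H1P; rewrite addnC leq_add2l leq_subr.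
  apply: le_trans (dmax2_llogl _ _ _ he) _; first by move=> *; apply: shifted01.
  rewrite ler_wpM2l ?sqr_ge0 // /totU; apply: le_dsum => n _; by rewrite dsum_shifted.
have -> : totU (fun n u => Psi n u * ind n u) = \sum_(Q <- S | rel Q)
   gw Q / (2 ^ (bx (a, Q)).1.1)%N%:R * totU (fun n u => (in_box Q n u)%:R * ind n u).
  rewrite /totU; under [RHS]eq_bigr do rewrite -dsumZ; rewrite -dsum_sum.
  apply: eq_dsum => n _; under [RHS]eq_bigr do rewrite -dsumZ; rewrite -dsum_sum.
  by apply: eq_dsum => u _; rewrite /Psi mulr_suml; apply: eq_bigr => Q _; rewrite mulrA.
apply: (@le_trans _ _ (\sum_(Q <- S | rel Q) tot (fun n y =>
   (inW n y && (rho n y == Q))%:R * (4 * e + (P false n y + P true n y))))).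
  rewrite big_seq_cond [leRHS]big_seq_cond; apply: ler_sum => Q /andP[QS _].
  apply: le_trans (pair_box QS) _; apply: le_tot => n y; apply: ler_wpM2l => //.
  have h sg : dmx sg n (y + (2 ^ K.+1 - rise K a n) + sg * third (K + 5))%N <=
     4 * e + (P false n y + P true n y).
    have h0 := le_pos (D sg n y - 2 * e).
    have h1 : 0 <= P false n y := pos_ge0 _; have h2 : 0 <= P true n y := pos_ge0 _.
    rewrite -/(D sg n y); case: sg h0; rewrite -/(P _ n y); lra.
  exact: h.
apply: (@le_trans _ _ (4 * e * (\sum_(Q <- S | rel Q) emass Q) +
   \sum_(Q <- S) tot (fun n y => (inW n y && (rho n y == Q))%:R * (P false n y + P true n y)))).
  rewrite mulr_sumr.
  apply: (@le_trans _ _ (\sum_(Q <- S | rel Q) (4 * e * emass Q +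
     tot (fun n y => (inW n y && (rho n y == Q))%:R * (P false n y + P true n y))))).
    apply: ler_sum => Q _; rewrite /emass -totZ -totD; apply: le_tot => n y.
    by rewrite mulrDr [_ * (4 * e)]mulrC.
  rewrite big_split lerD2l /= [leRHS](bigID rel) /= lerDl; apply: sumr_ge0 => Q _.
  by apply: tot_ge0 => n y; rewrite mulr_ge0 // addr_ge0 ?pos_ge0.
rewrite lerD2l (sum_emass K H m delta S_uniq (fun _ n y => P false n y + P true n y)).
apply: (@le_trans _ _ (tot (fun n y => P false n y + P true n y))).
  apply: le_tot => n y; rewrite -[leRHS]mul1r ler_wpM2r ?addr_ge0 ?pos_ge0 //.
  by case: (inW n y).
by rewrite totD (_ : 2 * _ = ln e^-1 ^+ 2 + ln e^-1 ^+ 2) ?mulrDl ?lerD //; ring.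
Qed.

End Slope.

(** Test [sum_boxes] on the set where [Psi] exceeds [lam]; [lam] is the value for which the L log L
    term cancels. *)
Lemma exceptional rel a e : (a < 2 ^ K.+1)%N -> 0 < e <= 1 ->
  totU (fun n u => pos (Psi rel a n u - 2 * ln e^-1 ^+ 2)) <=
  4 * e * \sum_(Q <- S | rel Q) emass Q.
Proof.
move=> aX he; set lam := 2 * _.
pose ind n u : R := (lam < Psi rel a n u)%R%:R.
have i01 n u : 0 <= ind n u <= 1 by rewrite /ind; case: (lam < _)%R; rewrite ?lexx ?ler01.
have := @sum_boxes rel a aX ind i01 e he; rewrite -/lam.
have -> : totU (fun n u => Psi rel a n u * ind n u) =
    totU (fun n u => pos (Psi rel a n u - lam)) + lam * totU ind.
  rewrite /totU -dsumZ -dsumD; apply: eq_dsum => n _; rewrite -dsumZ -dsumD.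
  apply: eq_dsum => u _; rewrite /ind /pos; case: ltP => h.
    by rewrite !mulr1 max_r ?subr_ge0 ?ltW // subrK.
  by rewrite !mulr0 addr0 max_l // subr_le0.
by rewrite lerD2r.
Qed.

(** The slopes [a] of good tiles at least as long as [Q] over one of its columns, where columns with
    a count above [M] are left out: the only shears in which [Q] has to be considered. *)
Definition related M a Q : bool := `[< exists n k' j', [/\ (n %/ 2 ^ tk Q = ti Q)%N,
  (tk Q <= k' <= K)%N, good k' (n %/ 2 ^ k') j', slope k' (n %/ 2 ^ k') j' = a &
  (rcount n k' k' <= M :> R)%R] >].

(* All slopes related to [Q] are read off one column, at the coarsest level occurring among them. *)
Lemma count_related M Q : 0 <= M ->
  \sum_(a < 2 ^ K.+1) (related M a Q)%:R <= M.
Proof.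
move=> M0; pose A := [seq a <- iota 0 (2 ^ K.+1) | related M a Q].
have -> : \sum_(a < 2 ^ K.+1) (related M a Q)%:R = (size A)%:R :> R.
  rewrite size_filter -sum1_count natr_sum [RHS]big_mkcond /=.
  have -> : iota 0 (2 ^ K.+1) = index_iota 0 (2 ^ K.+1) by rewrite /index_iota subn0.
  rewrite big_mkord.
  by apply: eq_bigr => a _; case: (related _ _ _).
pose P k' := (tk Q <= k' <= K)%N && `[< exists n j', [/\ (n %/ 2 ^ tk Q = ti Q)%N,
  good k' (n %/ 2 ^ k') j' & (rcount n k' k' <= M :> R)%R] >].
case: (eqVneq A [::]) => [->|A0]; first by [].
have exP : exists k', P k'.
  have : nth 0%N A 0 \in A by rewrite mem_nth // lt0n size_eq0.
  rewrite mem_filter => /andP[/asboolP[n [k' [j' [h1 h2 h3 _ h4]]]] _].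
  by exists k'; rewrite /P h2; apply/asboolP; exists n, j'.
have bP k' : P k' -> (k' <= K)%N by case/andP => /andP[].
case: (ex_maxnP exP bP) => k1 /andP[/andP[hk1 k1K] /asboolP[n [j [hn _ hM]]]] kmax.
apply: le_trans hM; apply: (size_slopes delta0 k1K); first by rewrite filter_uniq ?iota_uniq.
move=> a; rewrite mem_filter => /andP[/asboolP[n' [k' [j' [g1 g2 g3 g4 g5]]]] _].
have k'1 : (k' <= k1)%N by apply: kmax; rewrite /P g2; apply/asboolP; exists n', j'.
have e : (n' %/ 2 ^ k' = n %/ 2 ^ k')%N.
  by case/andP: g2 => /subnK <- _; rewrite -!divn_expK g1 hn.
by exists k', j'; rewrite -e.
Qed.

Let Ps M a := Psi (related M a) a.
Let height Q := (tt Q + 2 ^ K.+1)%N.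

(** Columns with [rcount] above [M] are handled by [rcount <= rcount ^ 2 / M]. Elsewhere every
    shorter tube meeting [Q'] is related to the slope of [Q']. Shearing by this slope makes [Q']
    horizontal, and the box property bounds the number of columns where the two meet. *)
Lemma good_pairs M Q' : Q' \in S -> 0 < M ->
  dsum (tk Q') (ti Q') (fun n =>
    \sum_(Q <- S | (tk Q <= tk Q')%N) gw Q * (onT Q n (tpos Q' n))%:R) <=
  dsum (tk Q') (ti Q') (fun n => rcount n (tk Q') (tk Q') ^+ 2 / M) +
  42 * dsum (tk Q') (ti Q') (fun n => Ps M (tslope Q') n (height Q')).
Proof.
move=> S' M0; have w' := S_wf S'.
have ha' : (tslope Q' < 2 ^ K.+1)%N by case/and3P: (w') => g _ _; apply: slope_lt delta0 _ _ _ g.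
set k' := tk Q'; set a' := tslope Q'.
apply: (@le_trans _ _ (dsum k' (ti Q') (fun n => rcount n k' k' ^+ 2 / M +
   \sum_(Q <- S | (tk Q <= k')%N && related M a' Q) gw Q * (onT Q n (tpos Q' n))%:R))).
  apply: le_dsum => n hn; case: (lerP (rcount n k' k') M) => hM.
    apply: ler_wpDl; first by rewrite divr_ge0 ?sqr_ge0 ?ltW.
    rewrite [leLHS](bigID (related M a')) /= [X in _ + X]big1_seq ?addr0 // => Q /andP[/andP[hk hr] QS].
    case: (boolP (onT Q n (tpos Q' n))) => [/andP[/eqP on _]|_]; last by rewrite mulr0.
    exfalso; move/negP: hr; apply; apply/asboolP; exists n, k', (tj Q'); split=> //.
    - by rewrite hk (tk_le w').
    - by rewrite hn; case/and3P: w'.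
    - by rewrite hn.
  apply: ler_wpDr.
    by apply: sumr_ge0 => Q _; rewrite mulr_ge0 ?gw_ge0.
  apply: (@le_trans _ _ (rcount n k' k')).
    apply: le_trans (count_short delta0 S_wf S_uniq S_far n (tpos Q' n) (tk_le w')).
    rewrite big_seq_cond [leRHS]big_seq_cond; apply: ler_sum => Q /andP[QS _].
    by rewrite -[leRHS]mul1r ler_wpM2r // gw_le1.
  by rewrite expr2 ler_pdivlMr // ler_wpM2l ?rcount_ge0 ?ltW.
rewrite dsumD lerD2l dsum_sum -dsumZ.
rewrite [leRHS](_ : _ = \sum_(Q <- S | related M a' Q) dsum k' (ti Q') (fun n =>
    42 * (gw Q / (2 ^ (bx (a', Q)).1.1)%N%:R * (in_box a' Q n (height Q'))%:R))); last first.
  by rewrite -dsum_sum; apply: eq_dsum => n _; rewrite /Ps /Psi mulr_sumr.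
rewrite [leRHS](bigID (fun Q => (tk Q <= k')%N)) /=; apply: ler_wpDr.
  apply: sumr_ge0 => Q _; apply: dsum_ge0 => n.
  by rewrite mulr_ge0 // mulr_ge0 // divr_ge0 ?gw_ge0.
under [leRHS]eq_bigl do rewrite andbC.
rewrite big_seq_cond [leRHS]big_seq_cond; apply: ler_sum => Q /andP[QS /andP[hk hr]].
have w := S_wf QS; have := bxP w ha'; rewrite -/a'.
rewrite /in_box; case: (bx (a', Q)) => [[r sg] J] /= [_ hJ hc].
rewrite [leRHS](_ : _ = gw Q * ((2 ^ r)%N%:R^-1 * (42 * dsum k' (ti Q') (fun n =>
  ((n %/ 2 ^ tk Q == ti Q)%N && ((height Q' + sg * third (K + 5)) %/ 2 ^ r == J)%N)%:R)))); last first.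
  by rewrite -!dsumZ; apply: eq_dsum => n _; ring.
rewrite [leLHS]dsumZ; apply: ler_wpM2l; first exact: gw_ge0.
have r0 := @natr_exp2_gt0 R r; rewrite ler_pdivlMl //.
have heq n : (n %/ 2 ^ k' = ti Q')%N -> (n < 2 ^ K)%N -> onT Q n (tpos Q' n) ->
    shear a' Q n = height Q'.
  move=> hn nK /andP[_ /eqP e]; rewrite /shear -e /tpos /height -/a'.
  have : (rise K a' n < 2 ^ K.+1)%N.
    by rewrite /rise ltn_divLR ?expn_gt0 //; apply: ltn_mul.
  move: (rise K a' n) (2 ^ K.+1)%N (tt Q'); clear; lia.
have nK n : (n %/ 2 ^ k' = ti Q')%N -> (n < 2 ^ K)%N by apply: in_tube_lt w'.
case: (pselect (exists2 n, (n %/ 2 ^ k' = ti Q')%N & onT Q n (tpos Q' n))) => [[n1 hn1 on1]|hno]; last first.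
  rewrite /dsum big1_seq => [|n /andP[_]]; last first.
    rewrite mem_dyadic => /eqP hn; case: (boolP (onT _ _ _)) => // on; exfalso; apply: hno.
    by exists n.
  by rewrite mulr0 mulr_ge0 // sumr_ge0 // => n _; rewrite ler0n.
have i1 : (n1 %/ 2 ^ tk Q = ti Q)%N by case/andP: on1 => /eqP.
have hh := heq _ hn1 (nK _ hn1) on1.
have hb : ((height Q' + sg * third (K + 5)) %/ 2 ^ r = J)%N by rewrite -hh hJ.
have ei : (ti Q %/ 2 ^ (k' - tk Q) = ti Q')%N by rewrite -i1 divn_expK subnK.
(* As [Q] meets [Q'] over [n1], its box contains the height of [Q'], and the box test succeeds over
   all columns of [Q]. *)
have -> : dsum k' (ti Q') (fun n => ((n %/ 2 ^ tk Q == ti Q)%N &&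
    ((height Q' + sg * third (K + 5)) %/ 2 ^ r == J)%N)%:R) = (2 ^ tk Q)%N%:R :> R.
  rewrite -[RHS]mulr1 -(dsum_const (tk Q) (ti Q)) -(dsum_restrict (fun=> 1) hk ei).
  by apply: eq_dsum => n _; rewrite hb eqxx andbT mulr1.
apply: (@le_trans _ _ ((count (fun n => shear a' Q n == height Q')
    (iota (ti Q * 2 ^ tk Q) (2 ^ tk Q)))%:R * (2 ^ r)%N%:R)); last first.
  by rewrite -!natrM ler_nat hc.
rewrite mulrC ler_wpM2r ?ler0n //.
apply: (@le_trans _ _ (dsum k' (ti Q') (fun n => (n %/ 2 ^ tk Q == ti Q)%N%:R *
    (shear a' Q n == height Q')%:R))).
  apply: le_dsum => n hn; case: (boolP (onT _ _ _)) => on; last by rewrite mulr_ge0.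
  by rewrite (heq _ hn (nK _ hn) on) eqxx; case/andP: on => -> _; rewrite mulr1.
rewrite (dsum_restrict _ hk ei) /dsum -sum1_count natr_sum [leRHS]big_mkcond /=.
by apply: ler_sum => n _; case: eqP.
Qed.

(** Tubes of equal slope that share a column and a height after shearing share a point, hence
    coincide by [slope_neq]; so each [(n, u)] is used at most once for each [a]. *)
Lemma sum_by_slope (h : nat -> nat -> nat -> R) : (forall a n u, 0 <= h a n u) ->
  \sum_(Q <- S) dsum (tk Q) (ti Q) (fun n => h (tslope Q) n (height Q)) <=
  \sum_(a < 2 ^ K.+1) totU (h a).
Proof.
move=> h0.
have hs Q : Q \in S -> (tslope Q < 2 ^ K.+1)%N.
  by move=> QS; case/and3P: (S_wf QS) => g _ _; apply: slope_lt delta0 _ _ _ g.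
apply: (@le_trans _ _ (\sum_(Q <- S) \sum_(a < 2 ^ K.+1) totU (fun n u =>
   ((nat_of_ord a == tslope Q) && ((n %/ 2 ^ tk Q == ti Q)%N && (u == height Q)))%:R * h a n u))).
  rewrite big_seq [leRHS]big_seq; apply: ler_sum => Q QS; have w := S_wf QS.
  rewrite (bigD1 (Ordinal (hs _ QS))) //=; apply: ler_wpDr.
    by apply: sumr_ge0 => a _; apply: dsum_ge0 => n; apply: dsum_ge0 => u; rewrite mulr_ge0.
  have hi : (ti Q %/ 2 ^ (K - tk Q) = 0)%N by apply/eqP; rewrite -ltn_expP; case/and3P: w.
  rewrite /totU -(dsum_restrict _ (tk_le w) hi); apply: le_dsum => n _.
  rewrite eqxx /=; case: eqP => _ /=; last by rewrite mul0r; apply: dsum_ge0 => u; rewrite mul0r.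
  rewrite mul1r -(@dsum_point _ H1 (height Q) (h (tslope Q) n)) //.
  apply: leq_trans H1P; rewrite /height.
  case/and3P: w => _ _ hw; have : (0 < 2 ^ K.+1)%N by rewrite expn_gt0.
  move: hw; move: (2 ^ K.+1)%N (2 ^ H)%N (tt Q); clear; lia.
rewrite exchange_big; apply: ler_sum => a _ /=.
rewrite /totU -dsum_sum; apply: le_dsum => n _; rewrite -dsum_sum; apply: le_dsum => u _.
rewrite -mulr_suml -[leRHS]mul1r ler_wpM2r // -natr_sum lern1.
rewrite (_ : (\sum_(i <- S) _ = count (fun Q => (nat_of_ord a == tslope Q) &&
   ((n %/ 2 ^ tk Q == ti Q)%N && (u == height Q))) S)%N); last first.
  by rewrite -sum1_count [RHS]big_mkcond; apply: eq_bigr => Q _; case: (_ && _).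
rewrite leqNgt -size_filter; apply/negP; set f := [seq _ <- _ | _] => hsz.
have uf : uniq f by rewrite filter_uniq.
have : nth (0, 0, 0, 0)%N f 0 == nth (0, 0, 0, 0)%N f 1.
  have := mem_nth (0, 0, 0, 0)%N hsz; have := mem_nth (0, 0, 0, 0)%N (ltnW hsz).
  rewrite !mem_filter; move: (nth _ _ 0) (nth _ _ 1) => Q1 Q2.
  move=> /andP[/and3P[/eqP a1 i1 /eqP t1] s1] /andP[/and3P[/eqP a2 i2 /eqP t2] s2].
  apply/eqP; apply: (slope_neq delta0 S_wf S_far s1 s2 (n := n) (y := tpos Q1 n)).
  - by rewrite /onT i1 eqxx.
  - rewrite /onT i2 /tpos -a1 -a2; apply/eqP; congr (_ + _)%N.
    by apply/eqP; rewrite -(eqn_add2r (2 ^ K.+1)) -/(height Q1) -/(height Q2) -t1 -t2.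
  - by rewrite -a1 -a2.
by rewrite nth_uniq // ltnW.
Qed.

Lemma second_moment : delta <= 1 ->
  tot (fun n y => Phi n y ^+ 2) <= (340 + 672 * ln delta^-1 ^+ 2) * Wmass.
Proof.
(* With [M = delta ^- 2], the columns with a large count cost a constant by [carleson2]; [e = 1 / M]
   then pays for the at most [M] shears related to a tube. *)
move=> d1; pose M := delta ^- 2; pose e := delta ^+ 2.
have M0 : 0 < M by rewrite invr_gt0 exprn_gt0.
have he : 0 < e <= 1 by rewrite exprn_gt0 //= expr_le1 // ltW.
have eM : e * M = 1 by rewrite /M divff // gt_eqF // exprn_gt0.
set lam := 2 * ln e^-1 ^+ 2.
have lamE : lam = 8 * ln delta^-1 ^+ 2.
  rewrite /lam /e -exprVn lnXn ?invr_gt0 //; ring.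
have lam0 : 0 <= lam by rewrite mulr_ge0 ?sqr_ge0.
have W0 : 0 <= Wmass by apply: tot_ge0 => *; apply: ler0n.
apply: (@le_trans _ _ (2 * \sum_(Q' <- S) gw Q' * dsum (tk Q') (ti Q') (fun n =>
    \sum_(Q <- S | (tk Q <= tk Q')%N) gw Q * (onT Q n (tpos Q' n))%:R))).
  apply: (@le_trans _ _ (tot (fun n y => 2 * \sum_(Q' <- S) gw Q' * ((onT Q' n y)%:R *
    \sum_(Q <- S | (tk Q <= tk Q')%N) gw Q * (onT Q n y)%:R)))).
    apply: le_tot => n y; apply: le_trans (sum_sq_sorted tk _ _) _.
      by move=> Q; rewrite mulr_ge0 ?gw_ge0.
    by rewrite ler_wpM2l //; apply: ler_sum => Q _; rewrite mulrA.
  rewrite totZ tot_sum ler_wpM2l // big_seq [leRHS]big_seq; apply: ler_sum => Q' QS'.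
  rewrite totZ ler_wpM2l ?gw_ge0 //.
  by rewrite (tot_tube delta0 (fun n y => \sum_(Q <- S | (tk Q <= tk Q')%N)
    gw Q * (onT Q n y)%:R) (S_wf QS')).
apply: (@le_trans _ _ (2 * \sum_(Q' <- S) gw Q' * (2 * (2 ^ tk Q')%N%:R +
   42 * dsum (tk Q') (ti Q') (fun n => Ps M (tslope Q') n (height Q'))))).
  rewrite ler_wpM2l // big_seq [leRHS]big_seq; apply: ler_sum => Q' QS'.
  rewrite ler_wpM2l ?gw_ge0 //; apply: le_trans (good_pairs QS' M0) _.
  rewrite lerD2r.
  apply: le_trans (carleson2 m0 m1 delta0 (ti Q') (tk_le (S_wf QS'))).
  rewrite mulrC -dsumZ; apply: le_dsum => n _.
  by rewrite /M invrK mulrC.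
(* Here 340 = 4 + 84 * 4, and 672 = 84 * 8 as [lam = 8 * ln delta^-1 ^ 2]. *)
have -> : (340 + 672 * ln delta^-1 ^+ 2) * Wmass =
    2 * (2 * Wmass + 42 * (lam * Wmass + 4 * Wmass)) by rewrite lamE; ring.
rewrite ler_wpM2l //; under eq_bigr do rewrite mulrDr mulrCA [gw _ * (42 * _)]mulrCA.
rewrite big_split -!mulr_sumr (sum_gw K H m delta S_uniq) lerD2l ler_wpM2l //.
(* Only the excess of [Ps] over [lam] is summed by slope, with its weight [gw] bounded by 1. *)
apply: (@le_trans _ _ (\sum_(Q' <- S) (lam * (gw Q' * (2 ^ tk Q')%N%:R) +
   dsum (tk Q') (ti Q') (fun n => pos (Ps M (tslope Q') n (height Q') - lam))))).
  rewrite big_seq [leRHS]big_seq; apply: ler_sum => Q' QS'.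
  apply: (@le_trans _ _ (gw Q' * (dsum (tk Q') (ti Q') (fun n => lam +
     pos (Ps M (tslope Q') n (height Q') - lam))))).
    rewrite ler_wpM2l ?gw_ge0 //; apply: le_dsum => n _.
    by have := le_pos (Ps M (tslope Q') n (height Q') - lam); lra.
  rewrite dsumD dsum_const mulrDr mulrA mulrC lerD2l -[leRHS]mul1r ler_wpM2r ?gw_le1 //.
  by apply: dsum_ge0 => n; apply: pos_ge0.
rewrite big_split -mulr_sumr (sum_gw K H m delta S_uniq) lerD2l.
apply: le_trans (sum_by_slope (h := fun a n u => pos (Ps M a n u - lam)) _) _.
  by move=> *; apply: pos_ge0.
apply: (@le_trans _ _ (\sum_(a < 2 ^ K.+1) 4 * e * \sum_(Q <- S | related M a Q) emass Q)).
  by apply: ler_sum => a _; apply: exceptional.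
rewrite -mulr_sumr -mulrA ler_wpM2l //.
apply: (@le_trans _ _ (e * (M * Wmass))); last by rewrite mulrA eM mul1r.
rewrite ler_wpM2l; first by [].
  by rewrite ltW //; case/andP: he.
under eq_bigr do rewrite big_mkcond.
rewrite exchange_big /= -(sum_gw K H m delta S_uniq) mulr_sumr; apply: ler_sum => Q _.
rewrite gwE; apply: le_trans (ler_wpM2r (emass_ge0 _ _ _ _ _ _) (count_related Q (ltW M0))).
rewrite mulr_suml; apply: ler_sum => a _; case: (related _ _ _); rewrite ?mul1r ?mul0r //.
Qed.

End Family.
End Moments.

(** * Interpolation *)

Lemma ler_sum_subset (R : realDomainType) (T : eqType) (s1 s2 : seq T) (g : T -> R) :
  uniq s1 -> uniq s2 -> {subset s1 <= s2} -> (forall x, 0 <= g x) ->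
  \sum_(x <- s1) g x <= \sum_(x <- s2) g x.
Proof.
move=> u1 u2 h g0; rewrite [leRHS](bigID (mem s1)) /= -[X in _ <= X + _]big_filter.
have -> : \sum_(x <- s1) g x = \sum_(x <- [seq x <- s2 | x \in s1]) g x.
  apply: perm_big; apply: uniq_perm => //; first by rewrite filter_uniq.
  by move=> x; rewrite mem_filter; case: (boolP (x \in s1)) => //= /h ->.
by rewrite lerDl sumr_ge0.
Qed.

Lemma sum_points_le (R : realType) K H (pts : seq (nat * nat)) (G : nat -> nat -> R) :
  uniq pts -> (forall z, z \in pts -> (z.1 < 2 ^ K)%N /\ (z.2 < 2 ^ H)%N) ->
  (forall n y, 0 <= G n y) -> \sum_(z <- pts) G z.1 z.2 <= tot K H G.
Proof.
move=> u hz G0; rewrite /tot /dsum !mul0n.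
rewrite -(big_allpairs (F := fun z => G z.1 z.2)) /=.
apply: ler_sum_subset => //.
  by apply: allpairs_uniq; rewrite ?iota_uniq // => -[? ?] [? ?].
move=> [n y] /hz[h1 h2]; apply/allpairsP; exists (n, y).
by rewrite !mem_iota.
Qed.

Section Interpolation.
Variable R : realType.

(** The largest level below [v] is enough: [v] is at most 4 times that level, whence the factor
    16. *)
Lemma layer_cake (s0 v : R) mm : 0 < s0 -> 0 <= v -> v <= (2 ^+ mm * s0) ^+ 2 ->
  v ^+ 2 <= s0 ^+ 4 + \sum_(k < mm) 16 * (2 ^+ k * s0) ^+ 4 * ((2 ^+ k * s0) ^+ 2 < v)%R%:R.
Proof.
move=> s00 v0; elim: mm => [|mm IH] hv.
  rewrite big_ord0 addr0 expr0 mul1r in hv *.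
  by rewrite (_ : s0 ^+ 4 = (s0 ^+ 2) ^+ 2) ?lerXn2r ?nnegrE ?sqr_ge0 // -exprM.
rewrite big_ord_recr /= addrA; case: (lerP v ((2 ^+ mm * s0) ^+ 2)) => h.
  by rewrite mulr0 addr0 IH.
rewrite mulr1 ler_wpDl //.
  apply: addr_ge0; first by rewrite exprn_ge0 // ltW.
  apply: sumr_ge0 => k _.
  by rewrite mulr_ge0 // mulr_ge0 // exprn_ge0 // mulr_ge0 ?exprn_ge0 // ltW.
rewrite (_ : 16 * _ = ((2 ^+ mm.+1 * s0) ^+ 2) ^+ 2); last by rewrite [2 ^+ mm.+1]exprS; ring.
by rewrite lerXn2r ?nnegrE ?sqr_ge0.
Qed.

Lemma geometric_top (s0 x : R) mm : 0 < s0 -> 0 <= x ->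
  \sum_(k < mm) (2 ^+ k * s0) * ((2 ^+ k * s0) < x)%R%:R <= 2 * x.
Proof.
move=> s00 x0.
have full n : \sum_(k < n) (2 ^+ k * s0) * ((2 ^+ k * s0) < x)%R%:R <= 2 ^+ n * s0.
  elim: n => [|n IH]; first by rewrite big_ord0 expr0 mul1r ltW.
  rewrite big_ord_recr /= exprS.
  have : 2 ^+ n * s0 * (2 ^+ n * s0 < x)%R%:R <= 2 ^+ n * s0.
    by case: (_ < x)%R; rewrite ?mulr1 // mulr0 mulr_ge0 ?exprn_ge0 // ltW.
  move: IH; set u := \sum_(k < n) _; set w := _ * _ * _; lra.
elim: mm => [|mm IH]; first by rewrite big_ord0 mulr_ge0.
rewrite big_ord_recr /=; case: (ltrP (2 ^+ mm * s0) x) => h; last by rewrite mulr0 addr0.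
rewrite mulr1; have := full mm; move: h; set u := \sum_(k < mm) _; set w := 2 ^+ mm * s0; clearbody u w; lra.
Qed.

(* The levels [t < F <= B t] with [t] ranging over powers of 4 number at most [log_4 B]. *)
Lemma window_count (s0 x B : R) q mm : 0 < s0 -> B <= 4 ^+ q ->
  \sum_(k < mm) (((2 ^+ k * s0) ^+ 2 < x) && (x <= B * (2 ^+ k * s0) ^+ 2))%R%:R <= q%:R :> R.
Proof.
move=> s00 hB; rewrite -natr_sum ler_nat.
pose P k := ((2 ^+ k * s0) ^+ 2 < x) && (x <= B * (2 ^+ k * s0) ^+ 2).
pose A := [seq k <- iota 0 mm | P k].
have -> : (\sum_(k < mm) (P k) = size A)%N.
  rewrite size_filter -sum1_count [RHS]big_mkcond /=.
  have -> : iota 0 mm = index_iota 0 mm by rewrite /index_iota subn0.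
  by rewrite big_mkord; apply: eq_bigr => k _; case: (P k).
case: (eqVneq A [::]) => [->//|A0].
have [k0 k0A hk0] := seq_argmin id A0.
have : (size A <= size (iota k0 q))%N.
  apply: uniq_leq_size; first by rewrite filter_uniq ?iota_uniq.
  move=> k kA; rewrite mem_iota (hk0 _ kA) /= ltnNge; apply/negP => hk.
  move: kA k0A; rewrite !mem_filter => /andP[/andP[p1 _] _] /andP[/andP[_ p2] _].
  have : (2 ^+ k * s0) ^+ 2 < B * (2 ^+ k0 * s0) ^+ 2 by apply: lt_le_trans p2.
  rewrite !exprMn [ltRHS]mulrA ltr_pM2r ?exprn_gt0 //; apply/negP; rewrite -leNgt.
  rewrite -!exprM ![(_ * 2)%N]mulnC !exprM (_ : 2 ^+ 2 = 4 :> R); last by rewrite expr2; ring.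
  apply: le_trans (ler_wpM2r _ hB) _; first by rewrite exprn_ge0.
  by rewrite -exprD ler_weXn2l ?ler1n // addnC.
by rewrite size_iota.
Qed.

Lemma young32 (x y : R) : 0 <= x -> 0 <= y -> x ^+ 2 * y <= x ^+ 3 + y ^+ 3.
Proof.
move=> x0 y0; case: (lerP y x) => h.
  rewrite ler_wpDr ?exprn_ge0 // [leRHS]exprSr ler_wpM2l ?exprn_ge0 //.
rewrite ler_wpDl ?exprn_ge0 // [leRHS]exprSr ler_wpM2r // lerXn2r ?nnegrE //; exact: ltW.
Qed.

(** Small values of [f] are absorbed at half the level; the middle range is paired with the second
    moment by the arithmetic-geometric inequality with weight [kap]; where [f * h > s], Young's
    inequality calls for the third moment. *)
Lemma level_split (f s h kap ph : R) : 0 <= f -> 0 < s -> 0 < h -> 0 < kap -> 0 <= ph ->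
  f ^+ 2 * ph <= s ^+ 2 / 2 * ph +
    (kap / (2 * s ^+ 2) * f ^+ 4 * ((s ^+ 2 < 2 * f ^+ 2) && (2 * f ^+ 2 <= 2 * h ^- 2 * s ^+ 2))%R%:R
      + s ^+ 2 / (2 * kap) * ph ^+ 2) +
    (f ^+ 3 / (h * s) * (s < f * h)%R%:R + h ^+ 2 * s ^+ 2 * ph ^+ 3).
Proof.
move=> f0 s0 h0 k0 p0.
have a1 : 0 <= s ^+ 2 / 2 * ph by rewrite mulr_ge0 // divr_ge0 ?sqr_ge0.
have a2 : 0 <= kap / (2 * s ^+ 2) * f ^+ 4.
  by rewrite mulr_ge0 ?exprn_ge0 // divr_ge0 ?mulr_ge0 ?sqr_ge0 // ltW.
have a3 : 0 <= s ^+ 2 / (2 * kap) * ph ^+ 2.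
  by rewrite mulr_ge0 ?sqr_ge0 // divr_ge0 ?sqr_ge0 ?mulr_ge0 // ltW.
have a4 : 0 <= f ^+ 3 / (h * s).
  by rewrite divr_ge0 ?exprn_ge0 // mulr_ge0 // ltW.
have a5 : 0 <= h ^+ 2 * s ^+ 2 * ph ^+ 3 by rewrite !mulr_ge0 ?exprn_ge0 // ltW.
case: (lerP (2 * f ^+ 2) (s ^+ 2)) => c1 /=.
  have : f ^+ 2 * ph <= s ^+ 2 / 2 * ph.
    by rewrite ler_wpM2r // ler_pdivlMr // mulrC.
  have : 0 <= f ^+ 3 / (h * s) * (s < f * h)%R%:R by rewrite mulr_ge0.
  by rewrite mulr0; lra.
case: (lerP (2 * f ^+ 2) (2 * h ^- 2 * s ^+ 2)) => c2 /=.
  have e : f ^+ 2 * ph <= kap / (2 * s ^+ 2) * f ^+ 4 + s ^+ 2 / (2 * kap) * ph ^+ 2.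
    rewrite -subr_ge0.
    have -> : kap / (2 * s ^+ 2) * f ^+ 4 + s ^+ 2 / (2 * kap) * ph ^+ 2 - f ^+ 2 * ph =
      (kap * f ^+ 2 - s ^+ 2 * ph) ^+ 2 / (2 * s ^+ 2 * kap).
      by field; rewrite ?gt_eqF.
    by rewrite divr_ge0 ?sqr_ge0 // !mulr_ge0 ?sqr_ge0 // ltW.
  have : 0 <= f ^+ 3 / (h * s) * (s < f * h)%R%:R by rewrite mulr_ge0.
  rewrite mulr1; lra.
have c3 : s < f * h.
  rewrite -(@ltr_pXn2r _ 2) // ?nnegrE ?mulr_ge0 ?(ltW s0) ?(ltW h0) // exprMn.
  rewrite -ltr_pdivrMr ?exprn_gt0 //.
  by move: c2; rewrite -mulrA ltr_pM2l // mulrC.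
rewrite c3 mulr0 mulr1.
have hs : 0 < h * s by rewrite mulr_gt0.
have := young32 (divr_ge0 f0 (ltW hs)) p0.
rewrite -(@ler_pM2l _ ((h * s) ^+ 2)) ?exprn_gt0 //.
have -> : (h * s) ^+ 2 * ((f / (h * s)) ^+ 2 * ph) = f ^+ 2 * ph.
  by field; rewrite ?gt_eqF.
have -> : (h * s) ^+ 2 * ((f / (h * s)) ^+ 3 + ph ^+ 3) =
    f ^+ 3 / (h * s) + h ^+ 2 * s ^+ 2 * ph ^+ 3 by field; rewrite ?gt_eqF.
by lra.
Qed.

Lemma exists_pow4 (y : R) : 1 <= y -> exists2 q : nat, y <= 4 ^+ q & q%:R <= 1 + ln y.
Proof.
move=> y1; have y0 : 0 < y by apply: lt_le_trans y1.
have hl4 : 1 <= ln (4 : R).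
  have h : ln (1 + (- 2^-1) : R) <= - 2^-1 by apply: le_ln1Dx; lra.
  have e : (1 + - 2^-1 : R) = 2^-1 by field.
  rewrite e lnV ?posrE // in h.
  have -> : (4 : R) = 2 ^+ 2 by ring.
  by rewrite lnXn // mulr2n; lra.
have ex : exists q : nat, y <= 4 ^+ q.
  exists (Num.truncn y).+1; apply: le_trans (ltW (truncnS_gt y)) _.
  rewrite -natrX ler_nat; apply: ltnW; exact: ltn_expl.
case: (ex_minnP ex) => q hq hmin; exists q => //.
case: q hq hmin => [|q] hq hmin; first by rewrite addr_ge0 // ln_ge0.
have lt4 : 4 ^+ q < y by rewrite ltNge; apply/negP => /hmin; rewrite ltnn.
have : ln (4 ^+ q) <= ln y by rewrite ler_ln ?posrE ?exprn_gt0 // ltW.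
rewrite lnXn // => h.
rewrite -natr1 addrC lerD2l; apply: le_trans h.
by rewrite -[ln 4 *+ q]mulr_natl ler_peMr // ler0n.
Qed.
End Interpolation.

(** * The discrete maximal inequality *)

Section Discrete.
Variables (R : realType) (K H : nat) (m : nat -> nat -> R) (delta : R).
Hypothesis m0 : forall n a, 0 <= m n a.
Hypothesis m1 : forall n, \sum_(a < 2 ^ K.+1) m n a <= 1.
Hypothesis delta0 : 0 < delta.
Hypothesis delta1 : delta <= 1.

Local Notation wf_tube := (wf_tube K H m delta).
Local Notation tot := (@tot R K H).
Local Notation onT := (onT K m delta).
Local Notation tpos := (tpos K m delta).

Let A2 := 340 + 672 * ln delta^-1 ^+ 2.

Lemma level_family (S0 : seq tube) (F : nat -> nat -> R) t :
  (forall Q, Q \in S0 -> wf_tube Q) ->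
  (forall Q, Q \in S0 -> t * (2 ^ tk Q)%N%:R <= dsum (tk Q) (ti Q) (fun n => F n (tpos Q n))) ->
  exists (ph : nat -> nat -> R) (N : R),
  [/\ forall n y, 0 <= ph n y, tot (fun n y => (has (fun Q => onT Q n y) S0)%:R) <= 5 * N,
    t * N <= tot (fun n y => F n y * ph n y), tot ph = N &
    tot (fun n y => ph n y ^+ 2) <= A2 * N /\ tot (fun n y => ph n y ^+ 3) * delta ^+ 2 <= 6 * N].
Proof.
move=> wf0 avg0; have [S [sub uS far cov]] := vitali K m delta S0.
have S_wf Q : Q \in S -> wf_tube Q by move=> /sub /wf0.
(* [H1] makes room for sheared heights and [H2] for their shift by [third (K + 5)]. *)
pose H1 := (H + K + 2)%N; pose H2 := (H1 + 2 * (K + 5) + 1)%N.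
have h1 : (2 ^ H + 2 ^ K.+1 <= 2 ^ H1)%N.
  rewrite /H1 addn2 [leqRHS]expnS mul2n -addnn leq_add // leq_exp2l //; move: (H) (K); clear; lia.
have h2 : (third (K + 5) + 2 ^ H1 <= 2 ^ H2)%N.
  rewrite /H2 addn1 [leqRHS]expnS mul2n -addnn; apply: leq_add; last first.
    by rewrite leq_exp2l // leq_addr.
  apply: (@leq_trans (2 ^ (2 * (K + 5)))); last by rewrite leq_exp2l //; lia.
  by rewrite -thirdE; lia.
have h3 : (K + 5 <= H2)%N by rewrite /H2; lia.
have [bx bxP] := @box_choice R K H m delta delta0.
exists (Phi K H m delta S), (Wmass K H m delta S); split.
- by move=> n y; apply: Phi_ge0.
- exact: (union_le delta0 S_wf cov).
- by apply: (weak_le delta0 S_wf uS) => Q QS; apply/avg0/sub.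
- exact: (tot_Phi delta0 S_wf uS).
split; first exact: (second_moment m0 m1 delta0 S_wf uS far h1 h2 h3 bxP delta1).
exact: (third_moment m0 m1 delta0 S_wf uS far).
Qed.

(** With [kap = 4 * A2] and [h = delta / 7], the second and third moments contribute at most
    [s ^ 2 * N / 8] each, since 6 / 49 <= 1 / 8. The small values contribute one half, so a quarter
    of [s ^ 2 * N] is left. *)
Lemma level_bound (S0 : seq tube) (f : nat -> nat -> R) s h :
  h = delta / 7 -> 0 < s -> (forall n y, 0 <= f n y) ->
  (forall Q, Q \in S0 -> wf_tube Q) ->
  (forall Q, Q \in S0 -> s ^+ 2 * (2 ^ tk Q)%N%:R <=
     dsum (tk Q) (ti Q) (fun n => f n (tpos Q n) ^+ 2)) ->
  s ^+ 4 * tot (fun n y => (has (fun Q => onT Q n y) S0)%:R) <=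
  tot (fun n y => 40 * A2 * f n y ^+ 4 *
      ((s ^+ 2 < 2 * f n y ^+ 2) && (2 * f n y ^+ 2 <= 2 * h ^- 2 * s ^+ 2))%R%:R +
    20 * f n y ^+ 3 / h * (s * (s < f n y * h)%R%:R)).
Proof.
move=> hE s0 f0 wf0 avg0.
have h0 : 0 < h by rewrite hE divr_gt0.
have A20 : 0 < A2 by have := sqr_ge0 (ln delta^-1); rewrite /A2; lra.
have [ph [N [p0 un wk pN [p2 p3]]]] := level_family (F := fun n y => f n y ^+ 2) wf0 avg0.
pose kap := 4 * A2; have k0 : 0 < kap by rewrite mulr_gt0.
have N0 : 0 <= N by rewrite -pN tot_ge0.
pose mid n y := f n y ^+ 4 * ((s ^+ 2 < 2 * f n y ^+ 2) &&
  (2 * f n y ^+ 2 <= 2 * h ^- 2 * s ^+ 2))%R%:R.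
pose top n y := f n y ^+ 3 * (s < f n y * h)%R%:R.
have s20 : 0 < s ^+ 2 by rewrite exprn_gt0.
have key : s ^+ 2 * N <= s ^+ 2 / 2 * N + (kap / (2 * s ^+ 2) * tot mid +
     s ^+ 2 / (2 * kap) * (A2 * N)) + ((h * s)^-1 * tot top + s ^+ 2 * (N / 8)).
  apply: le_trans wk _.
  apply: (@le_trans _ _ (s ^+ 2 / 2 * tot ph + (kap / (2 * s ^+ 2) * tot mid +
     s ^+ 2 / (2 * kap) * tot (fun n y => ph n y ^+ 2)) + ((h * s)^-1 * tot top +
       h ^+ 2 * s ^+ 2 * tot (fun n y => ph n y ^+ 3)))).
    rewrite -!totZ -!totD; apply: le_tot => n y.
    have := level_split (f0 n y) s0 h0 k0 (p0 n y).
    by rewrite /mid /top ![_ / _ * (_ * _)]mulrA [_^-1 * (_ * _)]mulrA [(h * s)^-1 * _]mulrC.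
  rewrite pN; apply: lerD; first rewrite !lerD2l.
    by apply: ler_wpM2l => //; rewrite divr_ge0 ?mulr_ge0 ?ltW.
  rewrite lerD2l mulrAC mulrC ler_wpM2l ?(ltW s20) //.
  have : delta ^+ 2 * tot (fun n y => ph n y ^+ 3) <= 6 * N by rewrite mulrC.
  rewrite hE exprMn exprVn; move: N0; set T := tot _; set D := delta ^+ 2.
  have -> : D * 7 ^- 2 * T = (D * T) / 49 by field.
  lra.
have e1 : s ^+ 2 / (2 * kap) * (A2 * N) = s ^+ 2 * (N / 8).
  by rewrite /kap; field; rewrite gt_eqF.
rewrite e1 in key.
have key2 : s ^+ 2 * N <= 4 * (kap / (2 * s ^+ 2) * tot mid + (h * s)^-1 * tot top).
  by move: key; set a := s ^+ 2 * (N / 8); have -> : s ^+ 2 / 2 * N = 4 * a by [rewrite /a; field];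
    have -> : s ^+ 2 * N = 8 * a by [rewrite /a; field]; lra.
have e2 : tot (fun n y => 40 * A2 * f n y ^+ 4 *
      ((s ^+ 2 < 2 * f n y ^+ 2) && (2 * f n y ^+ 2 <= 2 * h ^- 2 * s ^+ 2))%R%:R +
    20 * f n y ^+ 3 / h * (s * (s < f n y * h)%R%:R)) =
   40 * A2 * tot mid + 20 * s / h * tot top.
  rewrite -!totZ -totD; apply: eq_tot => n y; rewrite /mid /top; congr (_ + _); ring.
rewrite e2; apply: (@le_trans _ _ (5 * s ^+ 2 * (s ^+ 2 * N))).
  have -> : 5 * s ^+ 2 * (s ^+ 2 * N) = s ^+ 4 * (5 * N) by ring.
  by rewrite ler_wpM2l // exprn_ge0 // ltW.
apply: le_trans (ler_wpM2l _ key2) _; first by rewrite mulr_ge0 ?ltW.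
rewrite le_eqVlt; apply/orP; left; apply/eqP; rewrite /kap; field; rewrite !gt_eqF //.
Qed.

(** 1012 = 340 + 672 bounds [A2] and 200 bounds the number [q] of levels, up to powers of
    [1 + ln delta^-1]. *)
Definition disc_const : R := 80 * (8 * 1012 * 200 + 80).

(** The averages are assumed large for all slopes of the tile: the inherited slope depends on the
    other good tiles and cannot be prescribed. *)
Theorem discrete_maximal (pts : seq (nat * nat)) (val : nat * nat -> R)
    (kk jj : nat * nat -> nat) (F : nat -> nat -> R) :
  uniq pts -> (forall n y, 0 <= F n y) ->
  (forall z, z \in pts -> [/\ 0 <= val z, (z.1 < 2 ^ K)%N, (2 ^ K.+1 <= z.2)%N,
     (z.2 + 2 ^ K.+1 <= 2 ^ H)%N & good K m delta (kk z) (z.1 %/ 2 ^ kk z) (jj z)]) ->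
  (forall z a, z \in pts -> (a %/ 2 ^ (K - kk z) = jj z)%N -> (a < 2 ^ K.+1)%N ->
     val z * (2 ^ kk z)%N%:R <= dsum (kk z) (z.1 %/ 2 ^ kk z) (fun n =>
       F n (z.2 - rise K a z.1 + rise K a n)%N)) ->
  \sum_(z <- pts) val z ^+ 2 <=
    disc_const * (1 + ln delta^-1) ^+ 3 * tot (fun n y => F n y ^+ 2).
Proof.
move=> upts F0 hz hval.
set L := ln delta^-1.
have L0 : 0 <= L by rewrite ln_ge0 // invf_ge1.
pose tz z : tube := (kk z, (z.1 %/ 2 ^ kk z)%N, jj z,
  (z.2 - rise K (slope K m delta (kk z) (z.1 %/ 2 ^ kk z) (jj z)) z.1)%N).
have slz z : z \in pts -> (slope K m delta (kk z) (z.1 %/ 2 ^ kk z) (jj z) < 2 ^ K.+1)%N.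
  by move=> /hz[_ _ _ _ g]; apply: slope_lt delta0 _ _ _ g.
have risez z : z \in pts ->
    (rise K (slope K m delta (kk z) (z.1 %/ 2 ^ kk z) (jj z)) z.1 < 2 ^ K.+1)%N.
  move=> zp; have [_ h1 _ _ _] := hz _ zp.
  by rewrite /rise ltn_divLR ?expn_gt0 //; apply: ltn_mul => //; apply: slz.
have wfz z : z \in pts -> wf_tube (tz z).
  move=> zp; have [_ h1 _ h2 g] := hz _ zp; rewrite /wf_tube /tz /tk /ti /tj /tt /= g /=.
  apply/andP; split.
    have kK : (kk z <= K)%N by case/andP: g.
    by rewrite ltn_divLR ?expn_gt0 // -expnD subnK.
  by apply: leq_trans h2; rewrite leq_add2r leq_subr.
have onz z : z \in pts -> onT (tz z) z.1 z.2.
  move=> zp; rewrite /onT /tpos /tslope /tz /tk /ti /tj /tt /= eqxx /= subnK //.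
  have [_ _ h _ _] := hz _ zp; apply: leq_trans h; apply/ltnW/risez => //.
pose f n y := Num.sqrt (F n y).
have f0 n y : 0 <= f n y by apply: sqrtr_ge0.
have f2 n y : f n y ^+ 2 = F n y by rewrite sqr_sqrtr.
have f4 n y : f n y ^+ 4 = F n y ^+ 2 by rewrite -f2 -exprM.
have avgz z : z \in pts -> val z * (2 ^ tk (tz z))%N%:R <=
    dsum (tk (tz z)) (ti (tz z)) (fun n => f n (tpos (tz z) n) ^+ 2).
  move=> zp; have [_ _ _ _ g] := hz _ zp; have kK : (kk z <= K)%N by case/andP: g.
  have hv := hval z _ zp (slope_mem m delta0 (z.1 %/ 2 ^ kk z) (jj z) kK) (slz _ zp).
  rewrite /tk /ti /=; apply: le_trans hv _.
  by apply: le_dsum => n _; rewrite f2.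
pose h := delta / 7; have h0 : 0 < h by rewrite divr_gt0.
have A20 : 0 < A2 by have := sqr_ge0 (ln delta^-1); rewrite /A2; lra.
have B1 : 1 <= 2 * h ^- 2.
  have h1 : h ^+ 2 <= 1 by rewrite expr_le1 ?ltW // /h; move: delta1; lra.
  have : 1 <= h ^- 2 by rewrite invf_ge1 // exprn_gt0.
  lra.
have [q hq qL] := exists_pow4 B1.
have qL2 : q%:R <= 200 * (1 + L).
  apply: le_trans qL _; rewrite lnM ?posrE ?invr_gt0 ?exprn_gt0 //.
  have l2 : ln (2 : R) <= 1.
    have -> : (2 : R) = 1 + 1 by ring.
    by apply: le_ln1Dx; lra.
  have l7 : ln (7 : R) <= 6.
    have -> : (7 : R) = 1 + 6 by ring.
    by apply: le_ln1Dx; lra.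
  have -> : ln (h ^- 2) = 2 * (ln 7 + L).
    rewrite /h -exprVn lnXn ?invr_gt0 // invf_div lnM ?posrE ?invr_gt0 // mulr2n /L; ring.
  lra.
(* Finitely many levels above [s0] are summed; the remainder vanishes as [s0] tends to 0. *)
have main (s0 : R) : 0 < s0 -> \sum_(z <- pts) val z ^+ 2 <= (size pts)%:R * s0 ^+ 4 +
   disc_const * (1 + L) ^+ 3 * tot (fun n y => F n y ^+ 2).
  move=> s00.
  have [mm hmm] : exists mm, forall z, z \in pts -> val z <= (2 ^+ mm * s0) ^+ 2.
    have key : forall s : seq (nat * nat), exists mm, forall z, z \in s -> val z <= (2 ^+ mm * s0) ^+ 2.
      elim=> [|z s [mm IH]]; first by exists 0%N.
      pose p := (Num.truncn (val z / s0 ^+ 2)).+1; exists (maxn mm p) => z'; rewrite inE => /orP[/eqP ->|/IH].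
        rewrite exprMn -ler_pdivrMr ?exprn_gt0 //; apply: le_trans (ltW (truncnS_gt _)) _.
        rewrite -/p -exprM -natrX ler_nat; apply: ltnW.
        apply: leq_trans (ltn_expl p (ltnSn 1)) _; rewrite leq_exp2l //.
        by apply: leq_trans (leq_maxr mm p) _; rewrite leq_pmulr.
      move=> /le_trans; apply; rewrite lerXn2r ?nnegrE ?mulr_ge0 ?exprn_ge0 ?(ltW s00) //.
      by rewrite ler_wpM2r ?(ltW s00) // ler_weXn2l ?ler1n // leq_maxl.
    exact: key.
  pose s k : R := 2 ^+ k * s0.
  have sp k : 0 < s k by rewrite mulr_gt0 ?exprn_gt0.
  apply: (@le_trans _ _ (\sum_(z <- pts) (s0 ^+ 4 + \sum_(k < mm) 16 * s k ^+ 4 *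
      (s k ^+ 2 < val z)%R%:R))).
    rewrite big_seq [leRHS]big_seq; apply: ler_sum => z zp; have [v0 _ _ _ _] := hz _ zp.
    by apply: layer_cake => //; apply: hmm.
  rewrite big_split big_const_seq count_predT iter_addr_0 -[_ *+ size pts]mulr_natl lerD2l exchange_big /=.
  apply: (@le_trans _ _ (\sum_(k < mm) 16 * tot (fun n y => 40 * A2 * f n y ^+ 4 *
      ((s k ^+ 2 < 2 * f n y ^+ 2) && (2 * f n y ^+ 2 <= 2 * h ^- 2 * s k ^+ 2))%R%:R +
      20 * f n y ^+ 3 / h * (s k * (s k < f n y * h)%R%:R)))).
    apply: ler_sum => k _.
    rewrite -mulr_sumr -mulrA ler_wpM2l //.
    pose Zk := [seq z <- pts | (s k ^+ 2 < val z)%R]; pose S0 := [seq tz z | z <- Zk].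
    apply: le_trans (level_bound (S0 := S0) (erefl h) (sp k) f0 _ _); first last.
    - move=> Q /mapP[z]; rewrite mem_filter => /andP[hv zp] ->.
      by apply: le_trans (avgz _ zp); rewrite ler_wpM2r // ltW.
    - by move=> Q /mapP[z]; rewrite mem_filter => /andP[hv zp] ->; apply: wfz.
    rewrite ler_wpM2l ?exprn_ge0 ?(ltW (sp k)) //.
    apply: (@le_trans _ _ (\sum_(z <- Zk) (has (fun Q => onT Q z.1 z.2) S0)%:R)).
      rewrite /Zk big_filter [leRHS]big_mkcond /= big_seq [leRHS]big_seq; apply: ler_sum => z zp.
      case: ifP => // hv; rewrite (_ : has _ _) //; apply/hasP; exists (tz z); last exact: onz.
      by apply/mapP; exists z; rewrite // mem_filter hv.
    apply: (sum_points_le (G := fun n y => (has (fun Q => onT Q n y) S0)%:R)) => //.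
      by rewrite filter_uniq.
    move=> z; rewrite mem_filter => /andP[_ zp]; have [_ h1 _ h2 _] := hz _ zp; split=> //.
    by apply: leq_trans h2; rewrite -addn1 leq_add2l expn_gt0.
  under eq_bigr do rewrite -totZ.
  rewrite -tot_sum -totZ; apply: le_tot => n y.
  rewrite -mulr_sumr big_split /= -!mulr_sumr.
  have w1 := @window_count R s0 (2 * f n y ^+ 2) (2 * h ^- 2) q mm s00 hq.
  have w2 := @geometric_top R s0 (f n y * h) mm s00 (mulr_ge0 (f0 n y) (ltW h0)).
  have c1 : 0 <= 40 * A2 * f n y ^+ 4 by rewrite !mulr_ge0 ?exprn_ge0 // ltW.
  have c2 : 0 <= 20 * f n y ^+ 3 / h by rewrite divr_ge0 ?mulr_ge0 ?exprn_ge0 // ltW.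
  apply: (@le_trans _ _ (16 * (40 * A2 * f n y ^+ 4 * q%:R + 20 * f n y ^+ 3 / h * (2 * (f n y * h))))).
    by rewrite ler_wpM2l // lerD // ler_wpM2l.
  have -> : 20 * f n y ^+ 3 / h * (2 * (f n y * h)) = 40 * f n y ^+ 4.
    by field; rewrite gt_eqF.
  rewrite f4; have F2 : 0 <= F n y ^+ 2 by rewrite sqr_ge0.
  have A2L : A2 <= 1012 * (1 + L) ^+ 2.
    rewrite /A2 -/L; have := sqr_ge0 L; rewrite sqrrD; lra.
  have -> : 16 * (40 * A2 * F n y ^+ 2 * q%:R + 40 * F n y ^+ 2) =
     80 * (8 * A2 * q%:R + 8) * F n y ^+ 2 by ring.
  rewrite ler_wpM2r // /disc_const.
  have L1 : 1 <= 1 + L by lra.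
  have L3 : 1 <= (1 + L) ^+ 3 by rewrite exprn_ege1.
  have : A2 * q%:R <= 1012 * (1 + L) ^+ 2 * (200 * (1 + L)).
    by rewrite ler_pM // ltW.
  have -> : 1012 * (1 + L) ^+ 2 * (200 * (1 + L)) = 1012 * 200 * (1 + L) ^+ 3 by ring.
  move: L3; set T := (1 + L) ^+ 3; set U := A2 * q%:R.
  have -> : 8 * A2 * q%:R = 8 * U by rewrite /U; ring.
  lra.
apply/ler_addgt0Pr => e e0.
pose c := e / ((size pts)%:R + 1).
have p0 : 0 < (size pts)%:R + 1 :> R by rewrite ltr_wpDl.
have c0 : 0 < c by rewrite divr_gt0.
pose s0 := Num.sqrt (Num.sqrt c).
have s00 : 0 < s0 by rewrite !sqrtr_gt0.
have s04 : s0 ^+ 4 = c.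
  by rewrite (exprM s0 2 2) /s0 sqr_sqrtr ?sqrtr_ge0 // sqr_sqrtr // ltW.
apply: le_trans (main _ s00) _; rewrite addrC lerD2l s04 /c mulrA ler_pdivrMr // mulrC.
by rewrite ler_wpM2l ?(ltW e0) // lerDl.
Qed.

End Discrete.

Local Open Scope classical_set_scope.
Local Open Scope ring_scope.

(** * From rectangles to tiles *)

Section Geometry.
Variables (R : realType) (Q : rect R).
Hypothesis wfQ : rect_wf Q.
Local Notation N := (Num.sqrt (1 + rslope Q ^+ 2)).

Lemma rwid_gt0 : 0 < rwid Q. Proof. by case: wfQ. Qed.
Lemma rlen_gt0 : 0 < rlen Q. Proof. by case: wfQ => h /(lt_le_trans h). Qed.

Lemma diag_sqr : N ^+ 2 = 1 + rslope Q ^+ 2.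
Proof. by rewrite sqr_sqrtr // addr_ge0 // sqr_ge0. Qed.

Lemma diag_ge1 : 1 <= N.
Proof. by rewrite -[X in X <= _](sqrtr1 R) ler_wsqrtr // lerDl sqr_ge0. Qed.

Lemma diag_gt0 : 0 < N. Proof. exact: lt_le_trans ltr01 diag_ge1. Qed.

Lemma slope_le_diag : `|rslope Q| <= N.
Proof. by rewrite -sqrtr_sqr ler_wsqrtr // lerDr. Qed.

Lemma rect_set_bounds p : rect_set Q p ->
  `|p.1 - (rc Q).1| < rlen Q /\
  `|(p.2 - (rc Q).2) - rslope Q * (p.1 - (rc Q).1)| < N * rwid Q / 2.
Proof.
rewrite /rect_set /=; set s := rslope Q; set d1 := _ - _; set d2 := _ - (rc Q).2.
rewrite !ltr_pdivrMr ?diag_gt0 // => -[hA hB]; split; last first.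
  by move: hB; rewrite addrC mulNr mulrAC [rwid Q * _]mulrC.
have e : N ^+ 2 * d1 = (d1 + s * d2) - s * (- s * d1 + d2).
  by rewrite diag_sqr -/s; ring.
rewrite -(ltr_pM2l (exprn_gt0 2 diag_gt0)).
have -> : N ^+ 2 * `|d1| = `|N ^+ 2 * d1| by rewrite normrM (ger0_norm (exprn_ge0 _ (ltW diag_gt0))).
rewrite e; apply: le_lt_trans (ler_normB _ _) _; rewrite normrM.
have [w0 wL] := wfQ; have := slope_le_diag; have N1 := diag_ge1; rewrite -/s => sN.
have s0 := normr_ge0 s.
apply: (@lt_le_trans _ _ (rlen Q / 2 * N + N * (rlen Q / 2 * N))).
  apply: ltr_leD => //; apply: ler_pM => //; apply: le_trans (ltW hB) _.
  by rewrite ler_pM2r ?diag_gt0 // ler_pM2r.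
have -> : N ^+ 2 * rlen Q = N * (N * rlen Q / 2) + N * (rlen Q / 2 * N) by field.
rewrite lerD2r [rlen Q / 2 * N]mulrC -mulrA ler_peMl // mulr_ge0 ?(ltW diag_gt0) //.
by rewrite divr_ge0 // ltW // rlen_gt0.
Qed.

Lemma rect_set_sub p : `|p.1 - (rc Q).1| <= rlen Q / (8 * N) ->
  `|(p.2 - (rc Q).2) - rslope Q * (p.1 - (rc Q).1)| < rwid Q / 4 -> rect_set Q p.
Proof.
rewrite /rect_set /=; set s := rslope Q; set d1 := _ - _; set d2 := _ - (rc Q).2 => hA hB.
have [w0 wL] := wfQ; have N0 := diag_gt0; have N1 := diag_ge1.
rewrite !ltr_pdivrMr //; split; last first.
  rewrite addrC mulNr; apply: lt_le_trans hB _; apply: (@le_trans _ _ (rwid Q / 2 * 1)); first lra.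
  by rewrite ler_wpM2l //; lra.
have -> : d1 + s * d2 = N ^+ 2 * d1 + s * (d2 - s * d1) by rewrite diag_sqr -/s; ring.
apply: le_lt_trans (ler_normD _ _) _; rewrite [X in X + _]normrM [X in _ + X]normrM (ger0_norm (exprn_ge0 2 (ltW N0))).
have h1 : N ^+ 2 * `|d1| <= N * (rlen Q / 8).
  have -> : N * (rlen Q / 8) = N ^+ 2 * (rlen Q / (8 * N)) by field; rewrite gt_eqF.
  by rewrite ler_wpM2l // exprn_ge0 // ltW.
have h2 : `|s| * `|d2 - s * d1| <= N * (rlen Q / 4).
  apply: ler_pM => //; first exact: slope_le_diag.
  by apply: le_trans (ltW hB) _; rewrite ler_wpM2r.
apply: le_lt_trans (lerD h1 h2) _.
have : 0 < N * rlen Q by rewrite mulr_gt0 // rlen_gt0.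
lra.
Qed.

Lemma measurable_rect_set : measurable (rect_set Q).
Proof.
have mf1 : measurable_fun setT (fun p : R * R => `|(p.1 - (rc Q).1) + rslope Q * (p.2 - (rc Q).2)| / N).
  apply: measurable_funM => //; apply: measurableT_comp => //.
  apply: measurable_funD; first exact: measurable_funB.
  by apply: measurable_funM => //; apply: measurable_funB.
have mf2 : measurable_fun setT (fun p : R * R => `|- rslope Q * (p.1 - (rc Q).1) + (p.2 - (rc Q).2)| / N).
  apply: measurable_funM => //; apply: measurableT_comp => //.
  apply: measurable_funD; last exact: measurable_funB.
  by apply: measurable_funM => //; apply: measurable_funB.
rewrite (_ : rect_set Q = [set p | `|(p.1 - (rc Q).1) + rslope Q * (p.2 - (rc Q).2)| / N < rlen Q / 2] `&`
   [set p | `|- rslope Q * (p.1 - (rc Q).1) + (p.2 - (rc Q).2)| / N < rwid Q / 2]); last by [].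
apply: measurableI.
  have := mf1 measurableT _ (measurable_itv `]-oo, (rlen Q / 2)[); rewrite setTI.
  by congr measurable; apply/seteqP; split => p /=; rewrite in_itv.
have := mf2 measurableT _ (measurable_itv `]-oo, (rwid Q / 2)[); rewrite setTI.
by congr measurable; apply/seteqP; split => p /=; rewrite in_itv.
Qed.

Lemma measurable_VR (v : R -> R) : measurable_fun setT v ->
  measurable (VR (fun p => v p.1) Q).
Proof.
move=> mv; apply: measurableI; first exact: measurable_rect_set.
have := measurableT_comp mv (@measurable_fst _ _ R R).
move=> /(_ measurableT (theta Q)); rewrite setTI; apply.
exact: measurable_itv.
Qed.
End Geometry.

Lemma lebesgue_measure_segment (R : realType) (a b : R) (x y : bool) : a < b ->
  lebesgue_measure [set` Interval (BSide x a) (BSide y b)] = (b - a)%:E.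
Proof. by move=> ab; rewrite lebesgue_measure_itv /= lte_fin ab. Qed.

Section RectMeasure.
Variables (R : realType) (Q : rect R).
Hypothesis wfQ : rect_wf Q.
Local Notation N := (Num.sqrt (1 + rslope Q ^+ 2)).
Local Notation mu := (@lebesgue_measure R).

Lemma leb2E (A : set (R * R)) : leb2 A = (\int[mu]_x mu (xsection A x))%E.
Proof. by []. Qed.

Lemma measurable_mu_xsection (A : set (R * R)) : measurable A ->
  measurable_fun setT (fun x => mu (xsection A x)).
Proof. by move=> mA; apply: measurable_fun_xsection. Qed.

(** A parallelogram of horizontal extent [rlen Q / (4 * N)] with vertical sections of length
    [rwid Q / 4] fits inside. *)
Lemma leb2_rect_ge : ((rlen Q * rwid Q / (16 * N))%:E <= leb2 (rect_set Q))%E.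
Proof.
have N0 : 0 < N by exact: diag_gt0.
have w0 : 0 < rwid Q by exact: rwid_gt0.
have L0 : 0 < rlen Q by exact: rlen_gt0.
pose r := rlen Q / (8 * N); have r0 : 0 < r by rewrite divr_gt0 // mulr_gt0.
pose I := `[(rc Q).1 - r, (rc Q).1 + r]%classic.
have mI : measurable I by exact: measurable_itv.
rewrite leb2E.
apply: (@le_trans _ _ (\int[mu]_(x in I) (rwid Q / 4)%:E)%E).
  rewrite integral_cst // [X in (_ * X)%E](_ : _ = mu I) // /I lebesgue_measure_segment; last lra.
  rewrite -EFinM lee_fin.
  have -> : rwid Q / 4 * ((rc Q).1 + r - ((rc Q).1 - r)) = rlen Q * rwid Q / (16 * N).
    by rewrite /r; field; rewrite gt_eqF.
  by [].
apply: (@le_trans _ _ (\int[mu]_(x in I) mu (xsection (rect_set Q) x))%E); last first.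
  apply: ge0_subset_integral => //.
  by apply: measurable_mu_xsection; exact: measurable_rect_set.
apply: ge0_le_integral => //.
- by move=> x _; rewrite lee_fin divr_ge0 // ltW.
- apply: measurable_funTS; by apply: measurable_mu_xsection; exact: measurable_rect_set.
move=> x; rewrite /I /= in_itv /= => /andP[h1 h2].
pose c := (rc Q).2 + rslope Q * (x - (rc Q).1).
pose J := `]c - rwid Q / 8, c + rwid Q / 8[%classic.
apply: (@le_trans _ _ (mu J)).
  by rewrite /J lebesgue_measure_segment ?lee_fin; lra.
apply: le_measure; rewrite ?inE //; first exact: measurable_itv.
  by apply: measurable_xsection; exact: measurable_rect_set.
move=> y; rewrite /J /= in_itv /= => /andP[y1 y2]; rewrite xsectionE /=.
apply: rect_set_sub => //=; first by rewrite ler_norml -/r; lra.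
by rewrite ltr_norml; move: y1 y2; rewrite /c; lra.
Qed.

Variable v : R -> R.
Hypothesis mv : measurable_fun setT v.

Definition shadow : set R := [set x | `|x - (rc Q).1| < rlen Q] `&` [set x | theta Q (v x)].

Lemma measurable_shadow : measurable shadow.
Proof.
apply: measurableI.
  rewrite (_ : [set _ | _] = `](rc Q).1 - rlen Q, (rc Q).1 + rlen Q[%classic).
    exact: measurable_itv.
  by apply/seteqP; split => x /=; rewrite in_itv /= ltr_norml; lra.
have := mv measurableT; move=> /(_ (theta Q)); rewrite setTI; apply.
exact: measurable_itv.
Qed.

(** As [v] depends on the first coordinate only, [VR] lives over [shadow], and vertical sections of
    the rectangle have length at most [N * rwid Q]. *)
Lemma leb2_VR_le : (leb2 (VR (fun p => v p.1) Q) <= (N * rwid Q)%:E * mu shadow)%E.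
Proof.
have N0 : 0 < N by exact: diag_gt0.
have w0 : 0 < rwid Q by exact: rwid_gt0.
rewrite leb2E -(setIT shadow) -integral_indic //; last exact: measurable_shadow.
rewrite -ge0_integralZl //; last first.
- by rewrite lee_fin mulr_ge0 // ltW.
- apply/measurable_EFinP; apply: measurable_indic; exact: measurable_shadow.
apply: ge0_le_integral => //.
- by apply: measurable_mu_xsection; exact: measurable_VR.
- apply/measurable_EFinP; apply: measurable_funM => //.
  apply: measurable_indic; exact: measurable_shadow.
move=> x _; rewrite /= indicE; case: (boolP (x \in shadow)) => hx; last first.
  rewrite mule0 (_ : xsection _ _ = set0) ?measure0 //.
  apply/seteqP; split => // y; rewrite xsectionE /= => -[/(rect_set_bounds wfQ)[h _]] th.
  by move: hx; rewrite notin_setE; apply; split.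
rewrite mule1.
pose c := (rc Q).2 + rslope Q * (x - (rc Q).1).
pose J := `]c - N * rwid Q / 2, c + N * rwid Q / 2[%classic.
have Nw : 0 < N * rwid Q by rewrite mulr_gt0.
apply: (@le_trans _ _ (mu J)).
  apply: le_measure; rewrite ?inE //.
  - by apply: measurable_xsection; exact: measurable_VR.
  - exact: measurable_itv.
  move=> y; rewrite xsectionE /J /= in_itv /= => -[/(rect_set_bounds wfQ)[_ /=]].
  by rewrite ltr_norml /c; lra.
by rewrite /J lebesgue_measure_segment ?lee_fin; lra.
Qed.

(** Since [VR] is not empty, [theta Q] meets [0, 1]; its length is at most 1, so the slope is at
    most 3/2 in absolute value and [N <= 2]. *)
Lemma Rdelta_bounds w delta : 0 < delta -> (forall a, 0 <= v a <= 1) ->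
  Rdelta w delta (fun p => v p.1) Q ->
  [/\ N <= 2, 0 <= rslope Q + w / rlen Q / 2, ((rlen Q * w / 32)%:E <= leb2 (rect_set Q))%E &
   ((delta * rlen Q / 64)%:E <= mu shadow)%E].
Proof.
move=> d0 v01 [_ [wE hQ]].
have N0 : 0 < N by exact: diag_gt0.
have w0 : 0 < rwid Q by exact: rwid_gt0.
have L0 : 0 < rlen Q by exact: rlen_gt0.
have hA := leb2_rect_ge.
have V0 : (0 < leb2 (VR (fun p => v p.1) Q))%E.
  apply: lt_le_trans hQ; rewrite mule_gt0 ?lte_fin //.
  by apply: lt_le_trans hA; rewrite lte_fin divr_gt0 ?mulr_gt0.
have [x] : VR (fun p => v p.1) Q !=set0.
  by apply/set0P/eqP => h; move: V0; rewrite h /leb2 measure0 ltxx.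
case=> _; rewrite /theta /= in_itv /= => /andP[h1 h2].
have hr : rwid Q / rlen Q <= 1 by rewrite ler_pdivrMr // mul1r; case: wfQ.
have /andP[v0 v1] := v01 x.1.
have s1 : rslope Q <= 3/2 by lra.
have s2 : - (3/2) <= rslope Q by lra.
have N2 : N <= 2.
  have -> : (2 : R) = Num.sqrt (2 ^+ 2) by rewrite sqrtr_sqr ger0_norm.
  rewrite ler_wsqrtr //.
  have : 0 <= (3/2 - rslope Q) * (rslope Q + 3/2) by rewrite mulr_ge0 //; lra.
  by rewrite !expr2; lra.
have hA2 : ((rlen Q * w / 32)%:E <= leb2 (rect_set Q))%E.
  apply: le_trans hA; rewrite lee_fin wE ler_wpM2l //; first by rewrite -wE mulr_ge0 // ltW.
  by rewrite lef_pV2 ?posrE ?mulr_gt0 //; lra.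
split => //; first by rewrite -wE; lra.
rewrite -(@lee_pmul2l _ (2 * w)%:E) ?fin_numE //; last by rewrite lte_fin -wE mulr_gt0.
apply: (@le_trans _ _ (delta%:E * leb2 (rect_set Q))%E).
  apply: (@le_trans _ _ (delta%:E * (rlen Q * w / 32)%:E)%E).
    by rewrite -!EFinM lee_fin; lra.
  by rewrite lee_wpmul2l // lee_fin ltW.
apply: le_trans hQ _; apply: le_trans leb2_VR_le _.
by rewrite lee_wpmul2r // lee_fin wE ler_wpM2r // -wE ltW.
Qed.
End RectMeasure.

Lemma ge0_integral_seq_cover d (T : measurableType d) (R : realType)
    (mu : {measure set T -> \bar R}) (I : eqType) (s : seq I) (F : I -> set T)
    (A : set T) (f : T -> \bar R) :
  measurable A -> (forall i, measurable (F i)) -> measurable_fun setT f ->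
  (forall x, 0 <= f x)%E -> (forall x, A x -> exists2 i, i \in s & F i x) ->
  (\int[mu]_(x in A) f x <= \sum_(i <- s) \int[mu]_(x in F i) f x)%E.
Proof.
move=> mA mF mf f0; elim: s A mA => [|h s IH] A mA cov.
  rewrite big_nil (_ : A = set0) ?integral_set0 //.
  by apply/seteqP; split => // x /cov[].
rewrite big_cons -(setUIDK A (F h)) ge0_integral_setU //; first last.
- by apply/disj_setPS => x [[_ h1] [_ h2]].
- exact: measurable_funTS.
- exact: measurableD.
- exact: measurableI.
apply: leeD.
  by apply: ge0_subset_integral => //; [exact: measurableI|exact: measurable_funTS].
apply: IH; first exact: measurableD.
move=> x [/cov[i]]; rewrite inE => /orP[/eqP -> //|]; exists i => //.
Qed.

Lemma ge0_sum_integral_le d (T : measurableType d) (R : realType)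
    (mu : {measure set T -> \bar R}) (I : eqType) (s : seq I) (F : I -> set T)
    (f : T -> \bar R) :
  (forall i, measurable (F i)) -> uniq s -> trivIset [set` s] F ->
  measurable_fun setT f -> (forall x, 0 <= f x)%E ->
  (\sum_(i <- s) \int[mu]_(x in F i) f x <= \int[mu]_x f x)%E.
Proof.
move=> mF us tF mf f0.
rewrite -ge0_integral_bigsetU //; last exact: measurable_funTS.
apply: ge0_subset_integral => //.
by apply: bigsetU_measurable => i _.
Qed.

Lemma measure_seq_cover d (T : measurableType d) (R : realType)
    (mu : {measure set T -> \bar R}) (I : eqType) (s : seq I) (F : I -> set T) (A : set T) :
  measurable A -> (forall i, measurable (F i)) ->
  (forall x, A x -> exists2 i, i \in s & F i x) ->
  (mu A <= \sum_(i <- s) mu (F i))%E.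
Proof.
move=> mA mF cov.
have := @ge0_integral_seq_cover d T R mu I s F A (cst 1%E) mA mF.
rewrite integral_cst // mul1e => /(_ (measurable_cst _) (fun=> lee01) cov) /le_trans; apply.
by rewrite le_eqVlt (eq_bigr (fun i => mu (F i))) ?eqxx // => i _; rewrite integral_cst // mul1e.
Qed.

(** * Cells of the grid and distribution of the slope field *)

Section Cells.
Variables (R : realType) (w : R).
Hypothesis w0 : 0 < w.
Local Notation mu := (@lebesgue_measure R).

(* The offset [o] plays the role of minus infinity, so that cells are indexed by natural numbers. *)
Definition strip (o n : nat) : set R :=
  `[(n%:R - o%:R) * w, (n%:R - o%:R + 1) * w[%classic.

Definition cell (ox oy : nat) (z : nat * nat) : set (R * R) :=
  strip ox z.1 `*` strip oy z.2.

Lemma stripP o n x : strip o n x <-> n%:R <= x / w + o%:R < n%:R + 1.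
Proof.
rewrite /strip /= in_itv /= -ler_pdivlMr // -ltr_pdivrMr //.
by split; lra.
Qed.

Lemma strip_truncn o n x : strip o n x -> n = Num.truncn (x / w + o%:R).
Proof. by move/stripP => h; rewrite (@truncn_def _ _ n) // -natr1. Qed.

Lemma strip_ex o x : 0 <= x / w + o%:R -> strip o (Num.truncn (x / w + o%:R)) x.
Proof.
by move=> /truncn_itv h; apply/stripP; rewrite natr1.
Qed.

Lemma measurable_strip o n : measurable (strip o n).
Proof. exact: measurable_itv. Qed.

Lemma mu_strip o n : mu (strip o n) = w%:E.
Proof.
rewrite /strip lebesgue_measure_segment; first by congr EFin; ring.
by rewrite ltr_pM2r // ltrDl.
Qed.

Lemma measurable_cell ox oy z : measurable (cell ox oy z).
Proof. by apply: measurableX; exact: measurable_strip. Qed.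

Lemma leb2_cell ox oy z : leb2 (cell ox oy z) = (w ^+ 2)%:E.
Proof.
rewrite /leb2 /cell product_measure1E; try exact: measurable_strip.
by transitivity (mu (strip ox z.1) * mu (strip oy z.2))%E; rewrite // !mu_strip expr2.
Qed.

Lemma trivIset_cell ox oy (D : set (nat * nat)) : trivIset D (cell ox oy).
Proof.
move=> [a b] [c d] _ _ [[x y] [[/= /strip_truncn -> /strip_truncn ->] [/= /strip_truncn -> /strip_truncn ->]]].
by [].
Qed.
End Cells.

Lemma truncn_div (R : realType) (x : R) d : 0 <= x ->
  (Num.truncn (x * (2 ^ d)%N%:R) %/ 2 ^ d)%N = Num.truncn x.
Proof.
move=> x0; have p0 := @natr_exp2_gt0 R d.
have /truncn_itv : 0 <= x * (2 ^ d)%N%:R by rewrite mulr_ge0 // ltW.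
set t := Num.truncn _ => /andP[h1 h2]; apply/esym/truncn_def.
rewrite -(ler_pM2r p0) -(ltr_pM2r p0) -!natrM; apply/andP; split.
  by apply: le_trans h1; rewrite ler_nat leq_divM.
apply: lt_le_trans h2 _; rewrite ler_nat.
by rewrite -ltn_divLR // expn_gt0.
Qed.

Section Mass.
Variables (R : realType) (w : R) (v : R -> R).
Hypothesis w0 : 0 < w.
Hypothesis v01 : forall a, 0 <= v a <= 1.
Hypothesis mv : measurable_fun setT v.
Local Notation mu := (@lebesgue_measure R).

Definition level k a : set R := [set x | Num.truncn (v x * (2 ^ k)%N%:R) = a].

Lemma measurable_level k a : measurable (level k a).
Proof.
have mvk : measurable_fun setT (fun x => v x * (2 ^ k)%N%:R) by exact: measurable_funM.
have := mvk measurableT `[a%:R, a%:R + 1[%classic (measurable_itv _); rewrite setTI.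
congr measurable; apply/seteqP; split => x /=; rewrite in_itv /= natr1.
  exact: truncn_def.
move=> <-; apply: truncn_itv; rewrite mulr_ge0 //.
by case/andP: (v01 x).
Qed.

Definition fmass o K n a : R := fine (mu (strip w o n `&` level K a)) / w.

Lemma mu_strip_level o K n a :
  mu (strip w o n `&` level K a) = (w * fmass o K n a)%:E.
Proof.
have mm : measurable (strip w o n `&` level K a).
  by apply: measurableI; [exact: measurable_strip|exact: measurable_level].
rewrite /fmass mulrC divfK ?gt_eqF // fineK // ge0_fin_numE //.
apply: (@le_lt_trans _ _ w%:E); last by rewrite ltry.
rewrite -(mu_strip w0 o n); apply: le_measure; rewrite ?inE //.
exact: measurable_strip.
Qed.

Lemma fmass_ge0 o K n a : 0 <= fmass o K n a.
Proof. by rewrite divr_ge0 ?fine_ge0 // ltW. Qed.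

Lemma fmass_le1 o K n : \sum_(a < 2 ^ K.+1) fmass o K n a <= 1.
Proof.
rewrite -(ler_pM2l w0) mulr1 mulr_sumr -lee_fin -sumEFin.
under eq_bigr => a _ do rewrite -mu_strip_level.
rewrite -(mu_strip w0 o n) -(setIT (strip w o n)) -[leRHS]integral_indic //; last exact: measurable_strip.
rewrite -(big_mkord xpredT (fun a => mu ((strip w o n `&` setT) `&` level K a))).
apply: le_trans (ge0_sum_integral_le mu (s := index_iota 0 (2 ^ K.+1)) (F := level K) _ _ _ _ _).
- rewrite setIT; apply: lee_sum => a _; rewrite integral_indic //; first exact: measurable_level.
  exact: measurable_strip.
- by move=> a; exact: measurable_level.
- exact: iota_uniq.
- by move=> a b _ _ [x [<- <-]].
- by apply/measurable_EFinP; apply: measurable_indic; exact: measurable_strip.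
- by move=> x; rewrite lee_fin.
Qed.

Lemma mu_strip_tmass o K k n j : (k <= K)%N ->
  (mu (strip w o n `&` level k j) <= (w * tmass K (fmass o K) k n j)%:E)%E.
Proof.
move=> kK.
pose s := [seq a <- index_iota 0 (2 ^ K.+1) | (a %/ 2 ^ (K - k))%N == j].
apply: le_trans (measure_seq_cover mu (s := s) (F := fun a => strip w o n `&` level K a) _ _ _) _.
- by apply: measurableI; [exact: measurable_strip|exact: measurable_level].
- by move=> a; apply: measurableI; [exact: measurable_strip|exact: measurable_level].
- move=> x [hs hj]; have /andP[vx0 vx1] := v01 x.
  exists (Num.truncn (v x * (2 ^ K)%N%:R)) => //.
  have p0 := @natr_exp2_gt0 R K.
  rewrite mem_filter mem_index_iota /=; apply/andP; split.
    rewrite -hj -{1}(subnKC kK) expnD natrM mulrA truncn_div //.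
    by rewrite mulr_ge0.
  rewrite truncn_lt_nat ?mulr_ge0 // expnS natrM.
  by rewrite ltr_pM2r // (le_lt_trans vx1) // ltr1n.
rewrite /s big_filter big_mkord /tmass mulr_sumr -sumEFin.
by apply: lee_sum => a _; rewrite -mu_strip_level.
Qed.

(** Pigeonhole: [theta Q] has length at most [24 / 2 ^ k], so 25 slope intervals cover its values in
    [0, 1]. If none were good, [shadow] would have measure at most [600 * delta / 40000] times
    [rlen Q], against at least [delta * rlen Q / 64]; and 64 * 600 = 38400 is below 40000. *)
Lemma rect_good_tile Q delta o K k i : 0 < delta -> rect_wf Q ->
  Rdelta w delta (fun p => v p.1) Q -> (k <= K)%N ->
  (2 ^ k)%N%:R <= 24 * (rlen Q / w) ->
  (forall x, `|x - (rc Q).1| < rlen Q -> 0 <= x / w + o%:R /\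
     (Num.truncn (x / w + o%:R) %/ 2 ^ k)%N = i) ->
  exists j, good K (fmass o K) (delta / 200 / 200) k i j /\
    forall a, (a %/ 2 ^ (K - k))%N = j ->
      `|a%:R / (2 ^ K)%N%:R - rslope Q| * (2 ^ k)%N%:R <= 40.
Proof.
move=> d0 wfQ hQ kK h24 hx.
have [_ hs _ hE] := Rdelta_bounds wfQ mv d0 v01 hQ.
have L0 := rlen_gt0 wfQ; have p0 := @natr_exp2_gt0 R k.
have hwk : w / rlen Q / 2 * (2 ^ k)%N%:R <= 12.
  rewrite mulrC mulrA ler_pdivrMr // mulrA ler_pdivrMr //.
  by move: h24; rewrite mulrA ler_pdivlMr //; lra.
pose j0 := Num.truncn (rslope Q * (2 ^ k)%N%:R - 12).
have [j /andP[j1 j2] gj] : exists2 j, (j0 <= j < j0 + 25)%N &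
    good K (fmass o K) (delta / 200 / 200) k i j.
  apply: contrapT => hno.
  have hlt j : (j0 <= j < j0 + 25)%N ->
     dsum k i (fun n => tmass K (fmass o K) k n j) <= delta / 200 / 200 * (2 ^ k)%N%:R.
    move=> hj; rewrite leNgt; apply/negP => hlt; apply: hno; exists j => //.
    by rewrite /good kK ltW.
  have : (mu (shadow Q v) <= (w * (25 * (delta / 200 / 200 * (2 ^ k)%N%:R)))%:E)%E.
    pose s := [seq (n, j) | n <- iota (i * 2 ^ k) (2 ^ k), j <- iota j0 25].
    apply: le_trans (measure_seq_cover mu (s := s)
       (F := fun z => strip w o z.1 `&` level k z.2) _ _ _) _.
    - exact: measurable_shadow.
    - by move=> z; apply: measurableI; [exact: measurable_strip|exact: measurable_level].
    - move=> x [/hx[x0 xi] /=]; rewrite /theta /= in_itv /= => /andP[t1 t2].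
      have wE : rwid Q = w by case: hQ => _ [].
      rewrite wE in t1 t2.
      exists (Num.truncn (x / w + o%:R), Num.truncn (v x * (2 ^ k)%N%:R)); last first.
        by split => //; apply: strip_ex.
      have /andP[v0 v1] := v01 x.
      have vk0 : 0 <= v x * (2 ^ k)%N%:R by rewrite mulr_ge0 // ltW.
      have hv1 : rslope Q * (2 ^ k)%N%:R - 12 <= v x * (2 ^ k)%N%:R.
        by move: t1; rewrite -(ler_pM2r p0); lra.
      have hv2 : v x * (2 ^ k)%N%:R <= rslope Q * (2 ^ k)%N%:R + 12.
        by move: t2; rewrite -(ler_pM2r p0); lra.
      have hm : Num.truncn (v x * (2 ^ k)%N%:R) \in iota j0 25.
        rewrite mem_iota; apply/andP; split; first exact: le_truncn.
        rewrite truncn_lt_nat // natrD.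
        have := truncnS_gt (rslope Q * (2 ^ k)%N%:R - 12); rewrite -/j0 -natr1; lra.
      apply/allpairsP; exists (Num.truncn (x / w + o%:R), Num.truncn (v x * (2 ^ k)%N%:R)).
      by split; [rewrite mem_dyadic xi | exact: hm |].
    rewrite big_allpairs /= exchange_big /=.
    apply: (@le_trans _ _ (\sum_(j <- iota j0 25) (w * dsum k i (fun n => tmass K (fmass o K) k n j))%:E)%E).
      apply: lee_sum => j _; rewrite /dsum mulr_sumr -sumEFin; apply: lee_sum => n _.
      exact: mu_strip_tmass.
    rewrite sumEFin lee_fin -mulr_sumr ler_wpM2l ?(ltW w0) //.
    apply: (@le_trans _ _ (\sum_(j <- iota j0 25) delta / 200 / 200 * (2 ^ k)%N%:R)).
      rewrite big_seq [leRHS]big_seq; apply: ler_sum => j; rewrite mem_iota; exact: hlt.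
    by rewrite big_const_seq count_predT size_iota iter_addr_0 -[_ *+ 25]mulr_natl.
  move/(le_trans hE); rewrite lee_fin.
  pose c := delta / 200 / 200; rewrite -/c.
  have cd : delta = 200 * (200 * c) by rewrite /c; field.
  have c0 : 0 < c by rewrite /c; lra.
  have cL : 0 < c * rlen Q by rewrite mulr_gt0.
  have hT : w * (25 * (c * (2 ^ k)%N%:R)) <= 600 * (c * rlen Q).
    move: h24; rewrite mulrA ler_pdivlMr // -(ler_pM2l c0); lra.
  move/le_trans => /(_ _ hT); rewrite cd.
  have -> : 200 * (200 * c) * rlen Q / 64 = 200 * (200 * (c * rlen Q)) / 64 by field.
  move: (c * rlen Q) cL => u; lra.
exists j; split => // a ha.
have aj : (j%:R : R) <= a%:R / (2 ^ K)%N%:R * (2 ^ k)%N%:R <= (j%:R + 1 : R).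
  have q0 := @natr_exp2_gt0 R (K - k).
  have -> : a%:R / (2 ^ K)%N%:R * (2 ^ k)%N%:R = a%:R / (2 ^ (K - k))%N%:R :> R.
    by rewrite -{1}(subnK kK) expnD natrM; field; rewrite !gt_eqF.
  rewrite ler_pdivlMr // ler_pdivrMr // natr1 -!natrM !ler_nat -ha leq_divM /=.
  by apply/ltnW; rewrite -ltn_divLR // expn_gt0.
move: j1 j2; rewrite -(ler_nat R) -(ltr_nat R) natrD => j1 j2.
have h1 : - 12 <= rslope Q * (2 ^ k)%N%:R.
  move: hs; rewrite -(ler_pM2r p0) mul0r; lra.
(* Truncation gives [j0 = 0] when the window of slopes starts below 0. *)
have h2 : j0%:R <= Num.max 0 (rslope Q * (2 ^ k)%N%:R - 12).
  rewrite le_max; case: (lerP 0 (rslope Q * (2 ^ k)%N%:R - 12)) => h.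
    by rewrite -truncn_le in h; rewrite h orbT.
  by rewrite (_ : j0 = 0%N) ?lexx //; apply/truncn0Pn; rewrite -ltNge; lra.
have h3 := truncnS_gt (rslope Q * (2 ^ k)%N%:R - 12).
rewrite -/j0 -natr1 in h3.
have -> : `|a%:R / (2 ^ K)%N%:R - rslope Q| * (2 ^ k)%N%:R =
   `|a%:R / (2 ^ K)%N%:R * (2 ^ k)%N%:R - rslope Q * (2 ^ k)%N%:R|.
  by rewrite -mulrBl normrM (ger0_norm (ltW p0)).
move: aj h2; rewrite le_max => /andP[a1 a2] /orP h2.
rewrite ler_norml; case: h2 => h2; lra.
Qed.
End Mass.

Lemma truncnD_nat (R : realType) (x : R) n : 0 <= x ->
  Num.truncn (x + n%:R) = (Num.truncn x + n)%N.
Proof.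
move=> /truncn_itv /andP[h1 h2]; apply: truncn_def.
by rewrite -addSn !natrD lerD2r ltrD2r h1.
Qed.

Lemma rise_real (R : realType) K a n :
  ((rise K a n)%:R : R) <= a%:R / (2 ^ K)%N%:R * n%:R < ((rise K a n)%:R + 1 : R) .
Proof.
have P0 := @natr_exp2_gt0 R K; have := rise_bounds K a n.
by rewrite mulrAC ler_pdivlMr // ltr_pdivrMr // natr1 -!natrM ler_nat ltr_nat.
Qed.

Section Tiles.
Variables (R : realType) (w : R) (Q : rect R).
Hypothesis w0 : 0 < w.
Hypothesis wfQ : rect_wf Q.
Hypothesis wQ : rwid Q = w.
Local Notation l := (rlen Q / w).

Lemma rlen_ratio_ge1 : 1 <= l.
Proof. by rewrite ler_pdivlMr // mul1r -wQ; case: wfQ. Qed.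

Lemma dyadic_columns o q : 0 <= ((rc Q).1 - rlen Q) / w + o%:R ->
  24 * l <= (2 ^ (2 * q))%N%:R ->
  exists (k i : nat) (b : bool),
  [/\ (2 ^ k)%N%:R <= 24 * l, 6 * l <= (2 ^ k)%N%:R &
      forall x, `|x - (rc Q).1| < rlen Q -> 0 <= x / w + (o + b * third q)%N%:R /\
      (Num.truncn (x / w + (o + b * third q)%N%:R) %/ 2 ^ k)%N = i].
Proof.
set X1 := _ / w + _ => X10 hq.
pose X2 := ((rc Q).1 + rlen Q) / w + o%:R.
have L0 : 0 < rlen Q by exact: rlen_gt0.
have l1 := rlen_ratio_ge1.
have X12 : X2 - X1 = 2 * l by rewrite /X1 /X2; field; rewrite gt_eqF.
pose lo := Num.truncn X1; pose hi := Num.truncn X2.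
have X20 : 0 <= X2 by lra.
have /andP[lo1 lo2] := truncn_itv X10; have /andP[hi1 hi2] := truncn_itv X20.
rewrite -/lo -/hi -!natr1 in lo1 lo2 hi1 hi2.
have lohi : (lo <= hi)%N by apply: le_truncn; lra.
pose D := (3 * (hi - lo) + 3)%N; pose k := up_log 2 D.
have Dk : (D <= 2 ^ k)%N by apply: up_logP.
have DE : D%:R = 3 * (hi%:R - lo%:R) + 3 :> R by rewrite /D natrD natrM natrB.
have k6 : 6 * l <= (2 ^ k)%N%:R.
  by move: Dk; rewrite -(ler_nat R) DE; lra.
have k24 : (2 ^ k)%N%:R <= 24 * l.
  have D1 : (1 < D)%N by rewrite /D addn3.
  have /andP[h _] := up_log_bounds (ltnSn 1) D1.
  have k0 : (0 < k)%N by rewrite up_log_gt0.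
  rewrite -(prednK k0) expnS natrM; apply: le_trans (_ : 2 * D%:R <= _); last by rewrite DE; lra.
  by rewrite ler_pM2l // ler_nat ltnW.
have kq : (k <= 2 * q)%N.
  rewrite -(leq_exp2l _ _ (ltnSn 1)) -(ler_nat R); lra.
have key b : ((lo + b * third q) %/ 2 ^ k = (hi + b * third q) %/ 2 ^ k)%N ->
    forall x, `|x - (rc Q).1| < rlen Q -> 0 <= x / w + (o + b * third q)%N%:R /\
      (Num.truncn (x / w + (o + b * third q)%N%:R) %/ 2 ^ k)%N = ((lo + b * third q) %/ 2 ^ k)%N.
  move=> e x; rewrite ltr_norml => /andP[x1 x2].
  have hX1 : X1 <= x / w + o%:R by rewrite /X1 lerD2r ler_pM2r ?invr_gt0 //; lra.
  have hX2 : x / w + o%:R <= X2 by rewrite /X2 lerD2r ler_pM2r ?invr_gt0 //; lra.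
  have x0 : 0 <= x / w + o%:R by lra.
  rewrite natrD addrA; split; first by rewrite addr_ge0.
  rewrite truncnD_nat //; apply/eqP; rewrite eqn_leq; apply/andP; split.
    by rewrite e leq_div2r // leq_add2r le_truncn.
  by rewrite leq_div2r // leq_add2r le_truncn.
case: (third_shift kq lohi Dk) => e.
  by exists k, (lo %/ 2 ^ k)%N, false; split => // x /(key false); rewrite !addn0; apply.
by exists k, ((lo + third q) %/ 2 ^ k)%N, true; split => // x /(key true); rewrite !mul1n; apply.
Qed.

(** The error in the row is at most 40 / 3 from the slope, as [2 * l <= 2 ^ k / 3], 2 from the
    rounding of columns, 2 from the width, plus the rounding of heights. The total is below 32, the
    offset that centres the window. *)
Lemma rect_row_window o oy K k a z p p' : Num.sqrt (1 + rslope Q ^+ 2) <= 2 ->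
  6 * l <= (2 ^ k)%N%:R ->
  `|a%:R / (2 ^ K)%N%:R - rslope Q| * (2 ^ k)%N%:R <= 40 ->
  (a < 2 ^ K.+1)%N -> (rise K a z.1 <= z.2)%N ->
  rect_set Q p -> rect_set Q p' -> cell w o oy z p ->
  0 <= p'.1 / w + o%:R ->
  forall y, y = (z.2 - rise K a z.1 + rise K a (Num.truncn (p'.1 / w + o%:R)))%N ->
  y%:R <= p'.2 / w + (oy + 32)%N%:R < y%:R + 64.
Proof.
move=> N2 k6 ha aK hz Qp Qp' [/(stripP w0) zX /(stripP w0) zY] X'0 y ->.
have /truncn_itv := X'0; set n := Num.truncn _ => /andP[n1 n2].
pose X := p.1 / w + o%:R; pose X' := p'.1 / w + o%:R.
pose Y := p.2 / w + oy%:R; pose Y' := p'.2 / w + oy%:R.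
rewrite -/X -/X' -/Y -/Y' -natr1 in zX zY n1 n2 *.
have P0 := @natr_exp2_gt0 R K; have p0 := @natr_exp2_gt0 R k.
pose al : R := a%:R / (2 ^ K)%N%:R.
have al0 : 0 <= al by rewrite divr_ge0.
have al2 : al <= 2.
  by rewrite ler_pdivrMr // -natrM ler_nat -expnS ltnW.
have r1 := rise_real R K a z.1; have r2 := rise_real R K a n.
have [b1 b2] := rect_set_bounds wfQ Qp; have [b1' b2'] := rect_set_bounds wfQ Qp'.
have Nw : Num.sqrt (1 + rslope Q ^+ 2) * rwid Q / 2 <= w.
  by rewrite wQ mulrAC ler_piMl ?(ltW w0) //; lra.
have dX : `|X' - X| <= 2 * l.
  have -> : X' - X = (p'.1 - p.1) / w by rewrite /X /X'; ring.
  rewrite normrM (gtr0_norm (x := w^-1)) ?invr_gt0 // mulrA ler_pM2r ?invr_gt0 //.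
  move: b1 b1'; rewrite ler_norml !ltr_norml; lra.
have dY : `|Y' - Y - rslope Q * (X' - X)| <= 2.
  have -> : Y' - Y - rslope Q * (X' - X) = ((p'.2 - p.2) - rslope Q * (p'.1 - p.1)) / w.
    by rewrite /X /X' /Y /Y'; ring.
  rewrite normrM (gtr0_norm (x := w^-1)) ?invr_gt0 // ler_pdivrMr //.
  move: b2 b2'; rewrite ler_norml !ltr_norml; lra.
have U : `|(rslope Q - al) * (X' - X)| <= 40 / 3.
  rewrite normrM distrC; apply: le_trans (_ : `|al - rslope Q| * ((2 ^ k)%N%:R / 3) <= _); last lra.
  by rewrite ler_wpM2l //; lra.
have W : `|al * ((X' - X) - (n%:R - z.1%:R))| <= 2.
  rewrite normrM (ger0_norm al0) -[leRHS]mulr1; apply: ler_pM => //.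
  by rewrite ler_norml; lra.
rewrite natrD natrB //.
move: U W dY r1 r2; rewrite -/al !ler_norml; rewrite natrD addrA -/Y'.
move: zY; rewrite /= !mulrBr !mulrBl.
move: (rise K a z.1)%:R (rise K a n)%:R (z.2)%:R Y Y' => u1 u2 u3 Y Y'.
move: (al * z.1%:R) (al * n%:R) (al * X') (al * X) (rslope Q * X') (rslope Q * X) => c1 c2 c3 c4 c5 c6.
lra.
Qed.
End Tiles.

(** * Averages over cells and the maximal inequality *)

Lemma le_inve_real (R : realType) (c : R) (x : \bar R) : 0 < c -> (c%:E <= x)%E ->
  (x^-1 <= (c^-1)%:E)%E.
Proof.
move=> c0; case: x => [r| |] //.
  rewrite lee_fin => cr; have r0 := lt_le_trans c0 cr.
  by rewrite inver gt_eqF // lee_fin lef_pV2.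
by move=> _; rewrite invey lee_fin invr_ge0 ltW.
Qed.

Lemma sqr_sum_seq_le (R : realFieldType) (I : Type) (s : seq I) (x : I -> R) :
  (\sum_(i <- s) x i) ^+ 2 <= (size s)%:R * \sum_(i <- s) x i ^+ 2.
Proof.
case: (posnP (size s)) => [/size0nil ->|s0]; first by rewrite !big_nil expr0n mulr0.
have n0 : (0 : R) < (size s)%:R by rewrite ltr0n.
set S := \sum_(i <- s) x i; pose c := S / (size s)%:R.
have cS : (size s)%:R * c = S by rewrite mulrC divfK // gt_eqF.
have : \sum_(i <- s) (2 * c * x i - c ^+ 2) <= \sum_(i <- s) x i ^+ 2.
  by apply: ler_sum => i _; have := sqr_ge0 (x i - c); rewrite sqrrB; lra.
rewrite -(ler_pM2l n0); apply: le_trans; rewrite sumrB -mulr_sumr -/S.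
rewrite big_const_seq count_predT iter_addr_0 -[c ^+ 2 *+ _]mulr_natl.
have -> : (size s)%:R * (2 * c * S - (size s)%:R * c ^+ 2) =
  2 * ((size s)%:R * c) * S - ((size s)%:R * c) ^+ 2 by ring.
by rewrite cS; lra.
Qed.

Section Averages.
Variables (R : realType) (w : R) (f : R * R -> R) (E : R).
Hypothesis w0 : 0 < w.
Hypothesis mf : measurable_fun setT f.
Hypothesis fE : (\int[@leb2 R]_x (`|f x| ^+ 2)%:E = E%:E)%E.

Definition cavg ox oy n y : R :=
  fine (\int[@leb2 R]_(p in cell w ox oy (n, y)) (`|f p|)%:E)%E / w ^+ 2.

Lemma measurable_abs : measurable_fun setT (fun p => (`|f p|)%:E).
Proof. by apply/measurable_EFinP; apply: measurableT_comp. Qed.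

Lemma measurable_abs2 : measurable_fun setT (fun p => (`|f p| ^+ 2)%:E).
Proof. by apply/measurable_EFinP; apply: measurable_funX; apply: measurableT_comp. Qed.

Lemma cell_sqr_le ox oy z :
  (\int[@leb2 R]_(p in cell w ox oy z) (`|f p| ^+ 2)%:E <= E%:E)%E.
Proof.
rewrite -fE; apply: ge0_subset_integral => //; first exact: measurable_cell.
exact: measurable_abs2.
Qed.

(** A linear substitute for Cauchy-Schwarz: [a = 1] gives integrability on the cell, and [a] equal
    to the cell average gives [cavg_sqr]. *)
Lemma cell_young ox oy z (a : R) : 0 <= a ->
  ((2 * a)%:E * \int[@leb2 R]_(p in cell w ox oy z) (`|f p|)%:E <=
   \int[@leb2 R]_(p in cell w ox oy z) (`|f p| ^+ 2)%:E + (a ^+ 2 * w ^+ 2)%:E)%E.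
Proof.
move=> a0; have mc := @measurable_cell R w ox oy z.
have -> : (a ^+ 2 * w ^+ 2)%:E = (\int[@leb2 R]_(p in cell w ox oy z) (a ^+ 2)%:E)%E.
  by rewrite integral_cst // EFinM -(leb2_cell w0 ox oy z).
rewrite -ge0_integralZl //; first last.
- by rewrite lee_fin mulr_ge0.
- by apply: measurable_funTS; exact: measurable_abs.
rewrite -ge0_integralD //; first last.
- by move=> p _; rewrite lee_fin sqr_ge0.
- by apply: measurable_funTS; exact: measurable_abs2.
apply: ge0_le_integral => //.
- by move=> p _; rewrite -EFinM lee_fin mulr_ge0 // mulr_ge0.
- apply: measurable_funTS; apply: measurable_funeM; exact: measurable_abs.
- apply: measurable_funTS; apply: emeasurable_funD => //; exact: measurable_abs2.
move=> p _; rewrite -EFinM -EFinD lee_fin.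
have := sqr_ge0 (`|f p| - a); rewrite sqrrB; lra.
Qed.

Lemma cell_abs ox oy n y :
  (\int[@leb2 R]_(p in cell w ox oy (n, y)) (`|f p|)%:E)%E = (w ^+ 2 * cavg ox oy n y)%:E.
Proof.
have w2 : w ^+ 2 != 0 by rewrite expf_neq0 // gt_eqF.
rewrite /cavg mulrC divfK // fineK // ge0_fin_numE; last by apply: integral_ge0.
have := @cell_young ox oy (n, y) 1 ler01.
set X := (\int[_]_(p in _) _)%E; set Y := (\int[_]_(p in _) _)%E => h.
have : (Y + (1 ^+ 2 * w ^+ 2)%:E < +oo)%E.
  by rewrite lte_add_pinfty ?ltry //; apply: le_lt_trans (cell_sqr_le _ _ _) (ltry _).
move/(le_lt_trans h); have : (0 <= X)%E by apply: integral_ge0.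
by case: (X) => [r| |] // _; rewrite ?ltry // mulr1 gt0_muley ?lte_fin.
Qed.

Lemma cavg_ge0 ox oy n y : 0 <= cavg ox oy n y.
Proof. by rewrite divr_ge0 ?fine_ge0 ?integral_ge0 // exprn_ge0 // ltW. Qed.

Lemma cavg_sqr ox oy n y : ((w ^+ 2 * cavg ox oy n y ^+ 2)%:E <=
  \int[@leb2 R]_(p in cell w ox oy (n, y)) (`|f p| ^+ 2)%:E)%E.
Proof.
have := cell_young ox oy (n, y) (cavg_ge0 ox oy n y); rewrite cell_abs -EFinM.
have : (0 <= \int[@leb2 R]_(p in cell w ox oy (n, y)) (`|f p| ^+ 2)%:E)%E.
  by apply: integral_ge0 => p _; rewrite lee_fin sqr_ge0.
case: (\int[_]_(_ in _) _)%E => [r| |] // _; last by move=> _; rewrite leey.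
by rewrite -EFinD !lee_fin; lra.
Qed.

Lemma sum_cavg_sqr ox oy (s : seq (nat * nat)) : uniq s ->
  w ^+ 2 * \sum_(z <- s) cavg ox oy z.1 z.2 ^+ 2 <= E.
Proof.
move=> us; rewrite -lee_fin -fE mulr_sumr -sumEFin.
apply: (@le_trans _ _ (\sum_(z <- s) \int[@leb2 R]_(p in cell w ox oy z) (`|f p| ^+ 2)%:E)%E).
  by apply: lee_sum => -[n y] _; exact: cavg_sqr.
apply: ge0_sum_integral_le => //; last exact: measurable_abs2.
- by move=> z; exact: measurable_cell.
- exact: trivIset_cell.
Qed.

(* The 64 rows are those of [rect_row_window]; 32 and 24 bound [L w / |Q|] and [2 ^ k / (L / w)]. *)
Definition fat ox oy n y : R := 32 * 24 * \sum_(e <- iota 0 64) cavg ox (oy + 32) n (y + e).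

Lemma fat_ge0 ox oy n y : 0 <= fat ox oy n y.
Proof. by rewrite mulr_ge0 ?sumr_ge0 ?mulr_ge0 ?ler0n // => e _; exact: cavg_ge0. Qed.

Lemma tot_fat ox oy K H :
  w ^+ 2 * tot K H (fun n y => fat ox oy n y ^+ 2) <= (32 * 24 * 64) ^+ 2 * E.
Proof.
pose G n y := cavg ox (oy + 32) n y ^+ 2.
have G0 n y : 0 <= G n y by rewrite sqr_ge0.
(* Shifts by up to 63 rows leave the height [2 ^ H]; [H + 7] makes room for them. *)
have hG : w ^+ 2 * tot K (H + 7) G <= E.
  rewrite /tot /dsum !mul0n -(big_allpairs (F := fun z => G z.1 z.2)) /=.
  apply: sum_cavg_sqr; apply: allpairs_uniq; rewrite ?iota_uniq // => -[? ?] [? ?].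
  by [].
have w2 : 0 <= w ^+ 2 by rewrite sqr_ge0.
have sh e : e \in iota 0 64 -> tot K H (fun n y => G n (y + e)%N) <= tot K (H + 7) G.
  rewrite mem_iota /= add0n => he; apply: le_dsum => n _; apply: le_dsum_shift => //.
  rewrite expnD; apply: (@leq_trans (64 * 2 ^ H + 2 ^ H)).
    by rewrite leq_add2r; apply: leq_trans (ltnW he) _; rewrite leq_pmulr // expn_gt0.
  by rewrite -[X in (_ + X)%N]mul1n -mulnDl mulnC leq_mul2l orbT.
apply: (@le_trans _ _ (w ^+ 2 * tot K H (fun n y => (32 * 24) ^+ 2 * 64 * \sum_(e <- iota 0 64) G n (y + e)%N))).
  rewrite ler_wpM2l //; apply: le_tot => n y; rewrite /fat exprMn -mulrA ler_wpM2l ?sqr_ge0 //.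
  exact: sqr_sum_seq_le.
rewrite totZ tot_sum mulrCA.
have -> : (32 * 24 * 64) ^+ 2 * E = (32 * 24) ^+ 2 * 64 * (64 * E) :> R by rewrite exprMn -!mulrA.
rewrite ler_wpM2l ?mulr_ge0 ?sqr_ge0 ?ler0n //.
apply: (@le_trans _ _ (w ^+ 2 * \sum_(e <- iota 0 64) tot K (H + 7) G)).
  by rewrite ler_wpM2l // big_seq [leRHS]big_seq; apply: ler_sum => e /sh.
rewrite big_const_seq count_predT size_iota iter_addr_0 -[tot _ _ _ *+ _]mulr_natl mulrCA.
by rewrite ler_wpM2l ?ler0n.

Qed.

Lemma rect_average (v : R -> R) delta Q ox oy z p k i K a val :
  0 < delta -> (forall a, 0 <= v a <= 1) -> measurable_fun setT v ->
  rect_wf Q -> Rdelta w delta (fun p => v p.1) Q ->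
  6 * (rlen Q / w) <= (2 ^ k)%N%:R -> (2 ^ k)%N%:R <= 24 * (rlen Q / w) ->
  (forall x, `|x - (rc Q).1| < rlen Q -> 0 <= x / w + ox%:R /\
     (Num.truncn (x / w + ox%:R) %/ 2 ^ k)%N = i) ->
  `|a%:R / (2 ^ K)%N%:R - rslope Q| * (2 ^ k)%N%:R <= 40 ->
  (a < 2 ^ K.+1)%N -> (rise K a z.1 <= z.2)%N ->
  rect_set Q p -> cell w ox oy z p ->
  (val%:E <= (leb2 (rect_set Q))^-1 * \int[@leb2 R]_(q in rect_set Q) (`|f q|)%:E)%E ->
  val * (2 ^ k)%N%:R <= dsum k i (fun n => fat ox oy n (z.2 - rise K a z.1 + rise K a n)%N).
Proof.
move=> d0 v01 mv wfQ hQ k6 k24 hx ha aK hz Qp cp.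
have [N2 _ hA _] := Rdelta_bounds wfQ mv d0 v01 hQ.
have wQ : rwid Q = w by case: hQ => _ [].
have L0 := rlen_gt0 wfQ; have p0 := @natr_exp2_gt0 R k.
pose y n := (z.2 - rise K a z.1 + rise K a n)%N.
pose s := [seq (n, (y n + e)%N) | n <- iota (i * 2 ^ k) (2 ^ k), e <- iota 0 64].
have cov : (\int[@leb2 R]_(p in rect_set Q) (`|f p|)%:E <=
   \sum_(c <- s) \int[@leb2 R]_(p in cell w ox (oy + 32) c) (`|f p|)%:E)%E.
  apply: ge0_integral_seq_cover.
  - exact: measurable_rect_set.
  - by move=> c; exact: measurable_cell.
  - exact: measurable_abs.
  - by move=> q; rewrite lee_fin.
  move=> q Qq; have [h1 _] := rect_set_bounds wfQ Qq.
  have [x0 xi] := hx _ h1.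
  have /andP[t1 t2] := rect_row_window w0 wfQ wQ N2 k6 ha aK hz Qp Qq cp x0 erefl.
  have t0 : 0 <= q.2 / w + (oy + 32)%N%:R by apply: le_trans t1.
  set n := Num.truncn (q.1 / w + ox%:R) in xi t1 t2.
  set t := Num.truncn (q.2 / w + (oy + 32)%N%:R).
  exists (n, t); last by split; apply: strip_ex.
  have yt : (y n <= t)%N by rewrite truncn_ge_nat.
  have ty : (t < y n + 64)%N by rewrite truncn_lt_nat // [ltRHS]natrD.
  apply/allpairsP; exists (n, (t - y n)%N); split.
  - by rewrite /= mem_dyadic xi.
  - by rewrite (mem_iota 0 64) add0n ltn_subLR.
  - by rewrite /= subnKC.
pose X := (\int[@leb2 R]_(p in rect_set Q) (`|f p|)%:E)%E; rewrite -/X; rewrite -/X in cov.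
pose Z := \sum_(n <- iota (i * 2 ^ k) (2 ^ k)) \sum_(e <- iota 0 64) cavg ox (oy + 32) n (y n + e).
have XZ : (X <= (w ^+ 2 * Z)%:E)%E.
  apply: le_trans cov _; rewrite /s big_allpairs_dep /= /Z mulr_sumr -sumEFin; apply: lee_sum => n _.
  by rewrite mulr_sumr -sumEFin; apply: lee_sum => e _; rewrite cell_abs.
have X0 : (0 <= X)%E by apply: integral_ge0.
have c0 : 0 < rlen Q * w / 32 by rewrite divr_gt0 // mulr_gt0.
move/le_trans => /(_ _ (lee_wpmul2r X0 (le_inve_real c0 hA))).
have ci0 : (0 <= ((rlen Q * w / 32)^-1)%:E)%E by rewrite lee_fin invr_ge0 ltW.
move/le_trans => /(_ _ (lee_wpmul2l ci0 XZ)); rewrite -EFinM lee_fin => hv.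
have Z0 : 0 <= Z by rewrite sumr_ge0 // => n _; rewrite sumr_ge0 // => e _; exact: cavg_ge0.
rewrite /fat /dsum -mulr_sumr -/Z.
apply: le_trans (_ : (rlen Q * w / 32)^-1 * (w ^+ 2 * Z) * (2 ^ k)%N%:R <= _); first by rewrite ler_wpM2r // ltW.
have -> : (rlen Q * w / 32)^-1 * (w ^+ 2 * Z) * (2 ^ k)%N%:R = 32 * ((rlen Q / w)^-1 * (2 ^ k)%N%:R) * Z.
  by field; rewrite !gt_eqF.
rewrite ler_wpM2r //.
have l0 : 0 < rlen Q / w by rewrite divr_gt0.
have : (rlen Q / w)^-1 * (2 ^ k)%N%:R <= 24 by rewrite mulrC ler_pdivrMr.
lra.
Qed.
End Averages.

Lemma seq_nat_bound (R : realType) (T : eqType) (s : seq T) (X : T -> R) :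
  exists n : nat, forall x, x \in s -> X x <= n%:R.
Proof.
elim: s => [|y s [n IH]]; first by exists 0%N.
exists (maxn n (Num.truncn (X y)).+1) => x; rewrite inE => /orP[/eqP ->|/IH].
  by apply: le_trans (ltW (truncnS_gt _)) _; rewrite ler_nat leq_maxr.
by move/le_trans; apply; rewrite ler_nat leq_maxl.
Qed.

(** * From finitely many cells to the discrete inequality *)

Section Grid.
Variables (R : realType) (w delta : R) (v : R -> R) (f : R * R -> R) (E : R).
Hypothesis w0 : 0 < w.
Hypothesis delta0 : 0 < delta.
Hypothesis delta1 : delta <= 1.
Hypothesis v01 : forall a, 0 <= v a <= 1.
Hypothesis mv : measurable_fun setT v.
Hypothesis mf : measurable_fun setT f.
Hypothesis fE : (\int[@leb2 R]_x (`|f x| ^+ 2)%:E = E%:E)%E.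
Local Notation loss := (delta / 200 / 200).

Lemma strip_shift o c n x : strip w o n x -> strip w (o + c) (n + c) x.
Proof. by move=> /(stripP w0) h; apply/(stripP w0); rewrite !natrD; lra. Qed.

Lemma cell_shift o c d z p : cell w o o z p -> cell w (o + c) (o + d) (z.1 + c, z.2 + d)%N p.
Proof. by case=> /= h1 h2; split; apply: strip_shift. Qed.

Definition hit o z val (Qp : rect R * (R * R)) :=
  [/\ Rdelta w delta (fun p => v p.1) Qp.1, rect_set Qp.1 Qp.2, cell w o o z Qp.2 &
   (val%:E <= (leb2 (rect_set Qp.1))^-1 * \int[@leb2 R]_(q in rect_set Qp.1) (`|f q|)%:E)%E].

(** [t] gives the grid, the level and the slope interval. The translations [c] and [d] keep all
    columns and rows that occur nonnegative. *)
Definition tiled o c d q K z val (t : bool * nat * nat) :=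
  let s := (c + t.1.1 * third q)%N in
  good K (fmass w v (o + s) K) loss t.1.2 ((z.1 + s) %/ 2 ^ t.1.2) t.2 /\
  forall a, (a %/ 2 ^ (K - t.1.2))%N = t.2 -> (a < 2 ^ K.+1)%N ->
    val * (2 ^ t.1.2)%N%:R <= dsum t.1.2 ((z.1 + s) %/ 2 ^ t.1.2)
      (fun n => fat w f (o + s) (o + d) n (z.2 + d - rise K a (z.1 + s) + rise K a n)%N).

Lemma hit_tile o c d q K z val Qp : hit o z val Qp ->
  0 <= ((rc Qp.1).1 - rlen Qp.1) / w + (o + c)%N%:R ->
  24 * (rlen Qp.1 / w) <= (2 ^ (2 * q))%N%:R ->
  (2 * q <= K)%N -> (z.1 + (c + third q) < 2 ^ K)%N -> (2 ^ K.+1 <= d)%N ->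
  exists t, tiled o c d q K z val t.
Proof.
case: Qp => Q p [/= hQ Qp cp hv] hc hq qK zK dK.
have [wfQ [wQ _]] := hQ.
have [k [i [b [k24 k6 hx]]]] := dyadic_columns w0 wfQ wQ hc hq.
have kK : (k <= K)%N.
  apply: leq_trans qK; rewrite -(leq_exp2l _ _ (ltnSn 1)) -(ler_nat R).
  exact: le_trans k24 hq.
pose s := (c + b * third q)%N.
rewrite -addnA -/s in hx.
have csp : cell w (o + s) (o + d) (z.1 + s, z.2 + d)%N p by exact: cell_shift.
have iE : ((z.1 + s) %/ 2 ^ k)%N = i.
  have [h1 _] := rect_set_bounds wfQ Qp; have [_ <-] := hx _ h1.
  by case: csp => /= /(strip_truncn w0) <-.
have [j [gj ja]] := rect_good_tile w0 v01 mv delta0 wfQ hQ kK k24 hx.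
exists (b, k, j); rewrite /tiled /= -/s iE; split => // a aj aK.
apply: (rect_average w0 mf fE delta0 v01 mv wfQ hQ k6 k24 hx (ja _ aj) aK _ Qp csp hv) => /=.
apply: leq_trans (leq_addl _ _); apply: leq_trans dK; apply/ltnW.
rewrite /rise ltn_divLR ?expn_gt0 //; apply: ltn_mul => //.
apply: leq_ltn_trans zK; rewrite leq_add2l /s leq_add2l.
by case: (b); rewrite ?mul1n ?mul0n.
Qed.

Lemma disc_const_ge0 : 0 <= disc_const R.
Proof. by rewrite mulr_ge0 ?addr_ge0 ?mulr_ge0 ?ler0n. Qed.

(** The 2 counts the two grids, [400 ^ 3] is the effect of [loss] on the logarithm, and the last
    square is the cost of [fat]. *)
Definition grid_const : R := 2 * (disc_const R * 400 ^+ 3 * (32 * 24 * 64) ^+ 2).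

Lemma grid_const_ge0 : 0 <= grid_const.
Proof.
apply: mulr_ge0; first exact: ler0n.
apply: mulr_ge0; last exact: sqr_ge0.
by apply: mulr_ge0; [exact: disc_const_ge0|apply/exprn_ge0/ler0n].
Qed.

Lemma grid_maximal o (pts : seq (nat * nat)) (val : nat * nat -> R) :
  uniq pts -> (forall z, z \in pts -> 0 < val z /\ exists Qp, hit o z (val z) Qp) ->
  w ^+ 2 * \sum_(z <- pts) val z ^+ 2 <= grid_const * (1 + ln delta^-1) ^+ 3 * E.
Proof.
move=> us hz.
have [QQ hQQ] : {QQ & forall z, z \in pts -> hit o z (val z) (QQ z)}.
  apply: (@choice _ _ (fun z Qp => z \in pts -> hit o z (val z) Qp)) => z; case: (boolP (z \in pts)) => [/hz[_ [Qp h]]|_]; first by exists Qp.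
  by exists (Rect (0, 0) 0 0 0, (0, 0)).
have [c hc] := seq_nat_bound pts (fun z => - (((rc (QQ z).1).1 - rlen (QQ z).1) / w)).
have [q0 hq0] := seq_nat_bound pts (fun z => 24 * (rlen (QQ z).1 / w)).
have [M1 hM1] := seq_nat_bound pts (fun z => (z.1)%:R : R).
have [M2 hM2] := seq_nat_bound pts (fun z => (z.2)%:R : R).
(* [K] dominates all levels and shifted columns; [d] dominates the rise of a line, so that no tube
   starts below row 0. *)
pose q := q0; pose K := (2 * q + M1 + c + third q + 1)%N; pose d := (2 ^ K.+1)%N.
pose H := (M2 + K.+3)%N.
have hT z : z \in pts -> exists t, tiled o c d q K z (val z) t.
  move=> zp; apply: (hit_tile (hQQ _ zp)) => //.
  - have := hc _ zp; rewrite natrD; have : (0 : R) <= o%:R by []. lra.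
  - apply: le_trans (hq0 _ zp) _; rewrite ler_nat /q; apply: leq_trans (ltnW (ltn_expl q0 (ltnSn 1))) _.
    by rewrite leq_exp2l // leq_pmull.
  - by rewrite /K; move: (third q) (2 * q)%N => u u'; clear; lia.
  - apply: leq_ltn_trans (ltn_expl K (ltnSn 1)).
    have := hM1 _ zp; rewrite ler_nat /K => h; move: h; move: (third q) (z.1) => u u1; clear; lia.
have [tt htt] : {tt & forall z, z \in pts -> tiled o c d q K z (val z) (tt z)}.
  apply: (@choice _ _ (fun z t => z \in pts -> tiled o c d q K z (val z) t)) => z; case: (boolP (z \in pts)) => [/hT[t ht]|_]; first by exists t.
  by exists (false, 0%N, 0%N).
have loss0 : 0 < loss by rewrite !divr_gt0 ?ltr0n.
have loss1 : loss <= 1 by move: delta0 delta1; lra.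
(* The cells are split by the grid they use; each half is a discrete problem with its own column
   masses. *)
have half b : w ^+ 2 * \sum_(z <- pts | (tt z).1.1 == b) val z ^+ 2 <=
   disc_const R * (1 + ln loss^-1) ^+ 3 * ((32 * 24 * 64) ^+ 2 * E).
  pose s := (c + b * third q)%N.
  pose sh (z : nat * nat) := ((z.1 + s)%N, (z.2 + d)%N).
  pose un (z : nat * nat) := ((z.1 - s)%N, (z.2 - d)%N).
  have shK : cancel sh un by move=> [x y]; rewrite /sh /un /= !addnK.
  pose pb := [seq z <- pts | (tt z).1.1 == b].
  have dm := @discrete_maximal R K H (fmass w v (o + s) K) loss
    (fun n a => fmass_ge0 v w0 (o + s) K n a) (fun n => fmass_le1 w0 v01 mv (o + s) K n) loss0 loss1
    [seq sh z | z <- pb] (fun z => val (un z)) (fun z => (tt (un z)).1.2) (fun z => (tt (un z)).2)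
    (fat w f (o + s) (o + d)).
  rewrite -big_filter -/pb.
  have -> : \sum_(z <- pb) val z ^+ 2 = \sum_(z <- [seq sh z | z <- pb]) val (un z) ^+ 2.
    by rewrite big_map; apply: eq_bigr => z _; rewrite shK.
  have pbP z : z \in pb -> z \in pts /\ (tt z).1.1 = b.
    by rewrite mem_filter => /andP[/eqP].
  apply: (@le_trans _ _ (w ^+ 2 * (disc_const R * (1 + ln loss^-1) ^+ 3 * tot K H (fun n y => fat w f (o + s) (o + d) n y ^+ 2)))).
    rewrite ler_wpM2l ?sqr_ge0 //; apply: dm.
    - by rewrite map_inj_uniq; [exact: filter_uniq|exact: can_inj shK].
    - by move=> n y; apply: fat_ge0.
    - move=> _ /mapP[z /pbP[zp bz] ->]; rewrite shK; have := htt z zp; rewrite /tiled /= bz -/s => -[gz _].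
      split => //.
      + by apply: ltW; case: (hz _ zp).
      + rewrite /sh /=; apply: leq_ltn_trans (ltn_expl K (ltnSn 1)).
        have := hM1 _ zp; rewrite ler_nat /K /s => h.
        have : (b * third q <= third q)%N by case: (b); rewrite ?mul1n ?mul0n.
        by move: h; move: (b * third q)%N (third q) (z.1) => u u' u1; clear; lia.
      + by rewrite /sh /= leq_addl.
      + rewrite /sh /= /d /H -addnA addnn -mul2n -expnS.
        have := hM2 _ zp; rewrite ler_nat => h.
        apply: (@leq_trans (2 ^ (M2 + K.+2) + 2 ^ (M2 + K.+2))); last first.
          by rewrite addnn -mul2n -expnS leq_exp2l // -addnS.
        apply: leq_add; last by rewrite leq_exp2l // leq_addl.
        apply: leq_trans h _; apply: leq_trans (ltnW (ltn_expl M2 (ltnSn 1))) _.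
        by rewrite leq_exp2l // leq_addr.
    - move=> _ a /mapP[z /pbP[zp bz] ->]; rewrite shK => aj aK.
      have := htt z zp; rewrite /tiled /= bz -/s => -[_ hv]; exact (hv a aj aK).
  have := tot_fat w0 mf fE (o + s) (o + d) K H.
  move: (tot _ _ _) ((32 * 24 * 64) ^+ 2 * E) => t e te.
  by rewrite mulrCA ler_wpM2l // mulr_ge0 ?disc_const_ge0 // exprn_ge0 // addr_ge0 // ln_ge0 // invf_ge1.
(* The two factors 200 in [loss] cost at most 2 * 199 in the logarithm, whence 400. *)
have Lle : 1 + ln loss^-1 <= 400 * (1 + ln delta^-1).
  have -> : loss^-1 = 200 * (200 * delta^-1).
    by field; rewrite gt_eqF.
  have p200 : (0 : R) < 200 by rewrite ltr0n.
  have di : 0 < delta^-1 by rewrite invr_gt0.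
  rewrite !lnM ?posrE ?mulr_gt0 //.
  have l200 : ln (200 : R) <= 199.
    have -> : (200 : R) = 1 + 199 by ring.
    by apply: le_ln1Dx; lra.
  have : 0 <= ln delta^-1 by rewrite ln_ge0 // invf_ge1.
  lra.
have E0 : 0 <= E.
  by rewrite -lee_fin -fE; apply: integral_ge0 => x _; rewrite lee_fin sqr_ge0.
rewrite (bigID (fun z => (tt z).1.1 == true)) /= mulrDr.
rewrite [X in _ + _ * X](eq_bigl (fun z => (tt z).1.1 == false)); last by move=> z; case: (tt z).1.1.
apply: le_trans (lerD (half true) (half false)) _.
have E1 : 0 <= (32 * 24 * 64) ^+ 2 * E by rewrite mulr_ge0 // sqr_ge0.
rewrite /grid_const; move: disc_const_ge0 => D0.
have -> : 2 * (disc_const R * 400 ^+ 3 * (32 * 24 * 64) ^+ 2) * (1 + ln delta^-1) ^+ 3 * E =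
  2 * (disc_const R * (400 * (1 + ln delta^-1)) ^+ 3 * ((32 * 24 * 64) ^+ 2 * E)).
  by move: (disc_const R) (1 + _) (_ ^+ 2) 400 => x1 x2 x3 x4; ring.
move: (_ * E) E1 => e e0; rewrite -mulr2n -[leLHS]mulr_natl ler_wpM2l ?ler0n //.
have L1 : 0 <= 1 + ln loss^-1 by rewrite addr_ge0 // ln_ge0 // invf_ge1.
have L2 := le_trans L1 Lle.
rewrite -nnegrE in L1; rewrite -nnegrE in L2.
exact: (ler_wpM2r e0 (ler_wpM2l D0 (lerXn2r 3 L1 L2 Lle))).
Qed.
End Grid.

Lemma maxop_ge0 (R : realType) (C : set (rect R)) f x : (0 <= maxop C f x)%E.
Proof. by apply: ereal_sup_ubound; left. Qed.

(** * Simple functions below the square of the maximal function *)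

Section Maximal.
Import HBNNSimple.
Variables (R : realType) (w delta : R) (v : R -> R) (f : R * R -> R) (E : R).
Hypothesis w0 : 0 < w.
Hypothesis delta0 : 0 < delta.
Hypothesis delta1 : delta <= 1.
Hypothesis v01 : forall a, 0 <= v a <= 1.
Hypothesis mv : measurable_fun setT v.
Hypothesis mf : measurable_fun setT f.
Hypothesis fE : (\int[@leb2 R]_x (`|f x| ^+ 2)%:E = E%:E)%E.
Local Notation mx := (maxop (Rdelta w delta (fun p => v p.1)) f).

(** With [val ^ 2] half the supremum of [h] on the cell, some point has [h] above [val ^ 2], hence
    lies in a rectangle with average above [val]. This one rectangle controls [h] on the whole cell
    up to a factor 2. *)
Lemma cell_hit o z (h : R * R -> R) M : (forall x, h x <= M) ->
  (forall x, ((h x)%:E <= mx x ^+ 2)%E) ->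
  exists val, [/\ 0 <= val, forall x, cell w o o z x -> h x <= 2 * val ^+ 2 &
    0 < val -> exists Qp, hit w delta v f o z val Qp].
Proof.
move=> hM hm; case: (pselect (exists2 p, cell w o o z p & 0 < h p)) => [[p cp hp]|no]; last first.
  exists 0; split => //; last by rewrite ltxx.
  move=> x cx; rewrite expr0n mulr0 leNgt; apply/negP => hx; apply: no; by exists x.
pose A := h @` cell w o o z.
have supA : has_sup A.
  split; first by exists (h p); exists p.
  by exists M => _ [x _ <-].
have ubA x : cell w o o z x -> h x <= sup A.
  by move=> cx; apply: ub_le_sup; [case: supA | exists x].
have A0 : 0 < sup A by apply: lt_le_trans hp (ubA _ cp).
pose val := Num.sqrt (sup A / 2).
have v0 : 0 < val by rewrite sqrtr_gt0 divr_gt0.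
have v2 : val ^+ 2 = sup A / 2 by rewrite sqr_sqrtr // divr_ge0 // ltW.
exists val; split; [exact: ltW| |move=> _].
  by move=> x /ubA; rewrite v2 mulrC divfK.
have [|_ [x cx <-] hx] := @sup_adherent _ A (sup A / 2) _ supA; first by rewrite divr_gt0.
have : (val%:E < mx x)%E.
  rewrite ltNge; apply/negP => hle.
  have := hm x; apply/negP; rewrite -ltNge.
  apply: (@le_lt_trans _ _ (val%:E ^+ 2)%E).
    by rewrite lee_sqr ?maxop_ge0 // lee_fin ltW.
  by rewrite -EFin_expe lte_fin v2; lra.
move=> /ereal_sup_gt[_ [->|[Q [hQ Qx] <-]] hv].
  by move: hv; rewrite lte_fin ltNge ltW.
by exists (Q, x); split => //; apply: ltW.
Qed.

Lemma integral_bounded_le (h : R * R -> R) M : measurable_fun setT h ->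
  (forall x, 0 <= h x) -> (forall x, h x <= M) ->
  (forall x, ((h x)%:E <= mx x ^+ 2)%E) ->
  (\int[@leb2 R]_x (h x)%:E <= (2 * (grid_const R * (1 + ln delta^-1) ^+ 3 * E))%:E)%E.
Proof.
move=> mh0 h0 hM hm.
have mh : measurable_fun setT (fun x => (h x)%:E) by apply/measurable_EFinP.
(* Exhausting the plane by boxes of [2 * n] by [2 * n] cells leaves finitely many cells at a time;
   [n] then serves as the offset of the cells. *)
pose box (n : nat) : set (R * R) := `[- (n%:R * w), n%:R * w[%classic `*` `[- (n%:R * w), n%:R * w[%classic.
have mbox n : measurable (box n) by apply: measurableX; exact: measurable_itv.
have ndbox : nondecreasing_seq box.
  move=> a b ab; rewrite subsetEset => -[x y].
  have : a%:R * w <= b%:R * w by rewrite ler_wpM2r ?(ltW w0) // ler_nat.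
  by rewrite /box /= !in_itv /= => hw [/andP[? ?] /andP[? ?]]; split; apply/andP; split; lra.
have cvbox : \bigcup_n box n = setT.
  apply/seteqP; split => // -[x y] _.
  pose n := (Num.truncn (Num.max `|x| `|y| / w)).+1; exists n => //.
  have := truncnS_gt (Num.max `|x| `|y| / w); rewrite -/n ltr_pdivrMr // gt_max !ltr_norml.
  by rewrite /box /= !in_itv /= => /andP[/andP[? ?] /andP[? ?]]; split; apply/andP; split; lra.
have cv : (\int[@leb2 R]_(x in box n) (h x)%:E @[n --> \oo] -->
    \int[@leb2 R]_(x in \bigcup_n box n) (h x)%:E)%E.
  apply: ge0_nondecreasing_set_cvg_integral => //.
  - by move=> n; exact: measurable_funTS.
  - by move=> n x _; rewrite lee_fin.
rewrite cvbox in cv.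
suff bound n : (\int[@leb2 R]_(x in box n) (h x)%:E <= (2 * (grid_const R * (1 + ln delta^-1) ^+ 3 * E))%:E)%E.
  by apply: (cvge_to_le cv); exists 0%N => // n _; exact: bound.
have [val hval] : {val : nat * nat -> R & forall z, [/\ 0 <= val z,
    forall x, cell w n n z x -> h x <= 2 * val z ^+ 2 &
    0 < val z -> exists Qp, hit w delta v f n z (val z) Qp]}.
  apply: (@choice _ _ (fun z t => [/\ 0 <= t, forall x, cell w n n z x -> h x <= 2 * t ^+ 2 &
    0 < t -> exists Qp, hit w delta v f n z t Qp])) => z.
  exact: cell_hit hM hm.
pose s := [seq (a, b) | a <- iota 0 (2 * n), b <- iota 0 (2 * n)].
apply: (@le_trans _ _ (\sum_(z <- s) \int[@leb2 R]_(x in cell w n n z) (h x)%:E)%E).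
  apply: ge0_integral_seq_cover => //; first exact: mbox.
  - by move=> z; exact: measurable_cell.
  have col x : - (n%:R * w) <= x < n%:R * w -> exists2 a, a \in iota 0 (2 * n) & strip w n a x.
    rewrite -mulNr -ler_pdivlMr // -ltr_pdivrMr // => /andP[x1 x2].
    have x0 : 0 <= x / w + n%:R by lra.
    exists (Num.truncn (x / w + n%:R)); last exact: strip_ex.
    by rewrite mem_iota /= add0n truncn_lt_nat // mul2n -addnn natrD ltrD2r.
  case=> x y; rewrite /box /= !in_itv /= => -[/col[a ha sa] /col[b hb sb]].
  by exists (a, b); [apply/allpairsP; exists (a, b) | split].
apply: (@le_trans _ _ (\sum_(z <- s) (2 * (w ^+ 2 * val z ^+ 2))%:E)%E).
  apply: lee_sum => z _; have [_ hz _] := hval z.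
  have -> : (2 * (w ^+ 2 * val z ^+ 2))%:E = (\int[@leb2 R]_(x in cell w n n z) (2 * val z ^+ 2)%:E)%E.
    rewrite integral_cst; last exact: measurable_cell.
    have -> : 2 * (w ^+ 2 * val z ^+ 2) = 2 * val z ^+ 2 * w ^+ 2 by ring.
    by rewrite EFinM -(leb2_cell w0 n n z).
  apply: ge0_le_integral => //; first exact: measurable_cell.
  - by move=> x _; rewrite lee_fin.
  - exact: measurable_funTS.
rewrite sumEFin lee_fin -mulr_sumr ler_pM2l // -mulr_sumr.
pose pts := [seq z <- s | 0 < val z].
have -> : \sum_(z <- s) val z ^+ 2 = \sum_(z <- pts) val z ^+ 2.
  rewrite /pts big_filter [RHS]big_mkcond /=; apply: eq_bigr => z _.
  case: ltP => // hle; have [v0 _ _] := hval z.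
  by rewrite (_ : val z = 0) ?expr0n //; apply/eqP; rewrite eq_le hle v0.
apply: (grid_maximal w0 delta0 delta1 v01 mv mf fE (o := n)).
  by rewrite filter_uniq // allpairs_uniq ?iota_uniq // => -[? ?] [? ?].
move=> z; rewrite mem_filter => /andP[z0 _]; split => //.
by have [_ _ hz] := hval z; exact: hz.
Qed.

(* The integral is a supremum over the simple functions below the integrand, so
   the measurability of the maximal function plays no role. *)
Lemma integral_maxop_le :
  (\int[@leb2 R]_x (mx x ^+ 2) <= (2 * (grid_const R * (1 + ln delta^-1) ^+ 3 * E))%:E)%E.
Proof.
rewrite ge0_integralTE; last by move=> x; apply: expe_ge0; exact: maxop_ge0.
apply: ge_ereal_sup => _ [h hm <-]; rewrite -integralT_nnsfun.
have [M [_ hM]] := simple_bounded h.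
have mh : measurable_fun setT h by [].
apply: (@integral_bounded_le h (M + 1) mh) => // x.
by apply: le_trans (ler_norm _) _; apply: hM; rewrite ?ltrDl.
Qed.
End Maximal.

(** The factor [1 + ln delta^-1] stands for the logarithm, which vanishes at [delta = 1]. Squaring
    the norms turns the exponent 3/2 into a cube. *)
Theorem theorem1p1 (R : realType) :
  exists C : R, 0 < C /\
  forall (w delta : R) (v : R -> R) (f : R * R -> R),
    0 < w -> w <= 1 -> 0 < delta -> delta <= 1 ->
    (forall a, 0 <= v a <= 1) -> measurable_fun setT v ->
    measurable_fun setT f ->
    (\int[@leb2 R]_x (`|f x| ^+ 2)%:E < +oo)%E ->
    (\int[@leb2 R]_x ((maxop (Rdelta w delta (fun p => v p.1)) f x) ^+ 2)
      <= ((C * powR (1 + ln (delta^-1)) (3/2)) ^+ 2)%:E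
         * \int[@leb2 R]_x (`|f x| ^+ 2)%:E)%E.
Proof.
have g0 := grid_const_ge0 R.
(* The square of this constant dominates [2 * grid_const R], so no square root has to be taken. *)
exists (1 + 2 * grid_const R); split; first by rewrite ltr_wpDr // mulr_ge0.
move=> w delta v f w0 _ delta0 delta1 v01 mv mf fin.
have I0 : (0 <= \int[@leb2 R]_x (`|f x| ^+ 2)%:E)%E.
  by apply: integral_ge0 => x _; rewrite lee_fin sqr_ge0.
have [E fE] : exists E, (\int[@leb2 R]_x (`|f x| ^+ 2)%:E = E%:E)%E.
  by exists (fine (\int[@leb2 R]_x (`|f x| ^+ 2)%:E)%E); rewrite fineK // ge0_fin_numE.
rewrite fE in I0 *.
apply: le_trans (integral_maxop_le w0 delta0 delta1 v01 mv mf fE) _.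
rewrite -EFinM lee_fin mulrA exprMn.
have L0 : 0 <= 1 + ln delta^-1 by rewrite addr_ge0 // ln_ge0 // invf_ge1.
have -> : powR (1 + ln delta^-1) (3 / 2) ^+ 2 = (1 + ln delta^-1) ^+ 3.
  by rewrite -powR_mulrn ?powR_ge0 // -powRrM divfK // powR_mulrn.
rewrite ler_wpM2r // mulrA ler_wpM2r ?exprn_ge0 //.
move: (grid_const R) g0 => g g0; rewrite expr2; nra.
Qed.
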